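(* Let $\beta\in Q_n^+$ and $\nu\in I^\beta$. Assume $\Lambda=\Lambda_{t_1}+\cdots+\Lambda_{t_l}$, where $t_i\in I$ for each $1\le i\le l$. Then $e(\nu)\ne 0$ in $\mathcal R^\Lambda(\beta)$ if and only if $\nu$ is a shuffle of some $l$-tuple $(\nu^1,\nu^2,\dots,\nu^l)$ of (possibly empty) tuples of elements of $I$ such that $\beta=\beta_{\nu^1}+\cdots+\beta_{\nu^l}$ and $e(\nu^i)\ne 0$ in $\mathcal R^{\Lambda_{t_i}}(\beta_{\nu^i})$ for each $1\le i\le l$.
   Context: Setting. $A=(a_{ij})_{i,j\in I}$ is a symmetrizable generalized Cartan matrix and $d_i\in\mathbb{Z}_{>0}$ ($i\in I$) are such that $(d_ia_{ij})$ is symmetric. $(P,\Pi,\Pi^\vee)$ is a realization of $A$: $P$ is a free abelian group, $\Pi=\{\alpha_i\mid i\in I\}\subset P$ and $\Pi^\vee=\{h_i\mid i\in I\}\subset \mathrm{Hom}_{\mathbb Z}(P,\mathbb Z)$ are linearly independent sets and $\langle\alpha_j,h_i\rangle=a_{ij}$. There is a symmetric bilinear pairing $(-|-)$ on $P$ with $(\alpha_j|\alpha_i)=d_ia_{ij}$ and $(\Lambda|\alpha_i)=d_i\langle\Lambda,h_i\rangle$ for $\Lambda\in P$. $P^+=\{\Lambda\in P\mid\langle\Lambda,h_i\rangle\ge 0\ \forall i\in I\}$, $Q^+=\bigoplus_{i\in I}\mathbb{N}\alpha_i$ with $\mathbb N=\{0,1,2,\dots\}$; for $\beta=\sum k_i\alpha_i\in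 Q^+$ put $|\beta|=\sum k_i$; $Q_n^+=\{\beta\in Q^+\mid|\beta|=n\}$. For $\beta\in Q^+_n$, $I^\beta=\{\nu\in I^n\mid\sum_{i=1}^n\alpha_{\nu_i}=\beta\}$. $\mathfrak S_n$ is the symmetric group (products are compositions of maps), $s_r=(r,r+1)$, and it acts on $I^n$ by $w\nu=(\nu_{w^{-1}(1)},\dots,\nu_{w^{-1}(n)})$. For $i\in I$, $\Lambda_i\in P^+$ denotes the $i$th fundamental weight: $\langle\Lambda_i,h_j\rangle=\delta_{ij}$ for all $j\in I$. Let $K$ be a field. For $i,j\in I$ let $Q_{i,j}(u,v)\in K[u,v]$ with $Q_{i,i}=0$, and for $i\ne j$, $Q_{i,j}(u,v)=\sum t_{i,j;p,q}u^pv^q$, summed over $p,q\in\mathbb N$ with $p(\alpha_i|\alpha_i)+q(\alpha_j|\alpha_j)+2(\alpha_i|\alpha_j)=0$, where $t_{i,j;p,q}\in K$, $t_{i,j;-a_{ij},0}\in K^\times$ and $Q_{i,j}(u,v)=Q_{j,i}(v,u)$. The quiver Hecke algebra $\mathcal R(\beta)$, $\beta\in Q_n^+$, is the unital associative $K$-algebra with generators $\psi_1,\dots,\psi_{n-1},x_1,\dots,x_n,e(\nu)$ ($\nu\in I^\beta$) and relations: $e(\nu)e(\nu')=\delta_{\nu\nu'}e(\nu)$; $\sum_{\nu\in I^\beta}e(\nu)=1$; $x_re(\nu)=e(\nu)x_r$; $\psi_re(\nu)=e(s_r\nu)\psi_r$; $x_rx_s=x_sx_r$; $\psi_rx_{r+1}e(\nu)=(x_r\psi_r+\delta_{\nu_r\nu_{r+1}})e(\nu)$;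 $x_{r+1}\psi_re(\nu)=(\psi_rx_r+\delta_{\nu_r\nu_{r+1}})e(\nu)$; $\psi_rx_s=x_s\psi_r$ if $s\ne r,r+1$; $\psi_r\psi_s=\psi_s\psi_r$ if $|r-s|>1$; $\psi_r^2e(\nu)=Q_{\nu_r,\nu_{r+1}}(x_r,x_{r+1})e(\nu)$; $(\psi_{r+1}\psi_r\psi_{r+1}-\psi_r\psi_{r+1}\psi_r)e(\nu)=\delta_{\nu_r\nu_{r+2}}\frac{Q_{\nu_r,\nu_{r+1}}(x_r,x_{r+1})-Q_{\nu_r,\nu_{r+1}}(x_{r+2},x_{r+1})}{x_r-x_{r+2}}e(\nu)$. For $\Lambda\in P^+$, the cyclotomic quiver Hecke algebra $\mathcal R^\Lambda(\beta)$ is the quotient of $\mathcal R(\beta)$ by the two-sided ideal generated by $x_1^{\langle\Lambda,h_{\nu_1}\rangle}e(\nu)$, $\nu\in I^\beta$. For $\beta=0$, $\mathcal R^\Lambda(0)=K$ with $e(\emptyset)=1$. Notation. For a tuple $\nu=(\nu_1,\dots,\nu_k)$ of elements of $I$, $\beta_\nu=\sum_{i=1}^k\alpha_{\nu_i}$. A tuple $\nu\in I^n$ is a shuffle of $(\nu^1,\dots,\nu^l)$ if $\{1,\dots,n\}$ can be partitioned into $l$ (possibly empty) subsets such that the subsequence of $\nu$ on the $i$th subset (in increasing order of positions) is $\nu^i$, for each $i$. *)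

(* Defs.v *)
From HB Require Import structures.
From mathcomp Require Import all_boot all_order all_algebra fingroup perm.
Import generic_quotient.
From mathcomp Require Import boolp.
From mathcomp.multinomials Require Import monalg.

Set Implicit Arguments.
Unset Strict Implicit.
Unset Printing Implicit Defensive.

Import GRing.Theory Num.Theory.
Local Open Scope ring_scope.
Local Open Scope quotient_scope.

(* MathComp's algType requires 1 != 0, but a cyclotomic quotient may be the   *)
(* zero ring. Here a K-algebra is a ring with a central morphism from K.      *)
HB.mixin Record isPzAlg (K : pzRingType) A of GRing.PzRing A := {
  pz_scalar : {rmorphism K -> A};
  pz_scalarC : forall c (u : A), pz_scalar c * u = u * pz_scalar c
}.

#[short(type="pzAlgType")]
HB.structure Definition PzAlg (K : pzRingType) :=
  { A of GRing.PzRing A & isPzAlg K A }.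

Inductive in_ideal (A : pzRingType) (S : A -> Prop) : A -> Prop :=
| in_ideal_gen x : S x -> in_ideal S x
| in_ideal0 : in_ideal S 0
| in_idealD x y : in_ideal S x -> in_ideal S y -> in_ideal S (x + y)
| in_idealM a x b : in_ideal S x -> in_ideal S (a * x * b).

Section QuotientAlgebra.
Variables (K : pzRingType) (A : pzAlgType K) (S : A -> Prop).

Lemma in_idealN x : in_ideal S x -> in_ideal S (- x).
Proof. by move=> Sx; rewrite -[- x]mulr1 mulNr -mulrN -[x]mul1r; apply: in_idealM. Qed.

Definition ideal_rel (x y : A) : bool := `[< in_ideal S (x - y) >].

Lemma ideal_relP : equiv_class_of ideal_rel.
Proof.
split=> [x|x y|y x z]; rewrite /ideal_rel.
- by apply/asboolP; rewrite subrr; apply: in_ideal0.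
- by apply/asboolP/asboolP => /in_idealN; rewrite opprB.
- move=> /asboolP xy /asboolP yz; apply/asboolP.
  by rewrite -(subrKA y); apply: in_idealD.
Qed.

Canonical ideal_rel_equiv := EquivRelPack ideal_relP.
Canonical ideal_rel_encModRel := defaultEncModRel ideal_rel.

Definition quot_alg := {eq_quot ideal_rel}.
HB.instance Definition _ : EqQuotient A ideal_rel quot_alg :=
  EqQuotient.on quot_alg.
HB.instance Definition _ := Choice.on quot_alg.

Lemma quot_algP (x y : A) :
  reflect (in_ideal S (x - y)) (x == y %[mod quot_alg]).
Proof. by rewrite piE; apply: asboolP. Qed.

Lemma repr_quot_alg (x : A) : in_ideal S (repr (\pi_quot_alg x) - x).
Proof. by apply/quot_algP; rewrite reprK. Qed.

Definition qzero : quot_alg := lift_cst quot_alg 0.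
Definition qone : quot_alg := lift_cst quot_alg 1.
Definition qopp := lift_op1 quot_alg -%R.
Definition qadd := lift_op2 quot_alg +%R.
Definition qmul := lift_op2 quot_alg *%R.

Canonical pi_qzero_morph := PiConst qzero.
Canonical pi_qone_morph := PiConst qone.

Lemma pi_qopp : {morph \pi : x / - x >-> qopp x}.
Proof.
move=> x; unlock qopp; apply/eqP; rewrite eq_sym; apply/quot_algP.
by rewrite -opprD; apply: in_idealN; apply: repr_quot_alg.
Qed.
Canonical pi_qopp_morph := PiMorph1 pi_qopp.

Lemma pi_qadd : {morph \pi : x y / x + y >-> qadd x y}.
Proof.
move=> x y; unlock qadd; apply/eqP; rewrite eq_sym; apply/quot_algP.
by rewrite opprD addrACA; apply: in_idealD; apply: repr_quot_alg.
Qed.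
Canonical pi_qadd_morph := PiMorph2 pi_qadd.

Lemma pi_qmul : {morph \pi : x y / x * y >-> qmul x y}.
Proof.
move=> x y; unlock qmul; apply/eqP; rewrite eq_sym; apply/quot_algP.
rewrite -(subrKA (x * repr (\pi_quot_alg y))) -mulrBl -mulrBr.
apply: in_idealD.
  by rewrite -[_ - x]mul1r; apply: in_idealM; apply: repr_quot_alg.
by rewrite -[_ * _]mulr1; apply: in_idealM; apply: repr_quot_alg.
Qed.
Canonical pi_qmul_morph := PiMorph2 pi_qmul.

Lemma qaddA : associative qadd.
Proof. by move=> x y z; rewrite -[x]reprK -[y]reprK -[z]reprK !piE addrA. Qed.

Lemma qaddC : commutative qadd.
Proof. by move=> x y; rewrite -[x]reprK -[y]reprK !piE addrC. Qed.

Lemma qadd0 : left_id qzero qadd.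
Proof. by move=> x; rewrite -[x]reprK !piE add0r. Qed.

Lemma qaddN : left_inverse qzero qopp qadd.
Proof. by move=> x; rewrite -[x]reprK !piE addNr. Qed.

HB.instance Definition _ :=
  GRing.isZmodule.Build quot_alg qaddA qaddC qadd0 qaddN.

Lemma qmulA : associative qmul.
Proof. by move=> x y z; rewrite -[x]reprK -[y]reprK -[z]reprK !piE mulrA. Qed.

Lemma qmul1l : left_id qone qmul.
Proof. by move=> x; rewrite -[x]reprK !piE mul1r. Qed.

Lemma qmul1r : right_id qone qmul.
Proof. by move=> x; rewrite -[x]reprK !piE mulr1. Qed.

Lemma qmulDl : left_distributive qmul qadd.
Proof.
by move=> x y z; rewrite -[x]reprK -[y]reprK -[z]reprK !piE mulrDl.
Qed.

Lemma qmulDr : right_distributive qmul qadd.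
Proof.
by move=> x y z; rewrite -[x]reprK -[y]reprK -[z]reprK !piE mulrDr.
Qed.

HB.instance Definition _ := GRing.Zmodule_isPzRing.Build quot_alg
  qmulA qmul1l qmul1r qmulDl qmulDr.

Definition to_quot (x : A) : quot_alg := \pi_quot_alg x.

Lemma to_quot_additive : zmod_morphism to_quot.
Proof. by move=> x y; rewrite /to_quot pi_qadd pi_qopp. Qed.

Lemma to_quot_multiplicative : monoid_morphism to_quot.
Proof. by split=> [|x y]; [exact: lock | rewrite /to_quot pi_qmul]. Qed.

HB.instance Definition _ :=
  GRing.isZmodMorphism.Build A quot_alg to_quot to_quot_additive.
HB.instance Definition _ :=
  GRing.isMonoidMorphism.Build A quot_alg to_quot to_quot_multiplicative.

Definition quot_scalar : K -> quot_alg := to_quot \o pz_scalar.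

HB.instance Definition _ := GRing.RMorphism.on quot_scalar.

Lemma quot_scalarC c (u : quot_alg) : quot_scalar c * u = u * quot_scalar c.
Proof.
rewrite -[u]reprK -[\pi_quot_alg _]/(to_quot _).
by rewrite -[quot_scalar c]/(to_quot (pz_scalar c)) -!rmorphM pz_scalarC.
Qed.

HB.instance Definition _ := isPzAlg.Build K quot_alg quot_scalarC.

Lemma to_quot_eq0 x : reflect (in_ideal S x) (to_quot x == 0).
Proof.
have -> : 0 = to_quot 0 by rewrite raddf0.
by rewrite -[x in in_ideal S x]subr0; apply: quot_algP.
Qed.

End QuotientAlgebra.

Section FreeAlgebra.
Variables (K : comNzRingType) (G : choiceType).

Definition free_alg : Type := {malg K[{fmonom G}]}.
HB.instance Definition _ := GRing.Lalgebra.on free_alg.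

Lemma free_alg_scalarC (c : K) (u : free_alg) :
  (c%:MP : free_alg) * u = u * (c%:MP : free_alg).
Proof.
rewrite [LHS]malgM_def [RHS]malgM_def fgmulUg fgmulgU.
by apply: eq_bigr => k _; rewrite mul1m mulm1 mulrC.
Qed.

HB.instance Definition _ :=
  isPzAlg.Build K free_alg (pz_scalar := @malgC {fmonom G} K) free_alg_scalarC.

Definition free_gen (g : G) : free_alg := << fmu g >>.

Definition presented_alg (rel : free_alg -> free_alg -> Prop) :=
  quot_alg (fun z : free_alg => exists u v, rel u v /\ z = u - v).

Definition presented_gen rel (g : G) : presented_alg rel :=
  to_quot _ (free_gen g).

End FreeAlgebra.

Definition Zfree (J : eqType) (M : zmodType) (v : J -> M) : Prop :=
  forall (s : seq J) (c : J -> int), uniq s ->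
    \sum_(j <- s) v j *~ c j = 0 -> {in s, forall j, c j = 0}.

Definition Zbasis (J : eqType) (M : zmodType) (v : J -> M) : Prop :=
  Zfree v /\
  forall x : M, exists (s : seq J) (c : J -> int), x = \sum_(j <- s) v j *~ c j.

Definition free_abelian (M : zmodType) : Prop :=
  exists (J : eqType) (v : J -> M), Zbasis v.

(* Linear independence in Hom(P, int), the functionals being compared         *)
(* pointwise.                                                                 *)
Definition Zfree_dual (J : eqType) (M : zmodType)
    (f : J -> {additive M -> int}) : Prop :=
  forall (s : seq J) (c : J -> int), uniq s ->
    (forall x, \sum_(j <- s) f j x *~ c j = 0) -> {in s, forall j, c j = 0}.

Section RootData.
Variables (I : choiceType) (a : I -> I -> int) (d : I -> nat).

Definition gen_cartan_matrix : Prop :=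
  [/\ forall i, a i i = 2,
      forall i j, i != j -> a i j <= 0
    & forall i j, a i j = 0 <-> a j i = 0].

Definition symmetrizer : Prop :=
  (forall i, (0 < d i)%N) /\
  forall i j, (d i)%:Z * a i j = (d j)%:Z * a j i.

Variables (P : zmodType) (alpha : I -> P) (h : I -> {additive P -> int}).

Definition realization : Prop :=
  [/\ free_abelian P, Zfree alpha, Zfree_dual h
    & forall i j, h i (alpha j) = a i j].

Definition weight_pairing (form : P -> P -> rat) : Prop :=
  [/\ forall x y, form x y = form y x,
      forall x y z, form (x + y) z = form x z + form y z,
      forall i j, form (alpha j) (alpha i) = ((d i)%:Z * a i j)%:~R
    & forall Lam i, form Lam (alpha i) = ((d i)%:Z * h i Lam)%:~R].

Definition dominant (Lam : P) : Prop := forall i, 0 <= h i Lam.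

Definition fundamental_weights (fund : I -> P) : Prop :=
  forall i, dominant (fund i) /\ forall j, h j (fund i) = (i == j)%:R.

(* beta = sum_i k_i alpha_i with k_i in nat and sum_i k_i = n.                *)
Definition in_Qplus (n : nat) (beta : P) : Prop :=
  exists (s : seq I) (k : I -> nat),
    [/\ uniq s, (\sum_(i <- s) k i)%N = n & beta = \sum_(i <- s) alpha i *+ k i].

End RootData.

(* The coefficient t_{i,j;p,q} of u^p v^q in Q_{i,j}(u,v) is (Q i j)`_p`_q:   *)
(* the outer variable of {poly {poly K}} is u.                                *)
Definition klr_polys (K : fieldType) (I : choiceType) (a : I -> I -> int)
    (P : zmodType) (alpha : I -> P) (form : P -> P -> rat)
    (Q : I -> I -> {poly {poly K}}) : Prop :=
  [/\ forall i, Q i i = 0,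
      forall i j, i != j -> forall p q, (Q i j)`_p`_q != 0 ->
        p%:R * form (alpha i) (alpha i) + q%:R * form (alpha j) (alpha j)
          + 2 * form (alpha i) (alpha j) = 0,
      forall i j, i != j -> (Q i j)`_`|- a i j|%N`_0 != 0
    & forall i j, Q i j = swapXY (Q j i)].

Section Evaluation.
Variables (K : comNzRingType) (A : lalgType K) (q : {poly {poly K}}).

Definition eval2 (u v : A) : A :=
  \sum_(k < size q) \sum_(m < size q`_k) q`_k`_m *: (u ^+ k * v ^+ m).

(* (q(u,v) - q(w,v)) / (u - w), see ddiffE.                                   *)
Definition ddiff (u v w : A) : A :=
  \sum_(k < size q) \sum_(m < size q`_k) q`_k`_m *:
    ((\sum_(b < k) u ^+ (k.-1 - b) * w ^+ b) * v ^+ m).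

End Evaluation.

Lemma ddiffE (K : comNzRingType) (A : comAlgType K) (q : {poly {poly K}})
    (u v w : A) :
  (u - w) * ddiff q u v w = eval2 q u v - eval2 q w v.
Proof.
rewrite /ddiff /eval2 -sumrB mulr_sumr; apply: eq_bigr => k _.
rewrite -sumrB mulr_sumr; apply: eq_bigr => m _.
by rewrite -scalerAr mulrA -subrXX -scalerBr mulrBl.
Qed.

Section Sequences.
Variables (I : choiceType) (P : zmodType) (alpha : I -> P).

Definition seq_wt (s : seq I) : P := \sum_(i <- s) alpha i.

Definition Ibeta (n : nat) (beta : P) : Type :=
  {nu : n.-tuple I | seq_wt nu == beta}.
HB.instance Definition _ n beta := Choice.on (Ibeta n beta).

Definition nth_Ibeta n beta (nu : Ibeta n beta) (r : 'I_n) : I :=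
  tnth (val nu) r.

Definition perm_act n (w : 'S_n) (nu : n.-tuple I) : n.-tuple I :=
  [tuple tnth nu ((w^-1)%g r) | r < n].

Lemma seq_wt_perm_act n (w : 'S_n) (nu : n.-tuple I) :
  seq_wt (perm_act w nu) = seq_wt nu.
Proof.
rewrite /seq_wt !big_tuple (reindex_inj (@perm_inj _ w)) /=.
by apply: eq_bigr => r _; rewrite tnth_mktuple permK.
Qed.

Definition Ibeta_act n beta (w : 'S_n) (nu : Ibeta n beta) : Ibeta n beta :=
  exist _ (perm_act w (val nu))
    (etrans (congr1 (eq_op^~ beta) (seq_wt_perm_act w (val nu))) (valP nu)).

Definition seq_Ibeta (s : seq I) : Ibeta (size s) (seq_wt s) :=
  exist _ (in_tuple s) (eqxx _).

Lemma seq_wt_count (s nu : seq I) : uniq s -> {subset nu <= s} ->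
  seq_wt nu = \sum_(j <- s) alpha j *+ count_mem j nu.
Proof.
move=> s_uniq; elim: nu => [|i nu IHnu] nu_s.
  by rewrite /seq_wt big_nil big1 // => j _; rewrite mulr0n.
rewrite /seq_wt big_cons -/(seq_wt nu) IHnu => [|j j_nu]; last first.
  by apply: nu_s; rewrite in_cons j_nu orbT.
rewrite /=; under [RHS]eq_bigr do rewrite mulrnDr.
rewrite big_split; congr (_ + _) => /=.
rewrite (bigD1_seq i) ?eqxx ?mulr1n ?nu_s ?mem_head //= big1 ?addr0 // => j.
by rewrite eq_sym => /negbTE ->.
Qed.

Lemma seq_wt_inj (nu nu' : seq I) : Zfree alpha ->
  seq_wt nu = seq_wt nu' -> perm_eq nu nu'.
Proof.
move=> alpha_free wtE; pose s := undup (nu ++ nu').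
have s_uniq : uniq s by apply: undup_uniq.
have count_eq j : j \in s -> (count_mem j nu)%:Z - (count_mem j nu')%:Z = 0.
  apply: (alpha_free s (fun j => (count_mem j nu)%:Z - (count_mem j nu')%:Z)) => //.
  under eq_bigr do rewrite mulrzBr -!pmulrn.
  rewrite sumrB -!seq_wt_count ?wtE ?subrr // => i i_nu.
    by rewrite mem_undup mem_cat i_nu orbT.
  by rewrite mem_undup mem_cat i_nu.
apply/allP => j; rewrite -[j \in _]mem_undup => /count_eq/eqP.
by rewrite subr_eq0.
Qed.

(* I^beta is finite, so that the relation sum_nu e(nu) = 1 is not vacuous.    *)
Lemma Ibeta_finite n beta : Zfree alpha ->
  exists s : seq (Ibeta n beta), uniq s /\ forall nu, nu \in s.
Proof.
move=> alpha_free.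
case: (pselect (exists nu : Ibeta n beta, True)) => [[nu0 _]|no_nu]; last first.
  by exists [::]; split=> // nu; case: no_nu; exists nu.
pose perms : seq (n.-tuple I) := pmap insub (permutations (val nu0)).
exists (undup (pmap insub perms)).
split=> [|nu]; first exact: undup_uniq.
rewrite mem_undup mem_pmap_sub /= mem_pmap_sub /= mem_permutations.
by apply: seq_wt_inj => //; rewrite (eqP (valP nu)) (eqP (valP nu0)).
Qed.

End Sequences.

(* 0-based indices: for r < n-1, the positions r and r+1 and s_r = (r, r+1).  *)
Definition pos_l n (r : 'I_n.-1) : 'I_n := widen_ord (leq_pred n) r.
Fact pos_r_subproof n (r : 'I_n.-1) : (r.+1 < n)%N.
Proof. by case: n r => [|n] r; [case: r | rewrite ltnS; apply: ltn_ord]. Qed.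
Definition pos_r n (r : 'I_n.-1) : 'I_n := Ordinal (pos_r_subproof r).
Definition simple_perm n (r : 'I_n.-1) : 'S_n := tperm (pos_l r) (pos_r r).

Section QuiverHecke.
Variables (K : fieldType) (I : choiceType) (Q : I -> I -> {poly {poly K}}).
Variables (P : zmodType) (alpha : I -> P) (n : nat) (beta : P).

Local Notation Ib := (Ibeta alpha n beta).

Definition qh_index : choiceType := ('I_n.-1 + 'I_n + Ib)%type.
Definition psi_index (r : 'I_n.-1) : qh_index := inl (inl r).
Definition x_index (r : 'I_n) : qh_index := inl (inr r).
Definition e_index (nu : Ib) : qh_index := inr nu.

Local Notation psi r := (free_gen K (psi_index r)).
Local Notation x r := (free_gen K (x_index r)).
Local Notation e nu := (free_gen K (e_index nu)).
Local Notation delta i j := ((i == j)%:R).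

Inductive qh_rel : free_alg K qh_index -> free_alg K qh_index -> Prop :=
| qh_ee nu nu' : qh_rel (e nu * e nu') ((nu == nu')%:R * e nu)
| qh_sum_e (s : seq Ib) : uniq s -> (forall nu, nu \in s) ->
    qh_rel (\sum_(nu <- s) e nu) 1
| qh_xe r nu : qh_rel (x r * e nu) (e nu * x r)
| qh_psie r nu :
    qh_rel (psi r * e nu) (e (Ibeta_act (simple_perm r) nu) * psi r)
| qh_xx r s : qh_rel (x r * x s) (x s * x r)
| qh_psix r nu :
    qh_rel (psi r * x (pos_r r) * e nu)
      ((x (pos_l r) * psi r
        + delta (nth_Ibeta nu (pos_l r)) (nth_Ibeta nu (pos_r r))) * e nu)
| qh_xpsi r nu :
    qh_rel (x (pos_r r) * psi r * e nu)
      ((psi r * x (pos_l r)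
        + delta (nth_Ibeta nu (pos_l r)) (nth_Ibeta nu (pos_r r))) * e nu)
| qh_psix_far r s : s != pos_l r -> s != pos_r r ->
    qh_rel (psi r * x s) (x s * psi r)
| qh_psipsi_far (r s : 'I_n.-1) : (r.+1 < s)%N || (s.+1 < r)%N ->
    qh_rel (psi r * psi s) (psi s * psi r)
| qh_psi2 r nu :
    qh_rel (psi r ^+ 2 * e nu)
      (eval2 (Q (nth_Ibeta nu (pos_l r)) (nth_Ibeta nu (pos_r r)))
        (x (pos_l r)) (x (pos_r r)) * e nu)
| qh_braid (r r' : 'I_n.-1) nu : r' = r.+1 :> nat ->
    qh_rel
      ((psi r' * psi r * psi r' - psi r * psi r' * psi r) * e nu)
      (delta (nth_Ibeta nu (pos_l r)) (nth_Ibeta nu (pos_r r'))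
       * ddiff (Q (nth_Ibeta nu (pos_l r)) (nth_Ibeta nu (pos_r r)))
           (x (pos_l r)) (x (pos_r r)) (x (pos_r r')) * e nu).

Definition quiver_hecke : pzAlgType K := presented_alg qh_rel.

Definition qh_psi r : quiver_hecke := presented_gen qh_rel (psi_index r).
Definition qh_x r : quiver_hecke := presented_gen qh_rel (x_index r).
Definition qh_e nu : quiver_hecke := presented_gen qh_rel (e_index nu).

Variables (h : I -> {additive P -> int}) (Lam : P).

(* For dominant Lam, `|_| is the conversion of <Lam, h_i> to nat. There is no *)
(* generator when n = 0.                                                      *)
Definition cyc_gen (z : quiver_hecke) : Prop :=
  exists (r : 'I_n) (nu : Ib),
    r = 0%N :> nat /\ z = qh_x r ^+ `|h (nth_Ibeta nu r) Lam|%N * qh_e nu.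

Definition cyclotomic_qh : pzAlgType K := quot_alg cyc_gen.

Definition cyc_e (nu : Ib) : cyclotomic_qh := to_quot cyc_gen (qh_e nu).

End QuiverHecke.

(* enum lists a set of positions in increasing order.                         *)
Definition is_shuffle (T : Type) (n l : nat) (nu : n.-tuple T)
    (nus : 'I_l -> seq T) : Prop :=
  exists B : 'I_l -> {set 'I_n},
    [/\ forall k k', k != k' -> [disjoint B k & B k'],
        \bigcup_k B k = [set: 'I_n]
      & forall k, [seq tnth nu p | p <- enum (B k)] = nus k].

(* Main.v *)
Require Import Defs.
From HB Require Import structures.
From mathcomp Require Import all_boot all_order all_algebra perm finmap.
From mathcomp Require Import boolp classical_sets functions.
From mathcomp.multinomials Require Import monalg.
From mathcomp Require Import zify ring.

Set Implicit Arguments.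
Unset Strict Implicit.
Unset Printing Implicit Defensive.

Import GRing.Theory Num.Theory.
Local Open Scope ring_scope.

(** For dominant weights [a] and [w], the label sequences whose idempotent
    survives in the cyclotomic quotient for [a + w] are the shuffles of one such
    sequence for [a] with one such sequence for [w] ([alive_split]); the theorem
    is the iteration of this fact over the fundamental weights
    ([alive_colouring]).

    Modules are handled as families of subspaces indexed by label sequences,
    the space of [mu] playing the part of the image of e(mu), with dots and
    crossings as operators ([qhmod]). Crossings may be restricted to those that
    avoid the position [k]; this gives modules over the parabolic subalgebra of
    the first [k] and the last [n - k] strands. An idempotent that is zero in
    the cyclotomic quotient kills its space in every module where the first dot
    satisfies the cyclotomic relation ([cyc_vanish]), and the cyclotomic
    quotient itself is such a module ([cyc_qhring], [action_qhmod]). If a family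
    [N] inside a module is stable for the parabolic subalgebra, the submodule
    that it generates is spanned by [N] under the crossing words of the minimal
    coset representatives ([induced_stable], [induced_sum]).

    A surviving sequence is a shuffle ([forward_aux]). In a module for [a + w],
    let [dotted k] consist of the vectors on which every one of the first [k]
    strands, with label [i] say, has received [w i] dots. It is stable for the
    parabolic subalgebra, since a crossing commutes with symmetric monomials. On
    [dotted k] the first dot satisfies the relation for [a], and the first dot
    of the second block satisfies the relation for [w] modulo the submodule
    generated by [dotted k.+1]. If no splitting of [s] into two subsequences
    survives for [a] and [w], every vector labelled [s] therefore descends from
    the submodule generated by [dotted k] to the one generated by [dotted k.+1],
    for each [k], and in the end it is zero.

    A shuffle of surviving sequences survives ([shuffle_not_vanishing]). The
    tensor product of the two cyclotomic quotients is a module over the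
    parabolic subalgebra with a nonzero vector [t0] at the concatenated sequence
    ([tensor_neq0]). Its induced module satisfies the relation for [a + w]: the
    dots on the first strand meet either the first strand of the first block or
    that of the second one ([induced_cyc]). It remains to see that inducing does
    not kill [t0], which usually rests on the basis theorem. The substitute is
    the generic representation of the whole algebra on functions on the
    arrangements of coloured strands, where a dot acts by a scalar depending on
    the colour ([gen_qhmod]). There the coset words are linearly independent
    ([word_free]), and the only relations satisfied by the base vector are those
    that hold in every module ([faithfulP]). The submodule generated by the pair
    of [t0] and the base vector is thus the graph of a map from a parabolic
    submodule [E] of the generic representation, with kernel [N], and the
    induced module is realized as the quotient of the submodule generated by [E]
    by the one generated by [N]. *)

(** * Adjacent transpositions of sequences *)

Section Swap.
Variable T : Type.
Implicit Types (s : seq T) (b : bitseq) (r : nat).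

Fixpoint swp r s : seq T :=
  match r, s with
  | 0, u :: v :: s' => v :: u :: s'
  | r'.+1, u :: s' => u :: swp r' s'
  | _, _ => s
  end.

Arguments swp : simpl nomatch.

Lemma size_swp r s : size (swp r s) = size s.
Proof. by elim: r s => [|r IH] [|u s] //=; [case: s | rewrite IH]. Qed.

Lemma swpK r : involutive (swp r).
Proof. by elim: r => [|r IH] [|u s] //=; [case: s | rewrite IH]. Qed.

Lemma nth_swp d r s i : (r.+1 < size s)%N ->
  nth d (swp r s) i =
  if i == r then nth d s r.+1 else if i == r.+1 then nth d s r else nth d s i.
Proof.
elim: r s i => [|r IH] [|u s] i //=; first by case: s => [|v s] //=; case: i => [|[|i]].
by rewrite ltnS => hs; case: i => [|i] //=; rewrite IH.
Qed.

Lemma swp_id d r s : (r.+1 < size s)%N -> nth d s r = nth d s r.+1 -> swp r s = s.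
Proof.
move=> hs e; apply: (@eq_from_nth _ d); rewrite size_swp // => i _.
by rewrite nth_swp //; case: eqP => [->//|_]; case: eqP => [->|].
Qed.

Lemma swp_far r r' s : (r.+1 < r')%N -> swp r (swp r' s) = swp r' (swp r s).
Proof.
elim: r r' s => [|r IH] [|[|r']] // [|u s] //=; first by case: s.
by move=> h; rewrite IH.
Qed.

Lemma swp_braid r s : (r.+2 < size s)%N ->
  swp r.+1 (swp r (swp r.+1 s)) = swp r (swp r.+1 (swp r s)).
Proof.
elim: r s => [|r IH] [|u s] //=; first by case: s => [|v [|w s]].
by move=> h; rewrite IH.
Qed.

Lemma take_swp r k s : (k <= r)%N -> take k (swp r s) = take k s.
Proof.
elim: r k s => [|r IH] [|k] [|u s] //=; rewrite ?take0 //.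
by rewrite ltnS => h; rewrite IH.
Qed.

Lemma take_swp_in r k s : (r.+1 < k)%N -> take k (swp r s) = swp r (take k s).
Proof.
elim: r k s => [|r IH] [|[|k]] [|u s] //; first by case: s.
by rewrite ltnS => h; rewrite /= -IH.
Qed.

Lemma drop_swp r k s : (r.+1 < k)%N -> drop k (swp r s) = drop k s.
Proof.
elim: r k s => [|r IH] [|[|k]] [|u s] //; first by case: s.
by rewrite ltnS => h; rewrite /= IH.
Qed.

Lemma drop_swp_in r k s : drop k (swp (k + r) s) = swp r (drop k s).
Proof. by elim: k s => [|k IH] [|u s] //=; rewrite ?drop0 //; case: r {IH}. Qed.

Lemma swp_cat s t r : swp (size s + r) (s ++ t) = s ++ swp r t.
Proof. by elim: s => [|u s IH] //=; rewrite -IH. Qed.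

Lemma swp_cat_l s t r : (r.+1 < size s)%N -> swp r (s ++ t) = swp r s ++ t.
Proof.
elim: s r => [|u s IH] [|r] //=; first by case: s {IH} => [|v s].
by move=> h; rewrite IH.
Qed.

End Swap.

Lemma map_swp (T U : Type) (f : T -> U) r s : map f (swp r s) = swp r (map f s).
Proof. by elim: r s => [|r IH] [|u s] //=; [case: s | rewrite IH]. Qed.

Lemma perm_swp (T : eqType) r (s : seq T) : perm_eq (swp r s) s.
Proof.
elim: r s => [|r IH] [|u s] //=; last by rewrite perm_cons; apply: IH.
case: s => [|v s] //=.
by rewrite -[[:: v, u & s]]/([:: v; u] ++ s) -[[:: u, v & s]]/([:: u; v] ++ s) perm_cat2r perm_sym (perm_catC [:: u] [:: v]).
Qed.

Lemma mask_swp (T : Type) r b (s : seq T) : size b = size s ->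
  nth false b r != nth false b r.+1 -> mask (swp r b) (swp r s) = mask b s.
Proof.
elim: r b s => [|r IH] [|c b] [|u s] //=; first by case: b s => [|c' b] [|v s] //=; case: c; case: c'.
by move=> [hs] h; rewrite !IH.
Qed.

(** The number of pairs of positions carrying [false] before [true]: the
    length of the minimal coset representative encoded by [b]. *)
Fixpoint inv (b : bitseq) : nat :=
  if b is c :: b' then ((if c then 0 else count id b') + inv b')%N else 0%N.

Lemma count_swp r b : count id (swp r b) = count id b.
Proof. by apply/seq.permP/perm_swp. Qed.

Lemma inv_swp r b : nth false b r -> ~~ nth false b r.+1 -> (r.+1 < size b)%N ->
  inv (swp r b) = (inv b).+1.
Proof.
elim: r b => [|r IH] [|c b] //=; first by case: b => [|[] b] //=; case: c => //= *; lia.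
by move=> h1 h2 hs; rewrite IH // count_swp addnS.
Qed.

Lemma inv_swp_le r b : (inv (swp r b) <= (inv b).+1)%N.
Proof.
elim: r b => [|r IH] [|c b] //=; first by case: b => [|[] b] //=; case: c => //=; lia.
by rewrite count_swp -addnS leq_add2l.
Qed.

(** * Modules graded by label sequences *)

Section Modules.
Variables (K : fieldType) (I : choiceType) (Q : I -> I -> {poly {poly K}}).
Variable i0 : I.

Definition bits (n k : nat) : seq bitseq :=
  [seq b <- [seq val t | t : n.-tuple bool] | count id b == k].

Lemma mem_bits n k b : (b \in bits n k) = (size b == n) && (count id b == k).
Proof.
rewrite mem_filter andbC; congr andb; apply/mapP/eqP => [[t _ ->]|h].
  exact: size_tuple.
by subst n; exists (in_tuple b); rewrite ?mem_enum.
Qed.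

Lemma bits_uniq n k : uniq (bits n k).
Proof. by rewrite filter_uniq // map_inj_uniq ?enum_uniq //; apply: val_inj. Qed.

Section Operators.
Variable V : lmodType K.
Implicit Types (X Y Z x p : nat -> V -> V) (S : V -> Prop).

Definition subsp S : Prop :=
  S 0 /\ forall c u v, S u -> S v -> S (c *: u + v).

Lemma subspD S u v : subsp S -> S u -> S v -> S (u + v).
Proof. by move=> [_ h] Su Sv; rewrite -[u]scale1r; apply: h. Qed.

Lemma subspZ S c u : subsp S -> S u -> S (c *: u).
Proof. by move=> [h0 h] Su; rewrite -[_ *: _]addr0; apply: h. Qed.

Lemma subspN S u : subsp S -> S u -> S (- u).
Proof. by move=> hS Su; rewrite -scaleN1r; apply: subspZ. Qed.

Lemma subspB S u v : subsp S -> S u -> S v -> S (u - v).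
Proof. by move=> hS Su Sv; apply: subspD => //; apply: subspN. Qed.

Lemma subsp_sum S (J : Type) (r : seq J) (P : pred J) (F : J -> V) :
  subsp S -> (forall j, P j -> S (F j)) -> S (\sum_(j <- r | P j) F j).
Proof.
move=> hS hF; elim/big_rec: _ => [|j u Pj Su]; first by case: hS.
by apply: subspD => //; apply: hF.
Qed.

(** The operators given by a two-variable polynomial and by its divided
    difference in the first variable. The operators need not commute on the
    whole space, so that an order of composition has to be fixed. *)
Definition op_eval2 (q : {poly {poly K}}) (X Y : V -> V) (v : V) : V :=
  \sum_(k < size q) \sum_(m < size q`_k) q`_k`_m *: iter k X (iter m Y v).

Definition op_ddiff (q : {poly {poly K}}) (X Y Z : V -> V) (v : V) : V :=
  \sum_(k < size q) \sum_(m < size q`_k)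
    q`_k`_m *: \sum_(b < k) iter (k.-1 - b) X (iter b Z (iter m Y v)).

Lemma iter_in S (f : V -> V) m v :
  (forall u, S u -> S (f u)) -> S v -> S (iter m f v).
Proof. by move=> hf Sv; elim: m => //= m; apply: hf. Qed.

Lemma op_eval2_in S q (X Y : V -> V) v : subsp S ->
  (forall u, S u -> S (X u)) -> (forall u, S u -> S (Y u)) ->
  S v -> S (op_eval2 q X Y v).
Proof.
move=> hS hX hY Sv; apply: subsp_sum => // j1 _; apply: subsp_sum => // j2 _.
by apply: subspZ => //; apply: iter_in => //; apply: iter_in.
Qed.

Lemma op_ddiff_in S q (X Y Z : V -> V) v : subsp S ->
  (forall u, S u -> S (X u)) -> (forall u, S u -> S (Y u)) ->
  (forall u, S u -> S (Z u)) -> S v -> S (op_ddiff q X Y Z v).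
Proof.
move=> hS hX hY hZ Sv; apply: subsp_sum => // j1 _; apply: subsp_sum => // j2 _.
apply: subspZ => //; apply: subsp_sum => // j3 _.
by apply: iter_in => //; apply: iter_in => //; apply: iter_in.
Qed.

Definition linop (f : V -> V) := forall c u v, f (c *: u + v) = c *: f u + f v.

Lemma linop0 f : linop f -> f 0 = 0.
Proof. by move=> hf; have := hf (-1) 0 0; rewrite !scaleN1r !addNr. Qed.
Lemma linopD f u v : linop f -> f (u + v) = f u + f v.
Proof. by move=> hf; rewrite -[u]scale1r hf !scale1r. Qed.
Lemma linopZ f c u : linop f -> f (c *: u) = c *: f u.
Proof. by move=> hf; rewrite -[c *: u]addr0 hf linop0 // addr0. Qed.
Lemma linopN f u : linop f -> f (- u) = - f u.
Proof. by move=> hf; rewrite -scaleN1r linopZ // scaleN1r. Qed.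
Lemma linopB f u v : linop f -> f (u - v) = f u - f v.
Proof. by move=> hf; rewrite linopD // linopN. Qed.
Lemma linopMn f u k : linop f -> f (u *+ k) = f u *+ k.
Proof. by move=> hf; rewrite -!scaler_nat linopZ. Qed.
Lemma linop_sum f (J : Type) (r : seq J) (P : pred J) (F : J -> V) : linop f ->
  f (\sum_(j <- r | P j) F j) = \sum_(j <- r | P j) f (F j).
Proof.
by move=> hf; apply: (big_morph f) => [u v|]; [apply: linopD|apply: linop0].
Qed.
Lemma linop_iter f m : linop f -> linop (iter m f).
Proof. by move=> hf; elim: m => //= m IH c u v /=; rewrite IH hf. Qed.

Record stable (n : nat) (D : pred nat) (x p : nat -> V -> V)
    (N : seq I -> V -> Prop) : Prop := Stable {
  st_sub mu : subsp (N mu);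
  st_x r mu v : size mu = n -> (r < n)%N -> N mu v -> N mu (x r v);
  st_p r mu v : size mu = n -> (r.+1 < n)%N -> D r -> N mu v -> N (swp r mu) (p r v) }.

Local Notation lab mu r := (nth i0 mu r).

(** The space labelled by [mu] plays the part of the image of e(mu), so that
    the idempotents and the weight disappear from the relations. Restricting
    the crossings to [D] gives the parabolic subalgebras. *)
Record qhmod (n : nat) (D : pred nat) (x p : nat -> V -> V)
    (M : seq I -> V -> Prop) : Prop := QHMod {
  qh_st : stable n D x p M;
  qh_xlin r : linop (x r);
  qh_plin r : linop (p r);
  qh_xxC r s mu v : size mu = n -> (r < n)%N -> (s < n)%N -> M mu v -> x r (x s v) = x s (x r v);
  qh_px r mu v : size mu = n -> (r.+1 < n)%N -> D r -> M mu v ->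
    p r (x r.+1 v) = x r (p r v) + v *+ (lab mu r == lab mu r.+1);
  qh_xp r mu v : size mu = n -> (r.+1 < n)%N -> D r -> M mu v ->
    x r.+1 (p r v) = p r (x r v) + v *+ (lab mu r == lab mu r.+1);
  qh_px_far r s mu v : size mu = n -> (r.+1 < n)%N -> D r -> (s < n)%N -> s != r -> s != r.+1 ->
    M mu v -> p r (x s v) = x s (p r v);
  qh_pp_far r s mu v : size mu = n -> (r.+1 < s)%N -> (s.+1 < n)%N -> D r -> D s ->
    M mu v -> p r (p s v) = p s (p r v);
  qh_pp r mu v : size mu = n -> (r.+1 < n)%N -> D r -> M mu v ->
    p r (p r v) = op_eval2 (Q (lab mu r) (lab mu r.+1)) (x r) (x r.+1) v;
  qh_ppp r mu v : size mu = n -> (r.+2 < n)%N -> D r -> D r.+1 -> M mu v ->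
    p r.+1 (p r (p r.+1 v)) - p r (p r.+1 (p r v)) =
    op_ddiff (Q (lab mu r) (lab mu r.+1)) (x r) (x r.+1) (x r.+2) v
      *+ (lab mu r == lab mu r.+2) }.

(** The word of crossings, read off the descents of [b], that brings the
    first block to the positions marked by [b]. *)
Definition descent (b : bitseq) : nat :=
  find (fun r => ~~ nth false b r && nth false b r.+1) (iota 0 (size b)).

Lemma descentP b r : ~~ nth false b r -> nth false b r.+1 ->
  ~~ nth false b (descent b) /\ nth false b (descent b).+1.
Proof.
move=> b0 b1; pose a r := ~~ nth false b r && nth false b r.+1.
have hr : (r < size b)%N by case: (ltnP r.+1 (size b)) b1 => [/ltnW//|h]; rewrite nth_default.
have ha : has a (iota 0 (size b)) by apply/hasP; exists r; rewrite ?mem_iota // /a b0.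
apply/andP; have := nth_find 0%N ha; rewrite nth_iota ?add0n //.
by rewrite -[X in (_ < X)%N](size_iota 0) -has_find.
Qed.

Fixpoint word_rec (p : nat -> V -> V) (q : nat) (b : bitseq) (v : V) : V :=
  if q is q'.+1 then p (descent b) (word_rec p q' (swp (descent b) b) v) else v.

Definition word p b := word_rec p (inv b) b.

Lemma word_rec_lin p q b : (forall r, linop (p r)) -> linop (word_rec p q b).
Proof. by move=> hp; elim: q b => [|q IH] b c u v //=; rewrite IH hp. Qed.

Lemma word_lin p b : (forall r, linop (p r)) -> linop (word p b).
Proof. exact: word_rec_lin. Qed.

Definition subfam n (N M : seq I -> V -> Prop) :=
  forall mu v, size mu = n -> N mu v -> M mu v.
End Operators.

(** The correction terms of the dot-crossing relations keep their label
    sequence although the main terms change it: the two labels agree. *)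
Lemma swp_lab mu r (v : bool) : v = (nth i0 mu r == nth i0 mu r.+1) ->
  v -> swp r mu = mu.
Proof.
move=> -> /eqP e; case: (ltnP r.+1 (size mu)) => h; first exact: swp_id e.
by elim: r mu h {e} => [|r IH] [|u [|w mu]] //= h; rewrite IH.
Qed.

(** The same for the braid relation: its right-hand side carries a factor that
    forces the outer labels to agree. *)
Lemma swp3_lab mu r : (r.+2 < size mu)%N -> nth i0 mu r = nth i0 mu r.+2 ->
  swp r (swp r.+1 (swp r mu)) = mu.
Proof.
move=> h e; apply: (@eq_from_nth _ i0); rewrite !size_swp // => i _.
rewrite !nth_swp ?size_swp //; try lia.
by repeat (case: eqP => ?); subst; rewrite ?e //; lia.
Qed.

(** * Parabolic induction: the spanning set *)

Section Spanning.
Variables (V : lmodType K) (n : nat) (D : pred nat) (x p : nat -> V -> V).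
Variables (M : seq I -> V -> Prop) (MP : qhmod n D x p M).
Variables (k : nat) (kn : (k <= n)%N) (N : seq I -> V -> Prop) (NM : subfam n N M).
Hypothesis NP : stable n [pred r | D r & r.+1 != k] x p N.

Definition bits0 : bitseq := nseq k true ++ nseq (n - k) false.

Lemma size_bits0 : size bits0 = n.
Proof. by rewrite size_cat !size_nseq; lia. Qed.

Lemma nth_bits0 r : nth false bits0 r = (r < k)%N.
Proof.
rewrite nth_cat size_nseq; case: ltnP => h; first by rewrite nth_nseq h.
by rewrite nth_nseq if_same.
Qed.

(** Vectors obtained from [N] by crossings that each move an entry of the
    first block of [k] positions to the right past an entry of the second
    block; [b] records the positions that the first block has reached. *)
Inductive path : nat -> bitseq -> seq I -> V -> Prop :=
| path0 mu v : size mu = n -> N mu v -> path 0 bits0 mu v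
| pathS q b mu v r : path q b mu v -> D r -> (r.+1 < n)%N ->
    nth false b r -> ~~ nth false b r.+1 -> path q.+1 (swp r b) (swp r mu) (p r v).

(** Filtered by the number of crossings: the relations hold modulo fewer
    crossings. *)
Inductive span : nat -> seq I -> V -> Prop :=
| span_path q q' b mu v : (q' <= q)%N -> path q' b mu v -> span q mu v
| span0 q mu : span q mu 0
| span_lin q mu c u v : span q mu u -> span q mu v -> span q mu (c *: u + v).

Lemma path_size q b mu v : path q b mu v -> size b = n.
Proof. by elim=> [*|*]; rewrite ?size_bits0 ?size_swp. Qed.

Lemma path_size_lab q b mu v : path q b mu v -> size mu = n.
Proof. by elim=> [*|*]; rewrite ?size_swp. Qed.

Lemma path_M q b mu v : path q b mu v -> M mu v.
Proof.
elim=> [*|*]; first exact: NM.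
by apply: (st_p (qh_st MP)) => //; apply: path_size_lab; eassumption.
Qed.

Lemma span_sub q mu : subsp (span q mu).
Proof. by split=> [|c u v]; [apply: span0|apply: span_lin]. Qed.

Lemma span_M q mu v : span q mu v -> M mu v.
Proof.
elim=> [q1 q2 b nu u _ /path_M//|q1 nu|q1 nu c u w _ hu _ hw].
  by case: (st_sub (qh_st MP) nu).
by apply: (st_sub (qh_st MP) nu).2.
Qed.

Lemma span_le q q' mu v : (q <= q')%N -> span q mu v -> span q' mu v.
Proof.
move=> + hs; elim: hs q' => [q1 q2 b nu u h1 P|q1 nu|q1 nu c u w _ hu _ hw] q' h.
- by apply: span_path P; apply: leq_trans h.
- exact: span0.
by apply: span_lin; [apply: hu|apply: hw].
Qed.

(** Any descent of [b] can be taken for the last crossing: two descents of a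
    sequence of bits are never adjacent, so that their crossings commute. *)
Lemma path_descent q b mu v r : path q b mu v ->
  ~~ nth false b r -> nth false b r.+1 ->
  D r /\ (r.+1 < n)%N /\ exists q' v', [/\ q = q'.+1, v = p r v' & path q' (swp r b) (swp r mu) v'].
Proof.
move=> P; elim: P r => [nu u _ _|{}q {}b nu u r' P IH Dr' rn b1 b0] r.
  by rewrite !nth_bits0; lia.
have sb := path_size P.
rewrite !nth_swp ?sb //.
case: (eqVneq r r') => [->|nrr'].
  by move=> _ _; do 2!split=> //; exists q, u; split; rewrite ?swpK.
rewrite eqSS (negPf nrr'); case: (eqVneq r r'.+1) => [->|n1].
  by rewrite b1.
case: (eqVneq r.+1 r') => [e|n2]; first by rewrite (negPf b0).
move=> h0 h1; have [Dr [rn1 [q' [u' [eq eu P']]]]] := IH r h0 h1.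
do 2!split=> //; exists q, (p r' u'); split=> //.
  rewrite eu; have Mu' := path_M P'.
  have [h|h] : (r.+1 < r')%N \/ (r'.+1 < r)%N by lia.
    by rewrite (qh_pp_far MP (path_size_lab P') h _ _ _ Mu').
  by rewrite (qh_pp_far MP (path_size_lab P') h _ _ _ Mu').
have cm T (s : seq T) : swp r (swp r' s) = swp r' (swp r s).
  have [h|h] : (r.+1 < r')%N \/ (r'.+1 < r)%N by lia.
    by rewrite swp_far.
  by rewrite [RHS]swp_far.
rewrite !cm eq; apply: pathS => //; rewrite nth_swp ?(path_size P') ?sb //.
  by rewrite eq_sym (negPf nrr') eq_sym; case: eqP => [/esym|]; lia.
by rewrite eqSS; case: eqP; [lia|]; case: eqP; [lia|].
Qed.

(* Stability under dots, under crossings, and under crossings of two strands of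
   the same block; the latter do not raise the number of crossings. *)
Let spx q := forall r mu v, (r < n)%N -> span q mu v -> span q mu (x r v).
Let spp q := forall r mu v, (r.+1 < n)%N -> D r -> span q mu v ->
  span q.+1 (swp r mu) (p r v).
Let speq q := forall r b mu v, (r.+1 < n)%N -> D r -> path q b mu v ->
  nth false b r = nth false b r.+1 -> span q (swp r mu) (p r v).

Lemma spx_of_path q : (forall q' b r mu v, (q' <= q)%N -> (r < n)%N ->
  path q' b mu v -> span q mu (x r v)) -> spx q.
Proof.
move=> + r mu v rn S; elim: S => [q1 q2 b nu u h1 P|q1 nu|q1 nu c u w _ hu _ hw] H.
- exact: H P.
- by rewrite (linop0 (qh_xlin MP r)); apply: span0.
by rewrite (qh_xlin MP); apply: span_lin; [apply: hu|apply: hw].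
Qed.

Lemma spp_of_path q : (forall q' b r mu v, (q' <= q)%N -> (r.+1 < n)%N -> D r ->
  path q' b mu v -> span q.+1 (swp r mu) (p r v)) -> spp q.
Proof.
move=> + r mu v rn Dr S; elim: S => [q1 q2 b nu u h1 P|q1 nu|q1 nu c u w _ hu _ hw] H.
- exact: H P.
- by rewrite (linop0 (qh_plin MP r)); apply: span0.
by rewrite (qh_plin MP); apply: span_lin; [apply: hu|apply: hw].
Qed.

Lemma span_ddiff q (f : {poly {poly K}}) mu v r : spx q -> (r.+2 < n)%N -> size mu = n ->
  span q mu v -> span q (swp r (swp r.+1 (swp r mu)))
    (op_ddiff f (x r) (x r.+1) (x r.+2) v *+ (nth i0 mu r == nth i0 mu r.+2)).
Proof.
move=> hx rn sm Sv; case: eqP => [e|_]; last by rewrite mulr0n; apply: span0.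
rewrite mulr1n swp3_lab ?sm //.
by apply: op_ddiff_in => //; [exact: span_sub|..] => u; apply: hx; lia.
Qed.

(** Simultaneous induction on the number [q] of crossings. A dot passes the last
    crossing up to a shorter term. A crossing of an entry of the first block
    past one of the second prolongs the path, and in the opposite situation it
    meets the last crossing and gives a square. Between equal bits it is moved
    towards [N], by commutation or by the braid relation, until it acts on a
    single block inside [N]. *)
Lemma span_stable_aux q : [/\ spx q, spp q & speq q].
Proof.
have [m] := ubnP q; elim: m q => // m IH q hq.
have IHx q' : (q' < q)%N -> spx q' by move=> h; case: (IH q'); first lia.
have IHp q' : (q' < q)%N -> spp q' by move=> h; case: (IH q'); first lia.
have IHe q' : (q' < q)%N -> speq q' by move=> h; case: (IH q'); first lia.
have Hx : spx q.
  apply: spx_of_path => q1 b s mu v h1 sn P.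
  case: P h1 => [{b mu v} mu v smu Nv|{b mu v} q2 b mu v r P Dr rn b1 b0] h1.
    by apply: (@span_path _ 0 bits0) => //; apply: path0 => //; apply: (st_x NP).
  have Mv := path_M P; have Sv : span q2 mu v by apply: span_path P.
  have d0 u (e : bool) : e = (nth i0 mu r == nth i0 mu r.+1) -> span q2 mu u ->
      span q (swp r mu) (u *+ e).
    case: e => e Su; last by rewrite mulr0n; apply: span0.
    by rewrite (swp_lab e) // mulr1n; apply: span_le Su; lia.
  have pS u : span q2 mu u -> span q (swp r mu) (p r u).
    by move=> Su; apply: (@span_le q2.+1) => //; apply: IHp.
  case: (eqVneq s r.+1) => [->|n1].
    rewrite (qh_xp MP (path_size_lab P) _ _ Mv) //; apply: subspD; first exact: span_sub.
      by apply: pS; apply: IHx => //; lia.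
    exact: d0.
  case: (eqVneq s r) => [->|n2].
    have -> : x r (p r v) = p r (x r.+1 v) - v *+ (nth i0 mu r == nth i0 mu r.+1).
      by rewrite (qh_px MP (path_size_lab P) _ _ Mv) // addrK.
    apply: subspB; [exact: span_sub|by apply: pS; apply: IHx|exact: d0].
  by rewrite -(qh_px_far MP (path_size_lab P) _ _ _ _ _ Mv) //; apply: pS; apply: IHx.
have He : speq q.
  move=> r b mu v rn Dr P; case: P hq IHx IHp IHe Hx => [{b mu v} mu v smu Nv|{b mu v} {}q b mu v r' P Dr' rn' b1 b0] hq IHx IHp IHe Hx.
    rewrite !nth_bits0 => e; apply: (@span_path _ 0 bits0) => //.
    apply: path0; first by rewrite size_swp.
    by apply: (st_p NP) => //=; rewrite Dr /=; lia.
  have sb := path_size P; have Mv := path_M P.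
  rewrite !nth_swp ?sb //.
  case: (eqVneq r r') => [->|nrr']; first by rewrite eqn_leq ltnn b1 eqxx (negPf b0).
  rewrite eqSS (negPf nrr'); case: (eqVneq r r'.+1) => [er|n1].
    subst r; rewrite b1; case: eqP => [|_ /esym b2]; first by lia.
    have [_ [_ [q2 [v2 [e2 ev P2]]]]] := path_descent P b0 b2.
    have M2 := path_M P2; have s2 := path_size_lab P2; subst q v.
    have -> : swp r' mu = swp r' (swp r'.+1 (swp r'.+1 mu)) by rewrite swpK.
    have {b0 b1 b2} e2 : nth false (swp r'.+1 b) r' = nth false (swp r'.+1 b) r'.+1.
      rewrite !nth_swp ?sb // eqxx b1 b2.
      by repeat (case: eqP => ? //); lia.
    move: (swp r'.+1 mu) (swp r'.+1 b) s2 P2 M2 e2 => mu2 bb s2 P2 M2 e2.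
    rewrite -[p r'.+1 _](subrK (p r' (p r'.+1 (p r' v2)))) (qh_ppp MP s2 _ _ _ M2) //.
    rewrite swp_braid ?s2 //; apply: subspD; first exact: span_sub.
      apply: (@span_le q2); first by lia.
      by apply: span_ddiff => //; [apply: IHx; lia|apply: span_path P2].
    apply: (IHp q2.+1 (leqnn _)) => //; apply: (IHp q2 (leqnSn _)) => //.
    exact: (IHe q2 (leqnSn _) r' _ _ _ rn' Dr' P2 e2).
  case: (eqVneq r.+1 r') => [er|n2].
    subst r'; rewrite (negPf b0) => b2.
    have rn2 : (r.+2 < n)%N by [].
    have [_ [_ [q2 [v2 [e2 ev P2]]]]] := path_descent P (negbT b2) b1.
    have M2 := path_M P2; have s2 := path_size_lab P2; subst q v.
    have -> : swp r.+1 mu = swp r.+1 (swp r (swp r mu)) by rewrite swpK.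
    have {b0 b1} e3 : nth false (swp r b) r.+1 = nth false (swp r b) r.+2.
      rewrite !nth_swp ?sb // eqxx b2 (negPf b0).
      by repeat (case: eqP => ? //); lia.
    move: (swp r mu) (swp r b) s2 P2 M2 e3 => mu2 bb s2 P2 M2 e3.
    rewrite -[p r _](subKr (p r.+1 (p r (p r.+1 v2)))) (qh_ppp MP s2 _ _ _ M2) //.
    apply: subspB; first exact: span_sub.
      rewrite -swp_braid ?s2 //.
      apply: (IHp q2.+1 (leqnn _)) => //; apply: (IHp q2 (leqnSn _)) => //.
      exact: (IHe q2 (leqnSn _) r.+1 _ _ _ rn2 Dr' P2 e3).
    apply: (@span_le q2); first by lia.
    by apply: span_ddiff => //; [apply: IHx; lia|apply: span_path P2].
  move=> e; have Sp := IHe q (ltnSn q) r b mu v rn Dr P e.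
  have -> : swp r (swp r' mu) = swp r' (swp r mu).
    have [h|h] : (r.+1 < r')%N \/ (r'.+1 < r)%N by lia.
      by rewrite swp_far.
    by rewrite [RHS]swp_far.
  have -> : p r (p r' v) = p r' (p r v).
    have [h|h] : (r.+1 < r')%N \/ (r'.+1 < r)%N by lia.
      by rewrite (qh_pp_far MP (path_size_lab P) h _ _ _ Mv).
    by rewrite (qh_pp_far MP (path_size_lab P) h _ _ _ Mv).
  by apply: IHp.
split=> //; apply: spp_of_path => q1 b r mu v h1 rn Dr P.
case: (boolP (nth false b r)) => br; case: (boolP (nth false b r.+1)) => br1.
- apply: (@span_le q1); first by lia.
  case: (ltngtP q1 q) h1 => // [h1 _|e1 _]; last by subst q1; apply: (He r b) => //; rewrite br br1.
  by apply: (IHe q1 h1 r b) => //; rewrite br br1.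
- by apply: (@span_path _ q1.+1 (swp r b)) => //; apply: pathS.
- have [_ [_ [q2 [v2 [e2 ev P2]]]]] := path_descent P br br1.
  rewrite ev (qh_pp MP (path_size_lab P2) _ _ (path_M P2)) //; apply: (@span_le q2); first by lia.
  apply: op_eval2_in; [exact: span_sub| | |by apply: span_path P2] => u; apply: IHx; lia.
apply: (@span_le q1); first by lia.
case: (ltngtP q1 q) h1 => // [h1 _|e1 _].
  by apply: (IHe q1 h1 r b) => //; rewrite (negPf br) (negPf br1).
by subst q1; apply: (He r b) => //; rewrite (negPf br) (negPf br1).
Qed.

Definition induced mu v := exists q, span q mu v.

(** The easy half of the basis theorem for induced modules. *)
Lemma induced_stable : stable n D x p induced.
Proof.
split=> [mu|r mu v _ rn [q S]|r mu v _ rn Dr [q S]].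
- split=> [|c u v [q1 S1] [q2 S2]]; first by exists 0%N; apply: span0.
  exists (maxn q1 q2); apply: span_lin; [apply: span_le S1|apply: span_le S2].
    exact: leq_maxl.
  exact: leq_maxr.
- by exists q; case: (span_stable_aux q) => h _ _; apply: h.
by exists q.+1; case: (span_stable_aux q) => _ h _; apply: h.
Qed.

Lemma induced_base mu v : size mu = n -> N mu v -> induced mu v.
Proof. by move=> sm Nv; exists 0%N; apply: (@span_path _ 0 bits0) => //; apply: path0. Qed.

Lemma induced_M : subfam n induced M.
Proof. by move=> mu v _ [q /span_M]. Qed.

Lemma mask_bits0 (mu : seq I) : size mu = n -> mask bits0 mu = take k mu.
Proof.
move=> sm; rewrite -{1}(cat_take_drop k mu) mask_cat ?size_nseq ?size_takel ?sm //.
by rewrite mask_true ?size_takel ?sm // mask_false cats0.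
Qed.

Lemma mask_negb_bits0 (mu : seq I) : size mu = n -> mask (map negb bits0) mu = drop k mu.
Proof.
move=> sm; rewrite map_cat !map_nseq -{1}(cat_take_drop k mu).
rewrite mask_cat ?size_nseq ?size_takel ?sm //.
by rewrite mask_true ?size_drop ?sm // mask_false.
Qed.

Local Notation unshuffle b mu := (mask b mu ++ mask (map negb b) mu).

Lemma unshuffle_swp b (mu : seq I) r : size b = size mu -> (r.+1 < size b)%N ->
  nth false b r != nth false b r.+1 -> unshuffle (swp r b) (swp r mu) = unshuffle b mu.
Proof.
move=> h hr hb; rewrite map_swp !mask_swp ?size_map //.
by rewrite !(nth_map false) ?(inj_eq negb_inj) //; lia.
Qed.

Lemma path_count q b mu v : path q b mu v -> count id b = k.
Proof.
elim=> [*|*]; rewrite ?count_swp // count_cat !count_nseq /=.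
by rewrite mul1n mul0n addn0.
Qed.

Lemma path_inv q b mu v : path q b mu v -> inv b = q.
Proof.
elim=> [*|{}q {}b {}mu u r P e Dr rn b1 b0].
  rewrite /bits0; move: (n - k)%N => m; elim: (k) => [|j /= ->] //; elim: m => //= m ->.
  by rewrite count_nseq.
by rewrite inv_swp ?(path_size P) // e.
Qed.

(** The converse use of a path: a stable family that contains the starting
    vector contains all of them. Only the label sequence [unshuffle b mu] can
    start a path that ends at [b] and [mu]. *)
Lemma path_elim S q b mu v : stable n D x p S -> path q b mu v ->
  (forall w, N (unshuffle b mu) w -> S (unshuffle b mu) w) -> S mu v.
Proof.
move=> HS; elim=> [{}mu u sm Nu|{}q {}b {}mu u r P IH Dr rn b1 b0] H.
  by move: H; rewrite mask_bits0 // mask_negb_bits0 // cat_take_drop; apply.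
apply: (st_p HS) => //; first exact: (path_size_lab P).
apply: IH => w.
move: (H w); rewrite unshuffle_swp ?(path_size P) ?(path_size_lab P) //.
by rewrite b1 (negPf b0).
Qed.

Lemma induced_elim S mu v : stable n D x p S -> induced mu v ->
  (forall b w, size b = n -> count id b = k ->
     N (unshuffle b mu) w -> S (unshuffle b mu) w) -> S mu v.
Proof.
move=> HS [q Sq]; elim: Sq => [q1 q2 b nu u h1 P|q1 nu|q1 nu c u w _ hu _ hw] H.
- by apply: (path_elim HS P) => w; apply: H; [apply: (path_size P)|apply: (path_count P)].
- by case: (st_sub HS nu).
by apply: (st_sub HS nu).2; [apply: hu|apply: hw].
Qed.

(** Every path may be replaced by the one chosen in [word], by [path_descent]. *)
Lemma path_word q b mu v : path q b mu v ->
  exists2 w, N (unshuffle b mu) w & v = word_rec p q b w.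
Proof.
elim: q b mu v => [|q IH] b mu v P.
  inversion P; subst; exists v => //.
  by rewrite mask_bits0 // mask_negb_bits0 // cat_take_drop.
have [r [b0 b1]] : exists r, ~~ nth false b r /\ nth false b r.+1.
  inversion P; subst; exists r; rewrite !nth_swp ?(path_size H0) // eqxx.
  by case: eqP => [|_]; [lia|rewrite eqxx].
have [bd0 bd1] : ~~ nth false b (descent b) /\ nth false b (descent b).+1.
  exact: (descentP b0 b1).
have [Dd [dn [q' [v' [[eq] ev P']]]]] := path_descent P bd0 bd1.
subst q'; have [w Nw ew] := IH _ _ _ P'; exists w; last by rewrite ev ew.
move: Nw; rewrite unshuffle_swp ?(path_size P) ?(path_size_lab P) //.
by rewrite (negPf bd0) bd1.
Qed.

Lemma induced_sum mu v : induced mu v ->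
  exists2 F : bitseq -> V, forall b, b \in bits n k -> N (unshuffle b mu) (F b) &
    v = \sum_(b <- bits n k) word p b (F b).
Proof.
have plin b : linop (word p b) by apply: word_lin => r; apply: (qh_plin MP).
move=> [q Sq]; elim: Sq => [q1 q2 b nu u h1 P|q1 nu|q1 nu c u w _ [F hF ->] _ [G hG ->]].
- have [w Nw ->] := path_word P; rewrite -(path_inv P) -/(word p b w).
  have bB : b \in bits n k by rewrite mem_bits (path_size P) (path_count P) !eqxx.
  exists (fun b' => if b' == b then w else 0) => [b' _|].
    by case: eqP => [->//|_]; case: (st_sub NP (unshuffle b' nu)).
  rewrite (bigD1_seq b) ?bits_uniq //= eqxx big1 ?addr0 // => b' /negPf ->.
  by rewrite linop0.
- exists (fun=> 0) => [b _|]; first by case: (st_sub NP (unshuffle b nu)).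
  by rewrite big1 // => b _; rewrite linop0.
exists (fun b => c *: F b + G b) => [b hb|].
  by apply: (st_sub NP _).2; [apply: hF|apply: hG].
by rewrite scaler_sumr -big_split; apply: eq_bigr => b _; rewrite plin.
Qed.

End Spanning.

End Modules.

(** * Actions of presented algebras *)

Section FreeAction.
Variables (K : fieldType) (G : choiceType) (V : lmodType K) (g : G -> V -> V).
Hypothesis glin : forall a, linop (g a).
Implicit Types (z : free_alg K G) (v : V).

Definition act_word (m : seq G) v := foldr g v m.

Definition act z v : V := \sum_(m <- msupp z) z@_m *: act_word m v.

Lemma act_word_lin m : linop (act_word m).
Proof. by elim: m => //= a m IH c u v /=; rewrite IH glin. Qed.

Lemma actEw (d : {fset {fmonom G}}) z v : (msupp z `<=` d)%fset ->
  act z v = \sum_(m <- d) z@_m *: act_word m v.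
Proof.
move=> le; apply: big_fset_incl => // m _ hm.
by rewrite mcoeff_outdom // scale0r.
Qed.

Lemma act_lin_l v c z1 z2 : act (c *: z1 + z2) v = c *: act z1 v + act z2 v.
Proof.
pose d := (msupp z1 `|` msupp z2 `|` msupp (c *: z1 + z2))%fset.
rewrite !(@actEw d) ?fsubsetUr //; first last.
- by rewrite /d fsubsetU // fsubsetUl.
- by rewrite /d fsubsetU // fsubsetUr.
rewrite scaler_sumr -big_split; apply: eq_bigr => m _.
by rewrite mcoeffD mcoeffZ scalerDl scalerA.
Qed.

Definition act_at v z := act z v.

Lemma act_at_additive v : zmod_morphism (act_at v).
Proof. by move=> z1 z2; rewrite /act_at addrC -scaleN1r act_lin_l scaleN1r addrC. Qed.

HB.instance Definition _ v :=
  GRing.isZmodMorphism.Build (free_alg K G) V (act_at v) (act_at_additive v).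

Lemma actB z1 z2 v : act (z1 - z2) v = act z1 v - act z2 v.
Proof. exact: (raddfB (act_at v)). Qed.
Lemma actD z1 z2 v : act (z1 + z2) v = act z1 v + act z2 v.
Proof. exact: (raddfD (act_at v)). Qed.
Lemma act0 v : act 0 v = 0. Proof. exact: (raddf0 (act_at v)). Qed.
Lemma act_sum (J : Type) (r : seq J) (P : pred J) (F : J -> free_alg K G) v :
  act (\sum_(j <- r | P j) F j) v = \sum_(j <- r | P j) act (F j) v.
Proof. exact: (raddf_sum (act_at v)). Qed.
Lemma act_lin z : linop (act z).
Proof.
move=> c u v; rewrite /act scaler_sumr -big_split; apply: eq_bigr => m _.
by rewrite act_word_lin scalerDr !scalerA mulrC.
Qed.

Lemma actU (c : K) (m : {fmonom G}) v : act (<< c *g m >> : {malg K[{fmonom G}]}) v = c *: act_word m v.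
Proof. by rewrite (@actEw [fset m]%fset) ?msuppU_le // big_seq_fset1 mcoeffUU. Qed.

Lemma actM z1 z2 v : act (z1 * z2) v = act z1 (act z2 v).
Proof.
rewrite [z1 * z2](@malgME _ _ (z1 : {malg _[_]}) (z2 : {malg _[_]})) act_sum.
rewrite [RHS]/act; apply: eq_bigr => m1 _; rewrite act_sum.
rewrite [act z2 v]/act (linop_sum _ _ _ (act_word_lin m1)) scaler_sumr.
apply: eq_bigr => m2 _; rewrite actU fmM (linopZ _ _ (act_word_lin m1)) scalerA.
by rewrite /act_word foldr_cat.
Qed.

Lemma act1 v : act 1 v = v.
Proof.
rewrite -[1](@mpolyC1E {fmonom G} K : (1%:MP : {malg K[{fmonom G}]}) = 1).
by rewrite actU fm1 scale1r.
Qed.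

Lemma act_gen a v : act (free_gen K a) v = g a v.
Proof. by rewrite actU fmU scale1r. Qed.

Lemma actX z k v : act (z ^+ k) v = iter k (act z) v.
Proof. by elim: k => [|k IH]; rewrite ?act1 // exprS actM IH. Qed.

Lemma act_in (S : V -> Prop) z v : subsp S -> (forall a u, S u -> S (g a u)) ->
  S v -> S (act z v).
Proof.
move=> hS hg Sv; apply: subsp_sum => // m _; apply: subspZ => //.
by elim: (m : seq G) => //= a s IH; apply: hg.
Qed.

(** The relations may be tested on a subspace [U], and further generators of
    an ideal modulo a second subspace [U']. *)
Section Presented.
Variables (rel : free_alg K G -> free_alg K G -> Prop) (U U' : V -> Prop).
Hypotheses (Usub : subsp U) (Ug : forall a u, U u -> U (g a u)).
Hypotheses (U'sub : subsp U') (U'g : forall a u, U' u -> U' (g a u)).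
Hypothesis relU : forall z1 z2 u, rel z1 z2 -> U u -> act z1 u = act z2 u.

Local Notation A := (presented_alg rel).

Lemma act_ideal0 z u :
  in_ideal (fun z => exists z1 z2, rel z1 z2 /\ z = z1 - z2) z -> U u -> act z u = 0.
Proof.
move=> hz; elim: hz u => [{}z [z1 [z2 [r ->]]]||z1 z2 _ h1 _ h2|a {}z b _ hz] u Uu.
- by rewrite actB (relU r Uu) subrr.
- by rewrite act0.
- by rewrite actD h1 // h2 // addr0.
by rewrite !actM hz ?(linop0 (act_lin a)) //; apply: act_in.
Qed.

Lemma act_quot (z1 z2 : free_alg K G) u :
  to_quot _ z1 = to_quot _ z2 :> A -> U u -> act z1 u = act z2 u.
Proof.
move=> e Uu; apply/eqP; rewrite -subr_eq0 -actB; apply/eqP/act_ideal0 => //.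
by apply/to_quot_eq0; rewrite raddfB /= e subrr.
Qed.

Lemma act_quot_ideal (S : A -> Prop) (w : A) :
  (forall w, S w -> exists y, to_quot _ y = w /\ forall u, U u -> U' (act y u)) ->
  in_ideal S w -> forall y u, to_quot _ y = w -> U u -> U' (act y u).
Proof.
have reprP (a : A) : to_quot _ (repr a) = a by rewrite /to_quot reprK.
move=> hS hw; elim: hw => [{}w /hS [y0 [<- h]]||w1 w2 _ h1 _ h2|a {}w b _ h] y u ey Uu.
- by rewrite (act_quot ey Uu); apply: h.
- by rewrite (@act_quot y 0) ?act0 ?ey ?raddf0 //; case: U'sub.
- rewrite (@act_quot y (repr w1 + repr w2)) ?ey ?raddfD /= ?reprP // actD.
  by apply: subspD => //; [apply: h1|apply: h2].
rewrite (@act_quot y (repr a * repr w * repr b)) ?ey ?rmorphM /= ?reprP // !actM.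
by apply: act_in => //; apply: h => //; apply: act_in.
Qed.
End Presented.
End FreeAction.

(** * Idempotents that vanish *)
Section LabelAction.
Variables (I : choiceType) (P : zmodType) (alpha : I -> P) (n : nat) (beta : P).
Variable i0 : I.
Implicit Types nu : Ibeta alpha n beta.

Lemma nth_IbetaE nu (r : 'I_n) : nth_Ibeta nu r = nth i0 (val nu) r.
Proof. exact: tnth_nth. Qed.

Lemma val_Ibeta_act nu (r : 'I_n.-1) :
  (val (Ibeta_act (simple_perm r) nu) : seq I) = swp r (val nu).
Proof.
have rn := pos_r_subproof r; have sn : size (val nu) = n by rewrite size_tuple.
apply: (@eq_from_nth _ i0); first by rewrite size_swp !size_tuple.
move=> i; rewrite size_tuple => hi.
rewrite -[i]/(nat_of_ord (Ordinal hi)) -tnth_nth tnth_mktuple tpermV nth_swp ?sn //.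
rewrite (tnth_nth i0); case: tpermP => [->|->|]; rewrite ?eqxx //=.
  by case: eqP => //; lia.
move=> /eqP n1 /eqP n2; move: n1 n2; rewrite -!val_eqE /= => /negPf -> /negPf ->.
by [].
Qed.
End LabelAction.

Section Vanishing.
Variables (K : fieldType) (I : choiceType) (Q : I -> I -> {poly {poly K}}).
Variables (P : zmodType) (alpha : I -> P) (h : I -> {additive P -> int}).
Variables (i0 : I) (n : nat) (beta : P) (V : lmodType K) (x p : nat -> V -> V).
Variables (M M' : seq I -> V -> Prop) (Lam : P).
Hypotheses (MP : qhmod Q i0 n predT x p M) (M'P : stable n predT x p M').

Local Notation Ib := (Ibeta alpha n beta).
Local Notation W := (Ib -> V).
Implicit Types F : W.

(** The algebra acts on the families of vectors indexed by label sequences of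
    the given weight; this is the direct sum of the spaces of a module, so that
    e(mu) becomes a projection. *)
Definition gen_op (a : qh_index alpha n beta) F : W :=
  match a with
  | inl (inl r) => fun nu => p r (F (Ibeta_act (simple_perm r) nu))
  | inl (inr r) => fun nu => x r (F nu)
  | inr mu => fun nu => if nu == mu then F nu else 0
  end.

Lemma gen_op_lin a : linop (gen_op a).
Proof.
case: a => [[r|r]|mu] c F G; apply/funext => nu /=.
- exact: (qh_plin MP).
- exact: (qh_xlin MP).
rewrite -[RHS]/(c *: (if nu == mu then F nu else 0) + (if nu == mu then G nu else 0)).
by rewrite -[LHS]/(if nu == mu then c *: F nu + G nu else 0); case: eqP; rewrite ?scaler0 ?addr0.
Qed.

Definition sections (N : seq I -> V -> Prop) F := forall nu : Ib, N (val nu) (F nu).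

Lemma sections_sub N : (forall mu, subsp (N mu)) -> subsp (sections N).
Proof.
move=> hN; split=> [nu|c F G hF hG nu]; first by case: (hN (val nu)).
by apply: (hN (val nu)).2.
Qed.

Lemma sections_gen_op N : stable n predT x p N ->
  forall a F, sections N F -> sections N (gen_op a F).
Proof.
move=> NP [[r|r]|mu] F hF nu /=.
- rewrite -[tval (val nu)](swpK r) -(val_Ibeta_act i0); by apply: (st_p NP) => //; rewrite ?size_tuple //; apply: pos_r_subproof.
- by apply: (st_x NP) => //; rewrite ?size_tuple //; apply: hF.
by case: eqP => _; [exact: hF|case: (st_sub NP (val nu))].
Qed.

Local Notation sact r := (Ibeta_act (simple_perm r)).

Lemma val_s r (nu : Ib) : (val (sact r nu) : seq I) = swp r (val nu).
Proof. exact: val_Ibeta_act i0 _ _. Qed.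

Lemma Ib_inj (nu nu' : Ib) : (val nu : seq I) = val nu' -> nu = nu'.
Proof. by move=> e; do 2!apply: val_inj. Qed.

Lemma szI (nu : Ib) : size (val nu) = n.
Proof. by rewrite size_tuple. Qed.

Lemma s_inv r (nu : Ib) : sact r (sact r nu) = nu.
Proof. by apply: Ib_inj; rewrite !val_s swpK. Qed.

Lemma sact_same r (nu : Ib) :
  nth_Ibeta nu (pos_l r) == nth_Ibeta nu (pos_r r) -> sact r nu = nu.
Proof.
rewrite !(nth_IbetaE i0) => e; apply: Ib_inj; rewrite val_s.
exact: (swp_lab (erefl _) e).
Qed.

Lemma op_x0 r : x r 0 = 0. Proof. exact: (linop0 (qh_xlin MP r)). Qed.
Lemma op_p0 r : p r 0 = 0. Proof. exact: (linop0 (qh_plin MP r)). Qed.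

Lemma if_same (r : 'I_n.-1) (mu nu : Ib) (F : W) :
  (if mu == nu then F mu else 0) *+
    (nth_Ibeta nu (pos_l r) == nth_Ibeta nu (pos_r r)) =
  (if sact r mu == nu then F (sact r mu) else 0) *+
    (nth_Ibeta nu (pos_l r) == nth_Ibeta nu (pos_r r)).
Proof.
rewrite !mulrb; case E: (nth_Ibeta nu _ == _) => //.
rewrite (can2_eq (s_inv r) (s_inv r)) (sact_same E).
by case: eqP => // ->; rewrite (sact_same E).
Qed.

Lemma iter_x (r : 'I_n) k F nu :
  iter k (gen_op (x_index alpha beta r)) F nu = iter k (x r) (F nu).
Proof. by elim: k => //= k ->. Qed.

(** The relations are checked over an abstract algebra acting on families of
    vectors, so that the free algebra is never unfolded. *)
Section Relations.
Variables (A : lalgType K) (ac : A -> W -> W).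
Variables (ps : 'I_n.-1 -> A) (xs : 'I_n -> A) (es : Ib -> A).
Hypothesis ac_lin : forall c z1 z2 F, ac (c *: z1 + z2) F = c *: ac z1 F + ac z2 F.
Hypothesis acM : forall z1 z2 F, ac (z1 * z2) F = ac z1 (ac z2 F).
Hypothesis ac1 : forall F, ac 1 F = F.
Hypothesis ac_ps : forall r, ac (ps r) = gen_op (psi_index alpha beta r).
Hypothesis ac_xs : forall r, ac (xs r) = gen_op (x_index alpha beta r).
Hypothesis ac_es : forall nu, ac (es nu) = gen_op (e_index nu).

Lemma ac0 F : ac 0 F = 0.
Proof. by have := ac_lin (-1) 0 0 F; rewrite !scaleN1r !addNr. Qed.
Lemma acD z1 z2 F : ac (z1 + z2) F = ac z1 F + ac z2 F.
Proof. by rewrite -[z1]scale1r ac_lin !scale1r. Qed.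
Lemma acZ c z F : ac (c *: z) F = c *: ac z F.
Proof. by rewrite -[c *: z]addr0 ac_lin ac0 addr0. Qed.
Lemma acB z1 z2 F : ac (z1 - z2) F = ac z1 F - ac z2 F.
Proof. by rewrite acD -scaleN1r acZ scaleN1r. Qed.
Lemma ac_nat k F : ac (k%:R) F = F *+ k.
Proof. by rewrite -(@scaler_nat K) acZ ac1 scaler_nat. Qed.
Lemma acX z k F : ac (z ^+ k) F = iter k (ac z) F.
Proof. by elim: k => [|k IH]; rewrite ?ac1 // exprS acM IH. Qed.
Lemma ac_sum (J : Type) (s : seq J) (R : pred J) (G : J -> A) F nu :
  ac (\sum_(j <- s | R j) G j) F nu = \sum_(j <- s | R j) ac (G j) F nu.
Proof.
elim: s => [|j s IH]; first by rewrite !big_nil ac0.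
by rewrite !big_cons; case: (R j); rewrite // acD -IH.
Qed.

Lemma iter_xs r k F nu : iter k (ac (xs r)) F nu = iter k (x r) (F nu).
Proof. by rewrite ac_xs iter_x. Qed.

Lemma ac_eval2 q (r r' : 'I_n) F nu :
  ac (eval2 q (xs r) (xs r')) F nu = op_eval2 q (x r) (x r') (F nu).
Proof.
rewrite /eval2 /op_eval2 ac_sum; apply: eq_bigr => k _.
rewrite ac_sum; apply: eq_bigr => m _.
by rewrite acZ acM !acX -[LHS]/(_ *: (_ nu)) !iter_xs.
Qed.

Lemma ac_ddiff q (r r' r'' : 'I_n) F nu :
  ac (ddiff q (xs r) (xs r') (xs r'')) F nu = op_ddiff q (x r) (x r') (x r'') (F nu).
Proof.
rewrite /ddiff /op_ddiff ac_sum; apply: eq_bigr => k _.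
rewrite ac_sum; apply: eq_bigr => m _.
rewrite acZ acM -[LHS]/(_ *: (_ nu)) ac_sum; congr (_ *: _).
by apply: eq_bigr => b _; rewrite acM !acX !iter_xs.
Qed.

Local Notation delta i j := ((i == j)%:R).
Let acE := (acM, acD, acB, ac_nat, ac_ps, ac_xs, ac_es, natmulfctE, addrfctE).

Lemma rel_ee nu nu' F : ac (es nu * es nu') F = ac (delta nu nu' * es nu) F.
Proof.
rewrite !acE; apply/funext => mu /=.
case: (eqVneq mu nu) => [->|_]; last by rewrite mul0rn.
by rewrite mulrb.
Qed.

Lemma rel_sum (s : seq Ib) F : uniq s -> (forall nu, nu \in s) ->
  ac (\sum_(nu <- s) es nu) F = ac 1 F.
Proof.
move=> us hs; apply/funext => mu; rewrite ac_sum ac1 (bigD1_seq mu) //= ac_es /= eqxx.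
rewrite big1 ?addr0 // => nu.
by rewrite ac_es /= eq_sym => /negPf ->.
Qed.

Lemma rel_xe r nu F : ac (xs r * es nu) F = ac (es nu * xs r) F.
Proof. by rewrite !acE; apply/funext => mu /=; case: eqP => // _; rewrite op_x0. Qed.

Lemma rel_pe r nu F : ac (ps r * es nu) F = ac (es (sact r nu) * ps r) F.
Proof.
rewrite !acE; apply/funext => mu /=; rewrite (can2_eq (s_inv r) (s_inv r)).
by case: eqP => // _; rewrite op_p0.
Qed.

Variables (F : W) (MF : sections M F).

Lemma rel_xx r s : ac (xs r * xs s) F = ac (xs s * xs r) F.
Proof. by rewrite !acE; apply/funext => mu /=; rewrite (qh_xxC MP (szI _) _ _ (MF mu)). Qed.

Lemma rel_px r nu : ac (ps r * xs (pos_r r) * es nu) F =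
  ac ((xs (pos_l r) * ps r + delta (nth_Ibeta nu (pos_l r)) (nth_Ibeta nu (pos_r r))) * es nu) F.
Proof.
rewrite !acE; apply/funext => mu /=; rewrite if_same.
case: eqP => [<-|_]; last by rewrite mul0rn !(op_p0, op_x0, addr0).
by rewrite (qh_px MP (szI _) _ _ (MF _)) ?pos_r_subproof // !(nth_IbetaE i0).
Qed.

Lemma rel_xp r nu : ac (xs (pos_r r) * ps r * es nu) F =
  ac ((ps r * xs (pos_l r) + delta (nth_Ibeta nu (pos_l r)) (nth_Ibeta nu (pos_r r))) * es nu) F.
Proof.
rewrite !acE; apply/funext => mu /=; rewrite if_same.
case: eqP => [<-|_]; last by rewrite mul0rn !(op_p0, op_x0, addr0).
by rewrite (qh_xp MP (szI _) _ _ (MF _)) ?pos_r_subproof // !(nth_IbetaE i0).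
Qed.

Lemma rel_px_far r s : s != pos_l r -> s != pos_r r -> ac (ps r * xs s) F = ac (xs s * ps r) F.
Proof.
move=> n1 n2; rewrite !acE; apply/funext => mu /=.
by rewrite (qh_px_far MP (szI _) _ _ _ _ _ (MF _)) ?pos_r_subproof.
Qed.

Lemma rel_pp_far (r s : 'I_n.-1) : (r.+1 < s)%N || (s.+1 < r)%N ->
  ac (ps r * ps s) F = ac (ps s * ps r) F.
Proof.
have cm (r1 r2 : 'I_n.-1) (mu : Ib) : (r1.+1 < r2)%N ->
    sact r1 (sact r2 mu) = sact r2 (sact r1 mu).
  by move=> h12; apply: Ib_inj; rewrite !val_s swp_far.
move=> rs; rewrite !acE; apply/funext => mu /=; case/orP: rs => rs.
  by rewrite (cm _ _ _ rs) (qh_pp_far MP (szI _) rs _ _ _ (MF _)) ?pos_r_subproof.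
by rewrite (cm _ _ _ rs) (qh_pp_far MP (szI _) rs _ _ _ (MF _)) ?pos_r_subproof.
Qed.

Lemma rel_pp r nu : ac (ps r ^+ 2 * es nu) F =
  ac (eval2 (Q (nth_Ibeta nu (pos_l r)) (nth_Ibeta nu (pos_r r)))
       (xs (pos_l r)) (xs (pos_r r)) * es nu) F.
Proof.
rewrite expr2 !acE; apply/funext => mu; rewrite ac_eval2 /= s_inv.
case: eqP => [<-|_].
  by rewrite (qh_pp MP (szI _) _ _ (MF _)) ?pos_r_subproof // !(nth_IbetaE i0).
rewrite !op_p0 /op_eval2 big1 // => k _; rewrite big1 // => m _.
by rewrite !(linop0 (linop_iter _ (qh_xlin MP _))) scaler0.
Qed.

Lemma rel_ppp (r r' : 'I_n.-1) nu : r' = r.+1 :> nat ->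
  ac ((ps r' * ps r * ps r' - ps r * ps r' * ps r) * es nu) F =
  ac (delta (nth_Ibeta nu (pos_l r)) (nth_Ibeta nu (pos_r r')) *
      ddiff (Q (nth_Ibeta nu (pos_l r)) (nth_Ibeta nu (pos_r r)))
        (xs (pos_l r)) (xs (pos_r r)) (xs (pos_r r')) * es nu) F.
Proof.
move=> er; have rn : (r.+2 < n)%N by have := pos_r_subproof r'; rewrite er.
rewrite !acM ac_nat acB !acM !ac_ps ac_es; apply/funext => mu.
rewrite natmulfctE ac_ddiff -[LHS]/(_ mu - _ mu) /=.
have -> : sact r (sact r' (sact r mu)) = sact r' (sact r (sact r' mu)).
  by apply: Ib_inj; rewrite !val_s er swp_braid ?size_tuple.
have size_lab (nu' : Ib) : size (val nu') = n by rewrite size_tuple.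
have -> : (if mu == nu then F mu else 0) = if mu == nu then F nu else 0.
  by case: eqP => // ->.
rewrite (_ : op_ddiff _ _ _ _ _ *+ _ = op_ddiff (Q (nth_Ibeta nu (pos_l r)) (nth_Ibeta nu (pos_r r)))
    (x r) (x r.+1) (x r.+2)
    (if sact r' (sact r (sact r' mu)) == nu then F (sact r' (sact r (sact r' mu))) else 0)
    *+ (nth_Ibeta nu (pos_l r) == nth_Ibeta nu (pos_r r'))); last first.
  rewrite /= er !mulrb; case E: (nth_Ibeta nu _ == _) => //; congr op_ddiff.
  have fx : sact r' (sact r (sact r' nu)) = nu.
    apply: Ib_inj; rewrite !val_s er swp_braid ?size_lab //.
    apply: (@swp3_lab _ i0); rewrite ?size_lab //.
    by move/eqP: E; rewrite !(nth_IbetaE i0) /= er.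
  have -> : (sact r' (sact r (sact r' mu)) == nu) = (mu == nu).
    by rewrite !(can2_eq (s_inv _) (s_inv _)) -[in RHS]fx.
  by case: eqP => // ->; rewrite fx.
case: eqP => [<-|_]; last first.
  rewrite !op_p0 subr0 /op_ddiff big1 ?mul0rn // => k _; rewrite big1 // => m _.
  rewrite big1 ?scaler0 // => b _.
  by rewrite !(linop0 (linop_iter _ (qh_xlin MP _))).
have := qh_ppp MP (szI _) rn isT isT (MF (sact r' (sact r (sact r' mu)))).
by rewrite !(nth_IbetaE i0) /= er.
Qed.
End Relations.

Hypothesis cycM : forall mu v, (0 < n)%N -> size mu = n -> M mu v ->
  M' mu (iter `|h (nth i0 mu 0) Lam|%N (x 0) v).

Lemma act_rel z1 z2 F : qh_rel Q z1 z2 -> sections M F ->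
  act gen_op z1 F = act gen_op z2 F.
Proof.
have aM := actM gen_op_lin; have a1 := @act1 K _ _ gen_op.
have aL c z z' G := @act_lin_l K _ _ gen_op G c z z'.
have aps r : act gen_op (free_gen K (psi_index alpha beta r)) = gen_op (psi_index alpha beta r).
  by apply/funext => G; apply: act_gen.
have axs r : act gen_op (free_gen K (x_index alpha beta r)) = gen_op (x_index alpha beta r).
  by apply/funext => G; apply: act_gen.
have aes nu' : act gen_op (free_gen K (e_index nu')) = gen_op (e_index nu').
  by apply/funext => G; apply: act_gen.
case=> [nu nu'|s us hs|r nu|r nu|r s|r nu|r nu|r s n1 n2|r s rs|r nu|r r' nu er] MF.
- exact (rel_ee aL aM a1 aes nu nu' F).
- exact (rel_sum aL a1 aes F us hs).
- exact (rel_xe aM axs aes r nu F).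
- exact (rel_pe aM aps aes r nu F).
- exact (rel_xx aM axs MF r s).
- exact (rel_px aL aM a1 aps axs aes MF r nu).
- exact (rel_xp aL aM a1 aps axs aes MF r nu).
- exact (rel_px_far aM aps axs MF n1 n2).
- exact (rel_pp_far aM aps MF rs).
- exact (rel_pp aL aM a1 aps axs aes MF r nu).
exact (rel_ppp aL aM a1 aps axs aes MF nu er).
Qed.

(** The universal property of the cyclotomic quotient, tested on one vector
    placed in the component of [nu]. Allowing values in a subfamily [M'] gives
    the statement for the quotient of [M] by [M']. *)
Lemma cyc_vanish (nu : Ib) v : cyc_e Q h Lam nu = 0 -> M (val nu) v -> M' (val nu) v.
Proof.
move=> /eqP/to_quot_eq0 hI Mv.
have MS := sections_gen_op (qh_st MP); have M'S := sections_gen_op M'P.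
have Msub := sections_sub (st_sub (qh_st MP)); have M'sub := sections_sub (st_sub M'P).
pose F0 : W := fun mu => if mu == nu then v else 0.
have F0M : sections M F0.
  by move=> mu; rewrite /F0; case: eqP => [->//|_]; case: (st_sub (qh_st MP) (val mu)).
have hS (w : quiver_hecke Q alpha n beta) : cyc_gen h Lam w ->
    exists y, to_quot _ y = w /\ forall F, sections M F -> sections M' (act gen_op y F).
  case=> r [mu [r0 ->]].
  exists (free_gen K (x_index alpha beta r) ^+ `|h (nth_Ibeta mu r) Lam|%N * free_gen K (e_index mu)).
  split=> [|F MF nu']; first by rewrite rmorphM rmorphXn.
  have aM := actM gen_op_lin.
  have aX := actX gen_op_lin.
  have axs : act gen_op (free_gen K (x_index alpha beta r)) = gen_op (x_index alpha beta r).
    by apply/funext => G; apply: act_gen.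
  rewrite aM aX axs iter_x act_gen /= r0.
  case: eqP => [->|_]; last first.
    by rewrite (linop0 (linop_iter _ (qh_xlin MP 0))); case: (st_sub M'P (val nu')).
  rewrite (nth_IbetaE i0) r0; apply: cycM; [|by rewrite size_tuple|exact: MF].
  by have := ltn_ord r; rewrite r0.
have := act_quot_ideal gen_op_lin Msub MS M'sub M'S act_rel hS hI
  (erefl _ : to_quot _ (free_gen K (e_index nu)) = _) F0M.
by rewrite /F0; move/(_ nu); rewrite act_gen /= eqxx.
Qed.
End Vanishing.

(** * The relations in an algebra *)

Section AlgebraSpace.
Variables (K : fieldType) (A : pzAlgType K).

(** An algebra as a vector space; the cyclotomic quotients may be zero rings,
    which excludes the usual algebra structures. *)
Definition alg_space : Type := A.
HB.instance Definition _ := GRing.Zmodule.on alg_space.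

Definition alg_scale (c : K) (u : alg_space) : alg_space := (pz_scalar c : A) * (u : A).

Lemma alg_scaleA c d u : alg_scale c (alg_scale d u) = alg_scale (c * d) u.
Proof. by rewrite /alg_scale rmorphM mulrA. Qed.
Lemma alg_scale1 : left_id 1 alg_scale.
Proof. by move=> u; rewrite /alg_scale rmorph1 mul1r. Qed.
Lemma alg_scaleDr : right_distributive alg_scale +%R.
Proof. by move=> c u v; rewrite /alg_scale -mulrDr. Qed.
Lemma alg_scaleDl v : {morph alg_scale^~ v : c d / c + d}.
Proof. by move=> c d; rewrite /alg_scale rmorphD -mulrDl. Qed.

HB.instance Definition _ := GRing.Zmodule_isLmodule.Build K alg_space
  alg_scaleA alg_scale1 alg_scaleDr alg_scaleDl.

Definition lmulop (a : A) (u : alg_space) : alg_space := a * (u : A).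

Lemma lmulop_lin a : linop (lmulop a).
Proof.
move=> c u v; rewrite /lmulop -[LHS]/(a * (pz_scalar c * (u : A) + (v : A))).
by rewrite mulrDr mulrA -pz_scalarC -mulrA.
Qed.

Definition alg_eval2 (q : {poly {poly K}}) (u v : A) : A :=
  \sum_(k < size q) \sum_(m < size q`_k) pz_scalar q`_k`_m * (u ^+ k * v ^+ m).

Definition alg_ddiff (q : {poly {poly K}}) (u v w : A) : A :=
  \sum_(k < size q) \sum_(m < size q`_k) pz_scalar q`_k`_m *
    ((\sum_(b < k) u ^+ (k.-1 - b) * w ^+ b) * v ^+ m).

Lemma iter_lmulop a k u : iter k (lmulop a) u = lmulop (a ^+ k) u.
Proof.
elim: k => [|k IH] /=; first by rewrite /lmulop expr0 mul1r.
by rewrite IH /lmulop exprS mulrA.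
Qed.

End AlgebraSpace.

Section GradedRing.
Variables (K : fieldType) (I : choiceType) (Q : I -> I -> {poly {poly K}}) (i0 : I).
Local Notation lab mu r := (nth i0 mu r).

(** The relations of a quiver Hecke algebra with positions indexed by natural
    numbers and idempotents by arbitrary sequences; the sequences of the wrong
    weight or length have idempotent 0. *)
Record qhring (n : nat) (A : pzAlgType K) (X Ps : nat -> A) (E : seq I -> A) : Prop := QHRing {
  qr_ee mu : E mu * E mu = E mu;
  qr_xe r mu : X r * E mu = E mu * X r;
  qr_pe r mu : (r.+1 < n)%N -> Ps r * E mu = E (swp r mu) * Ps r;
  qr_xx r s : X r * X s = X s * X r;
  qr_px r mu : (r.+1 < n)%N ->
    Ps r * X r.+1 * E mu = (X r * Ps r + (lab mu r == lab mu r.+1)%:R) * E mu;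
  qr_xp r mu : (r.+1 < n)%N ->
    X r.+1 * Ps r * E mu = (Ps r * X r + (lab mu r == lab mu r.+1)%:R) * E mu;
  qr_px_far r s : (r.+1 < n)%N -> (s < n)%N -> s != r -> s != r.+1 ->
    Ps r * X s = X s * Ps r;
  qr_pp_far r s : (r.+1 < s)%N -> (s.+1 < n)%N -> Ps r * Ps s = Ps s * Ps r;
  qr_pp r mu : (r.+1 < n)%N ->
    Ps r * Ps r * E mu = alg_eval2 (Q (lab mu r) (lab mu r.+1)) (X r) (X r.+1) * E mu;
  qr_ppp r mu : (r.+2 < n)%N ->
    (Ps r.+1 * Ps r * Ps r.+1 - Ps r * Ps r.+1 * Ps r) * E mu =
    (lab mu r == lab mu r.+2)%:R *
      alg_ddiff (Q (lab mu r) (lab mu r.+1)) (X r) (X r.+1) (X r.+2) * E mu }.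

End GradedRing.

(** * Cyclotomic quiver Hecke algebras *)

Section Labels.
Variables (I : choiceType) (P : zmodType) (alpha : I -> P) (n : nat) (beta : P).
Local Notation Ib := (Ibeta alpha n beta).

Definition Ib_of (mu : seq I) : option Ib :=
  obind (fun t => insub t : option {nu : n.-tuple I | seq_wt alpha nu == beta}) (insub mu).

Lemma Ib_ofK (nu : Ib) : Ib_of (val nu) = Some nu.
Proof.
case: nu => t wt; by rewrite /Ib_of /= valK /= insubT.
Qed.

Lemma Ib_ofP mu nu : Ib_of mu = Some nu -> mu = val nu.
Proof.
rewrite /Ib_of; case: insubP => //= t _ <-.
by case: insubP => //= u _ <- [<-].
Qed.

Lemma seq_wt_perm (mu mu' : seq I) : perm_eq mu mu' -> seq_wt alpha mu = seq_wt alpha mu'.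
Proof. by move=> e; apply: perm_big. Qed.

(** Exchanging two labels keeps the weight. *)
Lemma Ib_of_swp r mu : Ib_of mu = None -> Ib_of (swp r mu) = None.
Proof.
case E: (Ib_of (swp r mu)) => [nu|//] hN; exfalso.
have sm : size mu = n by rewrite -(size_swp r) (Ib_ofP E) size_tuple.
have wm : seq_wt alpha mu == beta.
  by rewrite -(seq_wt_perm (perm_swp r mu)) (Ib_ofP E) (valP nu).
pose nu' : Ib := exist _ (Tuple (introT eqP sm)) wm.
by have := Ib_ofK nu'; rewrite /= hN.
Qed.

End Labels.

(** Images of relations under a ring morphism. The source is an abstract
    algebra, so that products in the free algebra are never computed. *)
Section Transfer.
Variables (K : fieldType) (F : lalgType K) (A : pzAlgType K) (pi : {rmorphism F -> A}).
Hypothesis piZ : forall c u, pi (c *: u) = pz_scalar c * pi u.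

Lemma tr_eval2 q u v : pi (eval2 q u v) = alg_eval2 q (pi u) (pi v).
Proof.
rewrite /eval2 raddf_sum; apply: eq_bigr => k _; rewrite raddf_sum; apply: eq_bigr => m _.
by rewrite /= piZ rmorphM !rmorphXn.
Qed.

Lemma tr_ddiff q u v w : pi (ddiff q u v w) = alg_ddiff q (pi u) (pi v) (pi w).
Proof.
rewrite /ddiff raddf_sum; apply: eq_bigr => k _; rewrite raddf_sum; apply: eq_bigr => m _.
rewrite /= piZ rmorphM rmorphXn raddf_sum; congr (_ * (_ * _)).
by apply: eq_bigr => b _; rewrite /= rmorphM !rmorphXn.
Qed.

Lemma tr2 a b c d : pi (a * b) = pi (c * d) -> pi a * pi b = pi c * pi d.
Proof. by rewrite !rmorphM. Qed.

Lemma tr_ee k a b c : pi (a * b) = pi (k%:R * c) -> pi a * pi b = k%:R * pi c.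
Proof. by rewrite !rmorphM rmorph_nat. Qed.

Lemma tr3 k a b c d e f : pi (a * b * c) = pi ((d * e + k%:R) * f) ->
  pi a * pi b * pi c = (pi d * pi e + k%:R) * pi f.
Proof. by rewrite !rmorphM rmorphD rmorphM rmorph_nat. Qed.

Lemma tr_pp q a b u v : pi (a ^+ 2 * b) = pi (eval2 q u v * b) ->
  pi a * pi a * pi b = alg_eval2 q (pi u) (pi v) * pi b.
Proof. by rewrite expr2 !rmorphM tr_eval2. Qed.

Lemma tr_ppp q k a b e u v w :
  pi ((b * a * b - a * b * a) * e) = pi (k%:R * ddiff q u v w * e) ->
  (pi b * pi a * pi b - pi a * pi b * pi a) * pi e =
  k%:R * alg_ddiff q (pi u) (pi v) (pi w) * pi e.
Proof. by rewrite !(rmorphM, rmorphB) rmorph_nat tr_ddiff. Qed.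

Lemma tr_pow m a b : pi (a ^+ m * b) = pi a ^+ m * pi b.
Proof. by rewrite rmorphM rmorphXn. Qed.
End Transfer.

Section NatIndex.
Variables (K : fieldType) (I : choiceType) (Q : I -> I -> {poly {poly K}}) (i0 : I).
Variables (P : zmodType) (alpha : I -> P) (n : nat) (beta : P) (A : pzAlgType K).
Local Notation Ib := (Ibeta alpha n beta).
Variables (xA : 'I_n -> A) (pA : 'I_n.-1 -> A) (eA : Ib -> A).
Local Notation del nu r s := ((nth_Ibeta nu r == nth_Ibeta nu s)%:R).
Local Notation Qn nu r := (Q (nth_Ibeta nu (pos_l r)) (nth_Ibeta nu (pos_r r))).

Hypothesis Aee : forall nu nu', eA nu * eA nu' = (nu == nu')%:R * eA nu.
Hypothesis Axe : forall r nu, xA r * eA nu = eA nu * xA r.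
Hypothesis Ape : forall r nu, pA r * eA nu = eA (Ibeta_act (simple_perm r) nu) * pA r.
Hypothesis Axx : forall r s, xA r * xA s = xA s * xA r.
Hypothesis Apx : forall r nu, pA r * xA (pos_r r) * eA nu =
  (xA (pos_l r) * pA r + del nu (pos_l r) (pos_r r)) * eA nu.
Hypothesis Axp : forall r nu, xA (pos_r r) * pA r * eA nu =
  (pA r * xA (pos_l r) + del nu (pos_l r) (pos_r r)) * eA nu.
Hypothesis Apx_far : forall r s, s != pos_l r -> s != pos_r r -> pA r * xA s = xA s * pA r.
Hypothesis App_far : forall r s : 'I_n.-1, (r.+1 < s)%N || (s.+1 < r)%N ->
  pA r * pA s = pA s * pA r.
Hypothesis App : forall r nu, pA r * pA r * eA nu =
  alg_eval2 (Qn nu r) (xA (pos_l r)) (xA (pos_r r)) * eA nu.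
Hypothesis Appp : forall (r r' : 'I_n.-1) nu, r' = r.+1 :> nat ->
  (pA r' * pA r * pA r' - pA r * pA r' * pA r) * eA nu =
  del nu (pos_l r) (pos_r r') *
    alg_ddiff (Qn nu r) (xA (pos_l r)) (xA (pos_r r)) (xA (pos_r r')) * eA nu.

Definition nat_x r : A := if insub r is Some r' then xA r' else 0.
Definition nat_p r : A := if insub r is Some r' then pA r' else 0.
Definition seq_e mu : A := if Ib_of alpha n beta mu is Some nu then eA nu else 0.

Lemma seq_e_val (nu : Ib) : seq_e (val nu) = eA nu.
Proof. by rewrite /seq_e Ib_ofK. Qed.
Lemma nat_xE (r : 'I_n) : nat_x r = xA r. Proof. by rewrite /nat_x valK. Qed.
Lemma nat_pE (r : 'I_n.-1) : nat_p r = pA r. Proof. by rewrite /nat_p valK. Qed.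

Lemma ltn_pred_ord r : (r.+1 < n)%N -> (r < n.-1)%N.
Proof. by case: n. Qed.

Lemma nat_qhring : qhring Q i0 n nat_x nat_p seq_e.
Proof.
have xP r : (r < n)%N -> exists2 r' : 'I_n, r' = r :> nat & nat_x r = xA r'.
  by move=> h1; exists (Ordinal h1) => //; rewrite -nat_xE.
have pP r : (r.+1 < n)%N -> exists r' : 'I_n.-1, [/\ r' = r :> nat, nat_p r = pA r',
    nat_x r = xA (pos_l r') & nat_x r.+1 = xA (pos_r r')].
  by move=> h1; exists (Ordinal (ltn_pred_ord h1)); rewrite -nat_pE -!nat_xE.
have eP mu : seq_e mu = 0 \/ exists2 nu : Ib, mu = val nu & seq_e mu = eA nu.
  rewrite /seq_e; case E: (Ib_of _ _ _ mu) => [nu|]; last by left.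
  by right; exists nu => //; apply: Ib_ofP.
split.
- move=> mu; case: (eP mu) => [->|[nu em ->]]; first by rewrite mul0r.
  by rewrite Aee eqxx mul1r.
- move=> r mu; case: (eP mu) => [->|[nu em ->]]; first by rewrite mul0r mulr0.
  by rewrite /nat_x; case: insubP => [r' _ _|_]; rewrite ?Axe // mul0r mulr0.
- move=> r mu /pP[r' [er -> _ _]]; rewrite /seq_e.
  case E: (Ib_of _ _ _ mu) => [nu|]; last by rewrite (Ib_of_swp r E) mul0r mulr0.
  by rewrite (Ib_ofP E) -er -(val_Ibeta_act i0) Ib_ofK Ape.
- move=> r s; rewrite /nat_x; case: insubP => [r' _ _|_]; last by rewrite mul0r mulr0.
  by case: insubP => [s' _ _|_]; rewrite ?mul0r ?mulr0.
- move=> r mu /pP[r' [er -> -> ->]]; case: (eP mu) => [->|[nu -> ->]]; first by rewrite !mulr0.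
  by rewrite Apx !(nth_IbetaE i0) /= er.
- move=> r mu /pP[r' [er -> -> ->]]; case: (eP mu) => [->|[nu -> ->]]; first by rewrite !mulr0.
  by rewrite Axp !(nth_IbetaE i0) /= er.
- by move=> r s /pP[r' [er -> _ _]] /xP[s' es ->] n1 n2; apply: Apx_far; rewrite -val_eqE /= er es.
- move=> r s rs sn; have rn : (r.+1 < n)%N by lia.
  have [s' [es -> _ _]] := pP s sn; have [r' [er -> _ _]] := pP r rn.
  by apply: App_far; rewrite er es rs.
- move=> r mu /pP[r' [er -> -> ->]]; case: (eP mu) => [->|[nu -> ->]]; first by rewrite !mulr0.
  by rewrite App !(nth_IbetaE i0) /= er.
move=> r mu rn; case: (eP mu) => [->|[nu -> ->]]; first by rewrite !mulr0.
have [s' [es -> _ ->]] := pP r.+1 rn; have [r' [er -> -> ->]] := pP r (ltnW rn).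
by rewrite Appp ?es ?er // !(nth_IbetaE i0) /= es er.
Qed.
End NatIndex.

Section Cyclotomic.
Variables (K : fieldType) (I : choiceType) (Q : I -> I -> {poly {poly K}}) (i0 : I).
Variables (P : zmodType) (alpha : I -> P) (h : I -> {additive P -> int}).
Variables (n : nat) (beta Lam : P).

Local Notation Ib := (Ibeta alpha n beta).
Local Notation R := (quiver_hecke Q alpha n beta).
Local Notation A := (cyclotomic_qh Q alpha n beta h Lam).

Definition cyc_pi (z : free_alg K (qh_index alpha n beta)) : A :=
  to_quot (cyc_gen h Lam) (to_quot _ z : R).

Lemma cyc_pi_additive : zmod_morphism cyc_pi.
Proof. by move=> u v; rewrite /cyc_pi !raddfB. Qed.
Lemma cyc_pi_multiplicative : monoid_morphism cyc_pi.
Proof. by split=> [|u v]; rewrite /cyc_pi ?rmorph1 ?rmorphM. Qed.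
HB.instance Definition _ := GRing.isZmodMorphism.Build _ _ cyc_pi cyc_pi_additive.
HB.instance Definition _ := GRing.isMonoidMorphism.Build _ _ cyc_pi cyc_pi_multiplicative.

Lemma cyc_pi_rel u v : qh_rel Q u v -> cyc_pi u = cyc_pi v.
Proof.
move=> r; rewrite /cyc_pi; congr (to_quot _ _); apply/eqP.
rewrite -subr_eq0 -raddfB; apply/to_quot_eq0; apply: in_ideal_gen.
by exists u, v.
Qed.

Lemma cyc_piZ c u : cyc_pi (c *: u) = pz_scalar c * cyc_pi u.
Proof. by rewrite -mul_malgC; apply: rmorphM. Qed.

Local Notation xA := (fun r => cyc_pi (free_gen K (x_index alpha beta r))).
Local Notation pA := (fun r => cyc_pi (free_gen K (psi_index alpha beta r))).
Local Notation eA := (fun nu => cyc_pi (free_gen K (e_index nu))).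

Definition cyc_x := nat_x xA.
Definition cyc_p := nat_p pA.
Definition cyc_en := seq_e eA.

Lemma cyc_en_val (nu : Ib) : cyc_en (val nu) = cyc_e Q h Lam nu.
Proof. exact: seq_e_val. Qed.

Lemma cyc_qhring : qhring Q i0 n cyc_x cyc_p cyc_en.
Proof.
have rl := cyc_pi_rel; apply: nat_qhring.
- move=> nu nu'; exact (tr_ee (rl _ _ (qh_ee Q nu nu'))).
- move=> r nu; exact (tr2 (rl _ _ (qh_xe Q r nu))).
- move=> r nu; exact (tr2 (rl _ _ (qh_psie Q r nu))).
- move=> r s; exact (tr2 (rl _ _ (qh_xx Q alpha beta r s))).
- move=> r nu; exact (tr3 (rl _ _ (qh_psix Q r nu))).
- move=> r nu; exact (tr3 (rl _ _ (qh_xpsi Q r nu))).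
- move=> r s n1 n2; exact (tr2 (rl _ _ (@qh_psix_far _ _ Q _ alpha _ beta r s n1 n2))).
- move=> r s rs; exact (tr2 (rl _ _ (@qh_psipsi_far _ _ Q _ alpha _ beta r s rs))).
- move=> r nu; exact (tr_pp cyc_piZ (rl _ _ (qh_psi2 Q r nu))).
by move=> r r' nu er; exact (tr_ppp cyc_piZ (rl _ _ (@qh_braid _ _ Q _ alpha _ beta r r' nu er))).
Qed.

Lemma cyc_pow mu : (0 < n)%N ->
  cyc_x 0 ^+ `|h (nth i0 mu 0) Lam|%N * cyc_en mu = 0.
Proof.
move=> n0; rewrite /cyc_en /seq_e; case E: (Ib_of _ _ _ mu) => [nu|]; last by rewrite mulr0.
rewrite (Ib_ofP E) /cyc_x -[0%N]/(nat_of_ord (Ordinal n0)) nat_xE -nth_IbetaE.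
rewrite -tr_pow; apply/eqP/to_quot_eq0; apply: in_ideal_gen.
by exists (Ordinal n0), nu; rewrite rmorphM rmorphXn.
Qed.
End Cyclotomic.

(** * Restriction to blocks of positions *)

Section Restriction.
Variables (K : fieldType) (I : choiceType) (Q : I -> I -> {poly {poly K}}) (i0 : I).
Variables (V : lmodType K) (x p : nat -> V -> V).
Implicit Types (M N : seq I -> V -> Prop) (mu nu : seq I).
Local Notation lab mu r := (nth i0 mu r).

Lemma sub_qhmod n D D' M N : qhmod Q i0 n D x p M -> stable n D' x p N ->
  subfam n N M -> (forall r, (r.+1 < n)%N -> D' r -> D r) -> qhmod Q i0 n D' x p N.
Proof.
move=> MP NP NM DD; split=> //.
- exact: (qh_xlin MP).
- exact: (qh_plin MP).
- by move=> r s mu v sm rn sn /(NM _ _ sm); apply: (qh_xxC MP).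
- by move=> r mu v sm rn Dr /(NM _ _ sm); apply: (qh_px MP) => //; apply: DD.
- by move=> r mu v sm rn Dr /(NM _ _ sm); apply: (qh_xp MP) => //; apply: DD.
- by move=> r s mu v sm rn Dr sn n1 n2 /(NM _ _ sm); apply: (qh_px_far MP) => //; apply: DD.
- move=> r s mu v sm rs sn Dr Ds /(NM _ _ sm); apply: (qh_pp_far MP) => //; apply: DD => //.
  by lia.
- by move=> r mu v sm rn Dr /(NM _ _ sm); apply: (qh_pp MP) => //; apply: DD.
move=> r mu v sm rn Dr Dr1 /(NM _ _ sm); apply: (qh_ppp MP) => //; apply: DD => //.
by lia.
Qed.

Lemma stable_sub n (D D' : pred nat) N : (forall r, D' r -> D r) -> stable n D x p N -> stable n D' x p N.
Proof.
move=> DD NP; split=> [mu|r mu v|r mu v sm rn Dr]; first exact: (st_sub NP).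
  exact: (st_x NP).
by apply: (st_p NP) => //; apply: DD.
Qed.

Section Left.
Variables (n k : nat) (D D' : pred nat) (N : seq I -> V -> Prop) (nu : seq I).
Hypotheses (kn : (k <= n)%N) (snu : size nu = (n - k)%N).
Hypothesis DD : forall r, (r.+1 < k)%N -> D' r -> D r.

Lemma stable_left : stable n D x p N -> stable k D' x p (fun mu => N (mu ++ nu)).
Proof.
have sz mu : size mu = k -> size (mu ++ nu) = n by rewrite size_cat => ->; lia.
move=> NP; split=> [mu|r mu v sm rn|r mu v sm rn Dr]; first exact: (st_sub NP).
  by apply: (st_x NP); [apply: sz|lia].
by rewrite -swp_cat_l ?sm //; apply: (st_p NP); [apply: sz|lia|apply: DD].
Qed.

Lemma restrict_left : qhmod Q i0 n D x p N ->
  qhmod Q i0 k D' x p (fun mu => N (mu ++ nu)).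
Proof.
have sz mu : size mu = k -> size (mu ++ nu) = n by rewrite size_cat => ->; lia.
have lb mu r : size mu = k -> (r < k)%N -> lab mu r = lab (mu ++ nu) r.
  by move=> sm rk; rewrite nth_cat sm rk.
move=> NP; split.
- exact: (stable_left (qh_st NP)).
- exact: (qh_xlin NP).
- exact: (qh_plin NP).
- move=> r s mu v /sz sm rn sn; apply: (qh_xxC NP sm); lia.
- move=> r mu v sm rn Dr; rewrite (lb mu r sm (ltnW rn)) (lb mu r.+1 sm rn); apply: (qh_px NP (sz _ sm)); [lia|exact: DD].
- move=> r mu v sm rn Dr; rewrite (lb mu r sm (ltnW rn)) (lb mu r.+1 sm rn); apply: (qh_xp NP (sz _ sm)); [lia|exact: DD].
- move=> r s mu v /sz sm rn Dr sn n1 n2; apply: (qh_px_far NP sm) => //; [lia|exact: DD|lia].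
- move=> r s mu v /sz sm rs sn Dr Ds; apply: (qh_pp_far NP sm) => //; [lia|apply: DD => //; lia|exact: DD].
- move=> r mu v sm rn Dr; rewrite (lb mu r sm (ltnW rn)) (lb mu r.+1 sm rn); apply: (qh_pp NP (sz _ sm)); [lia|exact: DD].
move=> r mu v sm rn Dr Dr1.
rewrite (lb mu r sm (ltnW (ltnW rn))) (lb mu r.+1 sm (ltnW rn)) (lb mu r.+2 sm rn).
by apply: (qh_ppp NP (sz _ sm)); [lia|apply: DD => //; lia|apply: DD].
Qed.
End Left.

Section Right.
Variables (n k : nat) (D D' : pred nat) (N : seq I -> V -> Prop) (nu : seq I).
Hypotheses (kn : (k <= n)%N) (snu : size nu = k).
Hypothesis DD : forall r, ((k + r).+1 < n)%N -> D' r -> D (k + r)%N.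
Local Notation shift f := (fun r => f (k + r)%N).

Lemma stable_right : stable n D x p N ->
  stable (n - k) D' (shift x) (shift p) (fun mu => N (nu ++ mu)).
Proof.
have sz mu : size mu = (n - k)%N -> size (nu ++ mu) = n by rewrite size_cat => ->; lia.
move=> NP; split=> [mu|r mu v sm rn|r mu v sm rn Dr]; first exact: (st_sub NP).
  by apply: (st_x NP); [apply: sz|lia].
by rewrite -swp_cat snu; apply: (st_p NP); [apply: sz|lia|apply: DD => //; lia].
Qed.

Lemma restrict_right : qhmod Q i0 n D x p N ->
  qhmod Q i0 (n - k) D' (shift x) (shift p) (fun mu => N (nu ++ mu)).
Proof.
have sz mu : size mu = (n - k)%N -> size (nu ++ mu) = n by rewrite size_cat => ->; lia.
have lb mu r : lab mu r = lab (nu ++ mu) (k + r).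
  by rewrite nth_cat snu ltnNge leq_addr /= addKn.
move=> NP; split.
- exact: (stable_right (qh_st NP)).
- move=> r; exact: (qh_xlin NP).
- move=> r; exact: (qh_plin NP).
- move=> r s mu v /sz sm rn sn; apply: (qh_xxC NP sm); lia.
- move=> r mu v sm rn Dr; rewrite (lb mu r) (lb mu r.+1) addnS; apply: (qh_px NP (sz _ sm)); [lia|apply: DD => //; lia].
- move=> r mu v sm rn Dr; rewrite (lb mu r) (lb mu r.+1) addnS; apply: (qh_xp NP (sz _ sm)); [lia|apply: DD => //; lia].
- move=> r s mu v /sz sm rn Dr sn n1 n2; apply: (qh_px_far NP sm) => //; [lia|apply: DD => //; lia|lia|lia|lia].
- move=> r s mu v /sz sm rs sn Dr Ds; apply: (qh_pp_far NP sm) => //; [lia|lia|apply: DD => //; lia|apply: DD => //; lia].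
- move=> r mu v sm rn Dr; rewrite (lb mu r) (lb mu r.+1) addnS; apply: (qh_pp NP (sz _ sm)); [lia|apply: DD => //; lia].
move=> r mu v sm rn Dr Dr1; rewrite (lb mu r) (lb mu r.+1) (lb mu r.+2) !addnS.
apply: (qh_ppp NP (sz _ sm)); [lia|apply: DD => //; lia|].
by rewrite -addnS; apply: DD => //; lia.
Qed.
End Right.
End Restriction.

(** * Dotted submodules *)

Section Dots.
Variables (K : fieldType) (I : choiceType) (Q : I -> I -> {poly {poly K}}) (i0 : I).
Variables (V : lmodType K) (n : nat) (x p : nat -> V -> V) (M : seq I -> V -> Prop).
Hypothesis MP : qhmod Q i0 n predT x p M.
Variable (w : I -> nat).
Local Notation lab mu r := (nth i0 mu r).

Fixpoint dots k (mu : seq I) (v : V) : V :=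
  if k is k'.+1 then iter (w (lab mu k')) (x k') (dots k' mu v) else v.

Lemma dots_lin k mu : linop (dots k mu).
Proof.
elim: k => //= k IH c u v /=; rewrite IH.
exact: (linop_iter _ (qh_xlin MP k)).
Qed.

Lemma M_x r mu v : size mu = n -> (r < n)%N -> M mu v -> M mu (x r v).
Proof. exact: (st_x (qh_st MP)). Qed.

Lemma M_p r mu v : size mu = n -> (r.+1 < n)%N -> M mu v -> M (swp r mu) (p r v).
Proof. by move=> *; apply: (st_p (qh_st MP)). Qed.

Lemma M_iter r m mu v : size mu = n -> (r < n)%N -> M mu v -> M mu (iter m (x r) v).
Proof. by move=> sm rn; apply: iter_in => u; apply: M_x. Qed.

Lemma dots_M k mu v : (k <= n)%N -> size mu = n -> M mu v -> M mu (dots k mu v).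
Proof.
move=> + sm Mv; elim: k => //= k IH kn.
by apply: M_iter => //; apply: IH; apply: ltnW.
Qed.

Lemma iter_comm (S : V -> Prop) (f g : V -> V) m v : (forall u, S u -> S (f u)) ->
  (forall u, S u -> g (f u) = f (g u)) -> S v -> g (iter m f v) = iter m f (g v).
Proof.
move=> hf hg Sv; elim: m => //= m IH; rewrite hg ?IH //.
exact: iter_in.
Qed.

Lemma x_iter r s m mu v : size mu = n -> (r < n)%N -> (s < n)%N -> M mu v ->
  x r (iter m (x s) v) = iter m (x s) (x r v).
Proof.
move=> sm rn sn; apply: (@iter_comm (M mu)) => u; first exact: M_x.
exact: (qh_xxC MP).
Qed.

Lemma iter_iter r s m m' mu v : size mu = n -> (r < n)%N -> (s < n)%N -> M mu v ->
  iter m (x r) (iter m' (x s) v) = iter m' (x s) (iter m (x r) v).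
Proof.
move=> sm rn sn; apply: (@iter_comm (M mu)) => u; first exact: M_x.
by move=> Mu; rewrite -(@x_iter s r m mu).
Qed.

Lemma dots_x k r mu v : (k <= n)%N -> size mu = n -> (r < n)%N -> M mu v ->
  x r (dots k mu v) = dots k mu (x r v).
Proof.
move=> + sm rn Mv; elim: k => //= k IH kn.
rewrite (@x_iter _ _ _ mu) ?IH //; first exact: ltnW.
by apply: dots_M => //; apply: ltnW.
Qed.

(** A crossing passes through one power of [x] on each of its strands, because
    it commutes with the symmetric monomials when the labels agree. *)
Lemma p_iter_iter r mu v : size mu = n -> (r.+1 < n)%N -> M mu v ->
  p r (iter (w (lab mu r.+1)) (x r.+1) (iter (w (lab mu r)) (x r) v)) =
  iter (w (lab mu r)) (x r.+1) (iter (w (lab mu r.+1)) (x r) (p r v)).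
Proof.
move=> sm rn Mv; have rn' := ltnW rn; have sm' : size (swp r mu) = n by rewrite size_swp.
have [e|ne] := eqVneq (lab mu r) (lab mu r.+1).
  pose y := x r.+1 \o x r.
  have yM u : M mu u -> M mu (y u) by move=> Mu; do 2!apply: M_x => //.
  have iy m u : M mu u -> iter m (x r.+1) (iter m (x r) u) = iter m y u.
    move=> Mu; elim: m => //= m IH; rewrite -IH /y /= -(@x_iter r r.+1 m mu) //.
    exact: M_iter.
  have em : swp r mu = mu by apply: (@swp_id _ i0); rewrite ?sm.
  rewrite e !iy //; last by rewrite -{1}em; apply: M_p.
  apply: (@iter_comm (M mu)) => // u Mu; rewrite /y /=.
  rewrite (qh_px MP sm rn _ (M_x sm rn' Mu)) // (qh_xxC MP sm' rn rn'); last exact: M_p.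
  rewrite (qh_xp MP sm rn _ Mu) // (linopD _ _ (qh_xlin MP r)) e eqxx.
  by rewrite (linopMn _ _ (qh_xlin MP r)).
have pr1 u : M mu u -> p r (x r.+1 u) = x r (p r u).
  by move=> Mu; rewrite (qh_px MP sm rn _ Mu) // (negPf ne) mulr0n addr0.
have pr u : M mu u -> p r (x r u) = x r.+1 (p r u).
  by move=> Mu; rewrite (qh_xp MP sm rn _ Mu) // (negPf ne) mulr0n addr0.
have it1 m u : M mu u -> p r (iter m (x r.+1) u) = iter m (x r) (p r u).
  by move=> Mu; elim: m => //= m IH; rewrite pr1 ?IH //; apply: M_iter.
have it m u : M mu u -> p r (iter m (x r) u) = iter m (x r.+1) (p r u).
  by move=> Mu; elim: m => //= m IH; rewrite pr ?IH //; apply: M_iter.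
rewrite it1 ?it //; last exact: M_iter.
by rewrite (@iter_iter _ _ _ _ (swp r mu)) //; apply: M_p.
Qed.

(** The numbers of dots depend on the labels only, so a crossing exchanges
    labels and dots together unless it cuts the end of the block. *)
Lemma dots_p k r mu v : (k <= n)%N -> size mu = n -> (r.+1 < n)%N -> r.+1 != k ->
  M mu v -> p r (dots k mu v) = dots k (swp r mu) (p r v).
Proof.
move=> + sm rn + Mv; have [m] := ubnP k; elim: m k => // m IH [|k] //= hk kn.
rewrite eqSS => rk; have km : (k < m)%N by lia.
have Md j : (j <= n)%N -> M mu (dots j mu v) by move=> jn; apply: dots_M.
have pfar : k != r -> k != r.+1 -> p r (iter (w (lab mu k)) (x k) (dots k mu v)) =
    iter (w (lab (swp r mu) k)) (x k) (p r (dots k mu v)).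
  move=> n1 n2; rewrite nth_swp ?sm // (negPf n1) (negPf n2).
  apply: (@iter_comm (M mu)) (Md k (ltnW kn)) => u; first exact: M_x.
  by move=> Mu; apply: (qh_px_far MP sm).
have [e|n1] := eqVneq r.+1 k; last first.
  have [n2 n3] : k != r /\ k != r.+1 by split; rewrite eq_sym.
  by rewrite (pfar n2 n3) IH // ltnW.
have rn' : (r <= n)%N by lia.
subst k => /=; rewrite p_iter_iter //; last exact: Md.
rewrite IH //; [|lia|lia].
rewrite !nth_swp ?sm // eqxx; case: eqP => [|_]; first by lia.
by rewrite eqxx.
Qed.

Definition dotted k mu v := exists2 u, M mu u & v = dots k mu u.

Lemma dotted_stable k : (k <= n)%N ->
  stable n [pred r | predT r & r.+1 != k] x p (dotted k).
Proof.
move=> kn; split=> [mu|r mu v sm rn [u Mu ->]|r mu v sm rn /= rk [u Mu ->]].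
- split=> [|c u v [u' Mu ->] [v' Mv ->]].
    exists 0; first by case: (st_sub (qh_st MP) mu).
    by rewrite (linop0 (dots_lin k mu)).
  exists (c *: u' + v'); first exact: (st_sub (qh_st MP) mu).2.
  by rewrite dots_lin.
- by exists (x r u); [apply: M_x|apply: dots_x].
by exists (p r u); [apply: M_p|apply: dots_p].
Qed.

Lemma dotted_M k : (k <= n)%N -> subfam n (dotted k) M.
Proof. by move=> kn mu v sm [u Mu ->]; apply: dots_M. Qed.

Lemma dots_eq0 k mu v : (0 < k)%N -> iter (w (lab mu 0)) (x 0) v = 0 -> dots k mu v = 0.
Proof.
case: k => // k _ e; elim: k => [|k IH] //.
by rewrite -[LHS]/(iter _ _ (dots k.+1 mu v)) IH (linop0 (linop_iter _ (qh_xlin MP _))).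
Qed.
End Dots.

(** The family [M'] plays the part of zero: the condition says that [s] carries
    no nonzero vector of [M] modulo [M'] as soon as the first dot of this
    quotient satisfies the cyclotomic relation with multiplicities [c]. *)
Definition vanishing (K : fieldType) (I : choiceType) (Q : I -> I -> {poly {poly K}})
    (i0 : I) (c : I -> nat) (s : seq I) : Prop :=
  forall n (V : lmodType K) (x p : nat -> V -> V) (M M' : seq I -> V -> Prop),
  size s = n -> qhmod Q i0 n predT x p M -> stable n predT x p M' ->
  (forall mu v, (0 < n)%N -> size mu = n -> M mu v ->
     M' mu (iter (c (nth i0 mu 0)) (x 0%N) v)) ->
  forall v, M s v -> M' s v.

Section Forward.
Variables (K : fieldType) (I : choiceType) (Q : I -> I -> {poly {poly K}}) (i0 : I).

Lemma stable0 (V : lmodType K) n D (x p : nat -> V -> V) M :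
  qhmod Q i0 n D x p M -> stable n D x p (fun (_ : seq I) v => v = 0).
Proof.
move=> MP; split=> [_|r _ v _ _ ->|r _ v _ _ _ ->].
- by split=> // c u v -> ->; rewrite scaler0 addr0.
- exact: (linop0 (qh_xlin MP r)).
exact: (linop0 (qh_plin MP r)).
Qed.

Lemma nil_not_vanishing c : ~ vanishing Q i0 c [::].
Proof.
move=> H.
have MP : qhmod Q i0 0 predT (fun _ (v : K^o) => v) (fun _ v => v) (fun (_ : seq I) _ => True).
  by split=> //; split.
have c0 mu (v : K^o) : (0 < 0)%N -> size mu = 0%N -> True -> iter (c (nth i0 mu 0)) id v = 0.
  by [].
have := H _ _ _ _ _ _ erefl MP (stable0 MP) c0 1 Logic.I.
by move/eqP; rewrite oner_eq0.
Qed.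

Variables (V : lmodType K) (n : nat) (x p : nat -> V -> V) (M : seq I -> V -> Prop).
Hypothesis MP : qhmod Q i0 n predT x p M.
Variables (a w : I -> nat).
Local Notation lab mu r := (nth i0 mu r).
Hypothesis cycM : forall mu v, (0 < n)%N -> size mu = n -> M mu v ->
  iter (a (lab mu 0) + w (lab mu 0)) (x 0%N) v = 0.

Local Notation dotted k := (dotted i0 x M w k).
Local Notation ind k := (induced n predT p k (dotted k)).

Lemma ind_stable k : (k <= n)%N -> stable n predT x p (ind k).
Proof.
move=> kn; apply: (induced_stable MP kn (dotted_M MP kn)).
exact: (dotted_stable MP w kn).
Qed.

(** The missing [a] dots complete the [w] dots already on the first strand. *)
Lemma dotted_cyc k mu v : (0 < k <= n)%N -> size mu = n -> dotted k mu v ->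
  iter (a (lab mu 0)) (x 0%N) v = 0.
Proof.
move=> /andP[k0 kn] sm [u Mu ->].
have n0 : (0 < n)%N by lia.
have -> m : iter m (x 0%N) (dots i0 x w k mu u) = dots i0 x w k mu (iter m (x 0%N) u).
  elim: m => //= m ->; rewrite (dots_x MP) //.
  exact: (M_iter MP).
apply: (dots_eq0 MP) => //.
by rewrite -iterD addnC; apply: cycM.
Qed.

(** If no splitting of [s] survives, the vectors labelled [s] lie in the
    submodule generated by [dotted k] for [k = 0], and then for [k + 1] whenever
    for [k], hence for [k = n], where the relation for [a] kills them. *)
Lemma forward_aux s : size s = n ->
  (forall b, size b = n -> vanishing Q i0 a (mask b s) \/ vanishing Q i0 w (mask (map negb b) s)) ->
  forall v, M s v -> v = 0.
Proof.
move=> ss H v Mv.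
(* One step: a component has the labels [mask b s] on the first block and the
   complementary ones on the second; one of them vanishes by hypothesis. *)
have up k u : (k < n)%N -> ind k s u -> ind k.+1 s u.
  move=> kn; have kn' := ltnW kn; move=> hu.
  apply: (induced_elim kn' (ind_stable kn) hu) => b y sb cb.
  have s1 : size (mask b s) = k by rewrite size_mask ?sb.
  have s2 : size (mask (map negb b) s) = (n - k)%N.
    by rewrite size_mask ?size_map ?sb // count_map -sb -cb -(count_predC id b) addKn.
  have DP := sub_qhmod MP (dotted_stable MP w kn') (dotted_M MP kn') (fun _ _ _ => isT).
  move=> hy; case: (H b sb) => van.
    suff -> : y = 0 by case: (st_sub (ind_stable kn) (mask b s ++ mask (map negb b) s)).
    have DD r : (r.+1 < k)%N -> predT r -> [pred r | predT r & r.+1 != k] r.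
      by move=> rk _ /=; lia.
    have RP := restrict_left kn' s2 DD DP.
    apply: (van k V x p _ (fun (_ : seq I) u => u = 0) s1 RP (stable0 RP) _ y hy).
    move=> mu z k0 sm hz.
    have kk : (0 < k <= n)%N by rewrite k0.
    have sz : size (mu ++ mask (map negb b) s) = n by rewrite size_cat sm s2; lia.
    by have := dotted_cyc kk sz hz; rewrite nth_cat sm k0.
  have SP := stable_right kn' s1 (D' := predT) (fun _ _ _ => isT) (ind_stable kn).
  have DD r : ((k + r).+1 < n)%N -> predT r -> [pred r | predT r & r.+1 != k] (k + r)%N.
    by move=> rk _ /=; lia.
  have RP := restrict_right kn' s1 DD DP.
  apply: (van _ V _ _ _ _ s2 RP SP _ y hy).
  move=> mu _ _ sm [u' Mu' ->]; apply: induced_base; first by rewrite size_cat sm s1; lia.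
  by exists u' => //=; rewrite nth_cat s1 ltnn subnn addn0.
have top k : (k <= n)%N -> ind k s v.
  elim: k => [|k IH] kn; last by apply: up => //; apply: IH; apply: ltnW.
  by apply: induced_base => //; exists v.
apply: (@induced_elim _ _ _ n predT x p n (leqnn n) (dotted n) (fun (_ : seq I) u => u = 0) s v) => //.
- exact: stable0 MP.
- exact: top.
move=> b y sb cb hy.
have ab : all id b by rewrite all_count cb sb.
have eb : b = nseq (size b) true by apply/all_pred1P; apply: sub_all ab; case.
have e2 : mask (map negb b) s = [::] by rewrite eb map_nseq mask_false.
case: (H b sb); rewrite ?e2 => van; last by case: (nil_not_vanishing van).
move: hy; rewrite e2 cats0 => hy.
have s1 : size (mask b s) = n by rewrite size_mask ?sb.
have DP := sub_qhmod MP (dotted_stable MP w (leqnn n)) (dotted_M MP (leqnn n)) (fun _ _ _ => isT).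
have DD r : (r.+1 < n)%N -> predT r -> [pred r | predT r & r.+1 != n] r.
  by move=> rk _ /=; lia.
have s0 : size ([::] : seq I) = (n - n)%N by rewrite subnn.
have RP := restrict_left (leqnn n) s0 DD DP.
apply: (van n V x p _ (fun (_ : seq I) u => u = 0) s1 RP (stable0 RP) _ y).
- move=> mu z k0 sm; rewrite cats0 => hz.
  by apply: (dotted_cyc _ _ hz); rewrite ?k0 /=.
by rewrite cats0.
Qed.
End Forward.

(** * The generic representation *)

Section Extension.
Variables (K L : fieldType) (phi : {rmorphism K -> L}).

Definition ext_space of {rmorphism K -> L} : Type := L.
Local Notation E := (ext_space phi).
HB.instance Definition _ := GRing.Zmodule.on E.

Definition ext_scale (c : K) (u : E) : E := phi c * (u : L).

Lemma ext_scaleA c d u : ext_scale c (ext_scale d u) = ext_scale (c * d) u.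
Proof. by rewrite /ext_scale rmorphM mulrA. Qed.
Lemma ext_scale1 : left_id 1 ext_scale.
Proof. by move=> u; rewrite /ext_scale rmorph1 mul1r. Qed.
Lemma ext_scaleDr : right_distributive ext_scale +%R.
Proof. by move=> c u v; rewrite /ext_scale -mulrDr. Qed.
Lemma ext_scaleDl v : {morph ext_scale^~ v : c d / c + d}.
Proof. by move=> c d; rewrite /ext_scale rmorphD -mulrDl. Qed.

HB.instance Definition _ := GRing.Zmodule_isLmodule.Build K E
  ext_scaleA ext_scale1 ext_scaleDr ext_scaleDl.

Definition ev2 (q : {poly {poly K}}) (u v : L) : L :=
  \sum_(k < size q) \sum_(m < size q`_k) phi q`_k`_m * (u ^+ k * v ^+ m).

Definition evd (q : {poly {poly K}}) (u v w : L) : L :=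
  \sum_(k < size q) \sum_(m < size q`_k) phi q`_k`_m *
    ((\sum_(b < k) u ^+ (k.-1 - b) * w ^+ b) * v ^+ m).

Lemma evdE q u v w : (u - w) * evd q u v w = ev2 q u v - ev2 q w v.
Proof.
rewrite /evd /ev2 -sumrB mulr_sumr; apply: eq_bigr => k _.
rewrite -sumrB mulr_sumr; apply: eq_bigr => m _.
by rewrite mulrCA -mulrBr -mulrBl subrXX -mulrA.
Qed.

Lemma ev2_horner q u v : ev2 q u v = (map_poly (map_poly phi) q).[u%:P].[v].
Proof.
rewrite (horner_coef (map_poly _ q)) size_map_inj_poly ?rmorph0 //; last first.
  by apply: map_inj_poly; rewrite ?rmorph0 //; apply: fmorph_inj.
rewrite horner_sum; apply: eq_bigr => k _.
rewrite coef_map -polyC_exp hornerM hornerC horner_coef size_map_poly mulr_suml.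
by apply: eq_bigr => m _; rewrite coef_map -mulrA [v ^+ _ * _]mulrC.
Qed.

Lemma ev2_swap q u v : ev2 (swapXY q) u v = ev2 q v u.
Proof. by rewrite !ev2_horner -swapXY_map horner2_swapXY. Qed.
End Extension.

Section NthSwap.
Variables (T : Type) (d : T).
Lemma nth_swp_l r (s : seq T) : (r.+1 < size s)%N -> nth d (swp r s) r = nth d s r.+1.
Proof. by move=> h; rewrite nth_swp // eqxx. Qed.
Lemma nth_swp_r r (s : seq T) : (r.+1 < size s)%N -> nth d (swp r s) r.+1 = nth d s r.
Proof. by move=> h; rewrite nth_swp // eqxx; case: eqP => //; lia. Qed.
Lemma nth_swp_far r j (s : seq T) : (r.+1 < size s)%N -> j != r -> j != r.+1 ->
  nth d (swp r s) j = nth d s j.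
Proof. by move=> h /negPf n1 /negPf n2; rewrite nth_swp // n1 n2. Qed.
Lemma nth_swp_rr r (s : seq T) : (r.+1 < size s)%N -> nth d (swp r s) r.+2 = nth d s r.+2.
Proof. by move=> h; apply: nth_swp_far => //; lia. Qed.
Lemma nth_swp_ll r (s : seq T) : (r.+2 < size s)%N -> nth d (swp r.+1 s) r = nth d s r.
Proof. by move=> h; apply: nth_swp_far => //; lia. Qed.
End NthSwap.

Section Generic.
Variables (K : fieldType) (I : choiceType) (Q : I -> I -> {poly {poly K}}) (i0 : I).
Hypothesis Qii : forall i, Q i i = 0.
Hypothesis Qsym : forall i j, Q i j = swapXY (Q j i).
Variables (L : fieldType) (phi : {rmorphism K -> L}) (X : nat -> L) (n : nat).
Hypothesis Xinj : forall c c', (c < n)%N -> (c' < n)%N -> X c = X c' -> c = c'.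
Variable iota_ : nat -> I.
Local Notation E := (ext_space phi).
Local Notation V := (seq nat -> E).
Local Notation ev2 := (ev2 phi).
Local Notation evd := (evd phi).
Implicit Types (f : V) (s : seq nat).
Local Notation col s r := (nth 0%N s r).
Local Notation same c c' := (iota_ c == iota_ c').

(** Strands keep their identity: the strand of colour [c] has label [iota_ c]
    and its dot acts as the scalar [X c]. Vectors are functions on the
    arrangements of the colours. A crossing of strands with equal labels acts
    as a divided difference; otherwise the factor [Q] is charged to one of the
    two directions of the exchange. *)
Definition swp_coef (c c' : nat) : L :=
  if same c c' then (X c - X c')^-1
  else if (c' < c)%N then 1 else ev2 (Q (iota_ c) (iota_ c')) (X c) (X c').
Definition stay_coef (c c' : nat) : L :=
  if same c c' then - (X c - X c')^-1 else 0.

Definition gen_x r f : V := fun s => X (col s r) * (f s : L).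
Definition gen_p r f : V := fun s =>
  swp_coef (col s r) (col s r.+1) * (f (swp r s) : L) +
  stay_coef (col s r) (col s r.+1) * (f s : L).

Definition arrangement s := perm_eq s (iota 0 n).

Definition gen_space (mu : seq I) f : Prop :=
  forall s, f s != 0 -> arrangement s /\ map iota_ s = mu.

Lemma gen_x_lin r : linop (gen_x r).
Proof.
move=> c f g; apply/funext => s; rewrite /gen_x.
rewrite -[LHS]/(X _ * (phi c * (f s : L) + (g s : L))).
by rewrite -[RHS]/(phi c * (X _ * (f s : L)) + X _ * (g s : L)); ring.
Qed.

Lemma gen_p_lin r : linop (gen_p r).
Proof.
move=> c f g; apply/funext => s; rewrite /gen_p.
set u := swp_coef _ _; set v := stay_coef _ _.
rewrite -[LHS]/(u * (phi c * (f (swp r s) : L) + (g (swp r s) : L)) + v * (phi c * (f s : L) + (g s : L))).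
rewrite -[RHS]/(phi c * (u * (f (swp r s) : L) + v * (f s : L)) + (u * (g (swp r s) : L) + v * (g s : L))).
by ring.
Qed.

Lemma arrangement_swp r s : arrangement (swp r s) = arrangement s.
Proof. by rewrite /arrangement (permPl (perm_swp r s)). Qed.

Lemma arr_size s : arrangement s -> size s = n.
Proof. by move/perm_size; rewrite size_iota. Qed.

Lemma arr_lt s r : arrangement s -> (r < n)%N -> (col s r < n)%N.
Proof.
move=> hs rn; have : col s r \in iota 0 n by rewrite -(perm_mem hs) mem_nth ?arr_size.
by rewrite mem_iota.
Qed.

Lemma arr_neq s r r' : arrangement s -> (r < n)%N -> (r' < n)%N -> r != r' ->
  X (col s r) != X (col s r').
Proof.
move=> hs rn rn' ne; apply/eqP => /(Xinj (arr_lt hs rn) (arr_lt hs rn'))/eqP.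
rewrite nth_uniq ?arr_size ?(negPf ne) //.
by rewrite (perm_uniq hs) iota_uniq.
Qed.

Lemma off_arr mu f s : gen_space mu f -> ~~ arrangement s -> f s = 0.
Proof. by move=> hf; apply: contraNeq => /hf[]. Qed.

Lemma lab_eq mu f s r r' : gen_space mu f -> (r < n)%N -> (r' < n)%N ->
  f s *+ (nth i0 mu r == nth i0 mu r') = f s *+ same (col s r) (col s r').
Proof.
move=> hf rn rn'; have [->|/hf[hs <-]] := eqVneq (f s) 0; first by rewrite !mul0rn.
by rewrite !(nth_map 0%N) ?arr_size.
Qed.

Lemma gen_space_sub mu : subsp (gen_space mu).
Proof.
split=> [s|c f g hf hg s]; first by rewrite eqxx.
have [f0|/hf//] := eqVneq (f s) 0; have [g0|/hg//] := eqVneq (g s) 0.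
by rewrite -[(c *: f + g) s]/(phi c * (f s : L) + (g s : L)) f0 g0 mulr0 addr0 eqxx.
Qed.

Lemma gen_stable : stable n predT gen_x gen_p gen_space.
Proof.
split=> [mu|r mu f sm rn hf s|r mu f sm rn _ hf s]; first exact: gen_space_sub.
  by rewrite /gen_x => h; apply: hf; apply: contraNneq h => ->; rewrite mulr0.
rewrite /gen_p => h.
have [f1|/hf] := eqVneq (f (swp r s)) 0; last first.
  by rewrite arrangement_swp map_swp => -[? <-]; rewrite swpK.
move: h; rewrite f1 mulr0 add0r /stay_coef.
case: ifP => [/eqP e h|_]; last by rewrite mul0r eqxx.
have /hf[hs em] : f s != 0 by apply: contraNneq h => ->; rewrite mulr0.
split=> //; rewrite em; apply/esym/(@swp_id _ i0); rewrite ?sm //.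
by rewrite -em !(nth_map 0%N) ?arr_size //; lia.
Qed.

Lemma stay_coefE s r : arrangement s -> (r.+1 < n)%N ->
  stay_coef (col s r) (col s r.+1) * (X (col s r.+1) - X (col s r)) =
  (same (col s r) (col s r.+1))%:R.
Proof.
move=> hs rn; rewrite /stay_coef; case: ifP => _; last by rewrite mul0r.
have := @arr_neq s r r.+1 hs (ltnW rn) rn; rewrite neq_ltn ltnSn => /(_ isT).
by rewrite -subr_eq0 => h; rewrite -[_ - X (col s r)]opprB mulrNN mulVf.
Qed.

Lemma gen_px r mu f : size mu = n -> (r.+1 < n)%N -> predT r -> gen_space mu f ->
  gen_p r (gen_x r.+1 f) = gen_x r (gen_p r f) + f *+ (nth i0 mu r == nth i0 mu r.+1).
Proof.
move=> sm rn _ hf; apply/funext => s; rewrite addrfctE natmulfctE (lab_eq _ hf) ?(ltnW rn) //.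
rewrite /gen_x /gen_p; have [hs|ns] := boolP (arrangement s); last first.
  rewrite (off_arr hf ns) (off_arr hf (s := swp r s)) ?arrangement_swp //.
  by rewrite mul0rn !mulr0 !addr0 mulr0.
rewrite nth_swp_r ?arr_size // -mulr_natl -(stay_coefE hs rn).
ring.
Qed.

Lemma gen_xp r mu f : size mu = n -> (r.+1 < n)%N -> predT r -> gen_space mu f ->
  gen_x r.+1 (gen_p r f) = gen_p r (gen_x r f) + f *+ (nth i0 mu r == nth i0 mu r.+1).
Proof.
move=> sm rn _ hf; apply/funext => s; rewrite addrfctE natmulfctE (lab_eq _ hf) ?(ltnW rn) //.
rewrite /gen_x /gen_p; have [hs|ns] := boolP (arrangement s); last first.
  rewrite (off_arr hf ns) (off_arr hf (s := swp r s)) ?arrangement_swp //.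
  by rewrite mul0rn !mulr0 !addr0 mulr0.
rewrite nth_swp_l ?arr_size // -mulr_natl -(stay_coefE hs rn).
ring.
Qed.

Lemma stay_coefC c c' : stay_coef c' c = - stay_coef c c'.
Proof.
rewrite /stay_coef eq_sym; case: ifP => _; last by rewrite oppr0.
by rewrite -[X c' - X c]opprB invrN opprK.
Qed.

(** The quadratic relation, coefficient by coefficient: for equal labels the
    divided difference squares to zero, and otherwise exactly one of the two
    directions contributes the factor [Q]. *)
Lemma coef_square c c' : X c != X c' ->
  swp_coef c c' * swp_coef c' c + stay_coef c c' ^+ 2 =
  ev2 (Q (iota_ c) (iota_ c')) (X c) (X c').
Proof.
move=> ne; rewrite /swp_coef /stay_coef [iota_ c' == _]eq_sym.
case: eqP => [<-|_].
  rewrite Qii -[X c' - X c]opprB invrN mulrN sqrrN -expr2 addNr.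
  by rewrite /ev2 size_poly0 big_ord0.
rewrite expr0n addr0; case: (ltngtP c c') => [h|h|e]; last by rewrite e eqxx in ne.
  by rewrite mulr1.
by rewrite mul1r Qsym ev2_swap.
Qed.

Lemma iter_gen_x r k f s : iter k (gen_x r) f s = X (col s r) ^+ k * (f s : L).
Proof.
elim: k => [|k IH] /=; first by rewrite expr0 mul1r.
by rewrite /gen_x IH exprS mulrA.
Qed.

Lemma gen_eval2 q r r' f s :
  op_eval2 q (gen_x r) (gen_x r') f s = ev2 q (X (col s r)) (X (col s r')) * (f s : L).
Proof.
rewrite /op_eval2 fct_sumE /ev2 mulr_suml; apply: eq_bigr => k _.
rewrite fct_sumE mulr_suml; apply: eq_bigr => m _.
rewrite -[LHS]/(phi _ * (iter k (gen_x r) (iter m (gen_x r') f) s : L)).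
by rewrite !iter_gen_x !mulrA.
Qed.

Lemma gen_ddiff q r r' r'' f s :
  op_ddiff q (gen_x r) (gen_x r') (gen_x r'') f s =
  evd q (X (col s r)) (X (col s r')) (X (col s r'')) * (f s : L).
Proof.
rewrite /op_ddiff fct_sumE /evd mulr_suml; apply: eq_bigr => k _.
rewrite fct_sumE mulr_suml; apply: eq_bigr => m _.
set G := \sum_(b < k) _; rewrite -[LHS]/(phi _ * (G s : L)) /G fct_sumE.
rewrite -mulrA; congr (_ * _); rewrite !mulr_suml; apply: eq_bigr => b _.
by rewrite !iter_gen_x !mulrA.
Qed.

Lemma lab_col mu f s r : gen_space mu f -> (r < n)%N -> f s != 0 ->
  nth i0 mu r = iota_ (col s r).
Proof. by move=> hf rn /hf[hs <-]; rewrite (nth_map 0%N) ?arr_size. Qed.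

Lemma gen_pp r mu f : size mu = n -> (r.+1 < n)%N -> predT r -> gen_space mu f ->
  gen_p r (gen_p r f) = op_eval2 (Q (nth i0 mu r) (nth i0 mu r.+1)) (gen_x r) (gen_x r.+1) f.
Proof.
move=> sm rn _ hf; apply/funext => s; rewrite gen_eval2.
have -> : ev2 (Q (nth i0 mu r) (nth i0 mu r.+1)) (X (col s r)) (X (col s r.+1)) * (f s : L) =
    ev2 (Q (iota_ (col s r)) (iota_ (col s r.+1))) (X (col s r)) (X (col s r.+1)) * (f s : L).
  have [->|f0] := eqVneq (f s) 0; first by rewrite !mulr0.
  by rewrite (lab_col hf _ f0) ?(lab_col hf rn f0) // ltnW.
rewrite /gen_p swpK; have [hs|ns] := boolP (arrangement s); last first.
  rewrite (off_arr hf ns) (off_arr hf (s := swp r s)) ?arrangement_swp //.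
  by rewrite !mulr0 !addr0 !mulr0 !addr0.
rewrite nth_swp_l ?nth_swp_r ?arr_size // stay_coefC -coef_square; first by ring.
by apply: arr_neq => //; [apply: ltnW|lia].
Qed.

Lemma gen_px_far r j mu f : size mu = n -> (r.+1 < n)%N -> predT r -> (j < n)%N ->
  j != r -> j != r.+1 -> gen_space mu f -> gen_p r (gen_x j f) = gen_x j (gen_p r f).
Proof.
move=> sm rn _ jn n1 n2 hf; apply/funext => s; rewrite /gen_p /gen_x.
have [hs|ns] := boolP (arrangement s); last first.
  rewrite (off_arr hf ns) (off_arr hf (s := swp r s)) ?arrangement_swp //.
  by rewrite !mulr0 !addr0 mulr0.
by rewrite nth_swp_far ?arr_size //; ring.
Qed.

Lemma gen_pp_far r q mu f : size mu = n -> (r.+1 < q)%N -> (q.+1 < n)%N -> predT r ->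
  predT q -> gen_space mu f -> gen_p r (gen_p q f) = gen_p q (gen_p r f).
Proof.
move=> sm rq qn _ _ hf; apply/funext => s; rewrite /gen_p -swp_far //.
have [hs|ns] := boolP (arrangement s); last first.
  have z s' : arrangement s' = arrangement s -> f s' = 0.
    by move=> e; apply: (off_arr hf); rewrite e.
  by rewrite !z ?arrangement_swp // !mulr0 !addr0 !mulr0 !addr0.
by rewrite !nth_swp_far ?arr_size //; try ring; lia.
Qed.

(** The identity behind the braid relation: [f0] to [f5] are the values on the
    six arrangements of three colours, [aij] the exchange coefficients and [bij]
    the stationary ones. *)
Lemma braid_ring (a01 a02 a12 a10 a21 b01 b02 b12 dd f0 f1 f2 f3 f4 f5 : L) :
  b12 * b01 = b02 * (b12 + b01) ->
  b02 * ((a12 * a21 + b12 ^+ 2) - (a01 * a10 + b01 ^+ 2)) = dd ->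
  a12 * (a02 * (a01 * f5 + b01 * f4) + b02 * (a21 * f0 + - b12 * f1)) +
  b12 * (a01 * (a02 * f3 + b02 * f2) + b01 * (a12 * f1 + b12 * f0)) -
  (a01 * (a02 * (a12 * f5 + b12 * f3) + b02 * (a10 * f0 + - b01 * f2)) +
   b01 * (a12 * (a02 * f4 + b02 * f1) + b12 * (a01 * f2 + b01 * f0))) = dd * f0.
Proof.
move=> T <-; apply/eqP; rewrite -subr_eq0.
rewrite (_ : _ - _ = (b12 * b01 - b02 * (b12 + b01)) * ((b12 - b01) * f0 + a12 * f1 - a01 * f2)).
  by rewrite T subrr mul0r.
by ring.
Qed.

(** The three stationary coefficients are inverse differences or zero according
    to the pattern of equal labels, and in every pattern they satisfy the two
    hypotheses of [braid_ring]. *)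
Lemma gen_ppp r mu f : size mu = n -> (r.+2 < n)%N -> predT r -> predT r.+1 ->
  gen_space mu f ->
  gen_p r.+1 (gen_p r (gen_p r.+1 f)) - gen_p r (gen_p r.+1 (gen_p r f)) =
  op_ddiff (Q (nth i0 mu r) (nth i0 mu r.+1)) (gen_x r) (gen_x r.+1) (gen_x r.+2) f
    *+ (nth i0 mu r == nth i0 mu r.+2).
Proof.
move=> sm rn _ _ hf; apply/funext => s.
have rn1 : (r.+1 < n)%N by apply: ltnW.
have rn0 : (r < n)%N by apply: ltnW.
rewrite addrfctE opprfctE natmulfctE gen_ddiff.
have -> : (evd (Q (nth i0 mu r) (nth i0 mu r.+1)) (X (col s r)) (X (col s r.+1)) (X (col s r.+2)) * (f s : L)) *+ (nth i0 mu r == nth i0 mu r.+2) =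
   (evd (Q (iota_ (col s r)) (iota_ (col s r.+1))) (X (col s r)) (X (col s r.+1)) (X (col s r.+2)) * (f s : L)) *+ same (col s r) (col s r.+2).
  have [->|f0] := eqVneq (f s) 0; first by rewrite !mulr0 !mul0rn.
  by rewrite !(lab_col hf _ f0).
have [hs|ns] := boolP (arrangement s); last first.
  have z s' : arrangement s' = arrangement s -> f s' = 0.
    by move=> e; apply: (off_arr hf); rewrite e.
  by rewrite /gen_p !z ?arrangement_swp // !(mulr0, addr0) subr0 mul0rn.
have ss := arr_size hs.
rewrite /gen_p -swp_braid ?ss //.
rewrite !(nth_swp_l, nth_swp_r, nth_swp_rr, nth_swp_ll) ?size_swp ?ss //.
have n01 : X (col s r) - X (col s r.+1) != 0 by rewrite subr_eq0 arr_neq //; lia.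
have n02 : X (col s r) - X (col s r.+2) != 0 by rewrite subr_eq0 arr_neq //; lia.
have n12 : X (col s r.+1) - X (col s r.+2) != 0 by rewrite subr_eq0 arr_neq //; lia.
rewrite !swpK !(stay_coefC (col s r.+1) (col s r.+2)) !(stay_coefC (col s r) (col s r.+1)).
move: (col s r) (col s r.+1) (col s r.+2) n01 n02 n12 => c0 c1 c2 n01 n02 n12.
rewrite -mulr_natr mulrAC.
apply: braid_ring.
  rewrite /stay_coef; case: (eqVneq (iota_ c0) (iota_ c1)) => [<-|ne01].
    case: eqP => _; last by rewrite !mul0r.
    by field; rewrite n01 n02 n12.
  case: (eqVneq (iota_ c1) (iota_ c2)) => [<-|ne12]; last by rewrite addr0 !mulr0.
  by rewrite (negPf ne01) mulr0 mul0r.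
have m12 : X c1 != X c2 by rewrite -subr_eq0.
have m01 : X c0 != X c1 by rewrite -subr_eq0.
rewrite (coef_square m12) (coef_square m01).
rewrite /stay_coef; case: eqP => [e02|_]; last by rewrite mul0r mulr0.
rewrite mulr1 -e02 [Q (iota_ c1) _]Qsym ev2_swap.
apply: (mulfI n02); rewrite evdE mulNr mulrN mulrA mulfV // mul1r opprB.
by [].
Qed.

Lemma gen_qhmod : qhmod Q i0 n predT gen_x gen_p gen_space.
Proof.
split.
- exact: gen_stable.
- exact: gen_x_lin.
- exact: gen_p_lin.
- move=> r j mu f _ _ _ _; apply/funext => s.
  by rewrite -[LHS]/(X _ * (X _ * (f s : L))) mulrCA.
- exact: gen_px.
- exact: gen_xp.
- exact: gen_px_far.
- exact: gen_pp_far.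
- exact: gen_pp.
exact: gen_ppp.
Qed.
End Generic.

(** * Linear independence of the coset words *)

Lemma inv_eq0 b : inv b = 0%N -> b = bits0 (size b) (count id b).
Proof.
rewrite /bits0; elim: b => [|[] b IH] //=.
  by rewrite add0n => /IH {1}->; rewrite add1n subSS.
move=> /eqP; rewrite addn_eq0 => /andP[/eqP c0 /eqP /IH].
by rewrite c0 subn0 add0n subn0 /= => {1}->.
Qed.

Lemma inv_descent b : (0 < inv b)%N -> exists r, ~~ nth false b r /\ nth false b r.+1.
Proof.
elim: b => [|c b IH] //=; case: c => /=.
  by rewrite add0n => /IH[r]; exists r.+1.
case E: (inv b) IH => [|m] IH; last by have [r hr] := IH isT; exists r.+1.
rewrite addn0 (inv_eq0 E); set c := count id b; case: c => [|c].
  by rewrite /bits0 /= count_nseq.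
by exists 0%N.
Qed.

Lemma inv_swp_descent r b : ~~ nth false b r -> nth false b r.+1 ->
  (r.+1 < size b)%N -> (inv (swp r b)).+1 = inv b.
Proof.
move=> b0 b1 rs; rewrite -[in RHS](swpK r b) [RHS]inv_swp ?size_swp //.
  by rewrite nth_swp_l.
by rewrite nth_swp_r.
Qed.

Section Words.
Variables (K : fieldType) (I : choiceType) (Q : I -> I -> {poly {poly K}}).
Variables (L : fieldType) (phi : {rmorphism K -> L}) (X : nat -> L) (n : nat).
Hypothesis Xinj : forall c c', (c < n)%N -> (c' < n)%N -> X c = X c' -> c = c'.
Variables (iota_ : nat -> I) (k : nat).
Hypothesis kn : (k <= n)%N.
Local Notation V := (seq nat -> ext_space phi).
Local Notation gp := (gen_p Q X iota_).
Local Notation arr := (arrangement n).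

Definition block_type (s : seq nat) : bitseq := [seq (c < k)%N | c <- s].

Definition block_sorted (f : V) : Prop :=
  forall s, f s != 0 -> arr s /\ block_type s = bits0 n k.

Lemma block_type_swp r s : block_type (swp r s) = swp r (block_type s).
Proof. exact: map_swp. Qed.

Lemma gen_p_neq0 r (f : V) s : gp r f s != 0 -> f (swp r s) != 0 \/ f s != 0.
Proof.
move=> h; have [f0|] := eqVneq (f s) 0; last by right.
by left; apply: contraNneq h => f1; rewrite /gen_p f0 f1 !mulr0 addr0.
Qed.

Lemma swp_coef_neq0 c c' : (c < n)%N -> (c' < c)%N -> swp_coef Q phi X iota_ c c' != 0.
Proof.
move=> cn h; rewrite /swp_coef h; case: ifP => _; last exact: oner_neq0.
rewrite invr_eq0 subr_eq0; apply/eqP => /(Xinj cn (ltn_trans h cn)) e.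
by rewrite e ltnn in h.
Qed.

(** The word of [b] moves the first block to the positions marked by [b] or,
    where some crossing stays, to positions with fewer inversions. *)
Lemma word_support q b (f : V) s : size b = n -> count id b = k -> inv b = q ->
  block_sorted f -> word_rec gp q b f s != 0 ->
  arr s /\ (block_type s = b \/ (inv (block_type s) < q)%N).
Proof.
elim: q b s => [|q IH] b s sb cb ib hf.
  move/hf=> [hs e]; split; first exact: hs.
  by left; rewrite e (inv_eq0 ib) sb cb.
have [r0 [/descentP h /h [b0 b1]]] : exists r, ~~ nth false b r /\ nth false b r.+1.
  by apply: inv_descent; rewrite ib.
rewrite /=; move: (descent b) b0 b1 => r b0 b1 hw.
have rs : (r.+1 < size b)%N by case: ltnP b1 => // h'; rewrite nth_default.
have ib' : inv (swp r b) = q.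
  by apply: succn_inj; rewrite -ib inv_swp_descent.
have sb' : size (swp r b) = n by rewrite size_swp.
have cb' : count id (swp r b) = k by rewrite count_swp.
have [h1|h1] := gen_p_neq0 hw; have [hs H] := IH _ _ sb' cb' ib' hf h1; last first.
  split; first exact: hs.
  by right; case: H => [->|/ltnW]; rewrite ?ib'.
rewrite arrangement_swp block_type_swp in hs H.
split; first exact: hs.
case: H => [e|lt]; first by left; rewrite -(swpK r b) -e swpK.
right; rewrite -(swpK r (block_type s)); apply: leq_ltn_trans (inv_swp_le _ _) _.
by rewrite ltnS.
Qed.

(** The leading part of a word is an exchange of functions with invertible
    coefficients: along a word every pair of colours is exchanged in the
    direction that does not carry the factor [Q]. *)
Lemma word_inj q b (f : V) : size b = n -> count id b = k -> inv b = q ->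
  block_sorted f ->
  (forall s, arr s -> block_type s = b -> word_rec gp q b f s = 0) -> f = 0.
Proof.
elim: q b => [|q IH] b sb cb ib hf H.
  apply/funext => s; apply/eqP; apply: contraT => fs.
  have [hs es] := hf s fs.
  have e : block_type s = b by rewrite es (inv_eq0 ib) sb cb.
  by have /= f0 := H s hs e; rewrite f0 eqxx in fs.
have [r0 [/descentP h /h [b0 b1]]] : exists r, ~~ nth false b r /\ nth false b r.+1.
  by apply: inv_descent; rewrite ib.
move: H => /=; move: (descent b) b0 b1 => r b0 b1 H.
have rs : (r.+1 < size b)%N by case: ltnP b1 => // h'; rewrite nth_default.
have ib' : inv (swp r b) = q.
  by apply: succn_inj; rewrite -ib inv_swp_descent.
apply: (IH (swp r b)); rewrite ?size_swp ?count_swp // => s hs es.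
have es' : block_type (swp r s) = b by rewrite block_type_swp es swpK.
have := H (swp r s); rewrite arrangement_swp => /(_ hs es').
have ss := arr_size hs; rewrite sb -ss in rs.
rewrite /gen_p swpK [word_rec _ _ _ _ (swp r s)](_ : _ = 0); last first.
  apply/eqP; apply: contraT => /(word_support _ _ ib' hf)[]; rewrite ?size_swp ?count_swp //.
  move=> _ []; rewrite es'; last by rewrite ib; lia.
  by move=> e; move: ib'; rewrite -e ib; lia.
rewrite mulr0 addr0 => /eqP; rewrite mulf_eq0 => /orP[|/eqP//].
rewrite nth_swp_l ?nth_swp_r // => /eqP e0.
have : swp_coef Q phi X iota_ (nth 0%N s r.+1) (nth 0%N s r) != 0.
  apply: swp_coef_neq0; first by apply: arr_lt; rewrite // -ss.
  move: b0 b1; rewrite -es' /block_type !(nth_map 0%N) ?size_swp // ?(ltnW rs) //.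
  by rewrite nth_swp_l ?nth_swp_r //; lia.
by rewrite e0 eqxx.
Qed.

(** Triangularity with respect to the number of inversions. *)
Lemma word_free (F : bitseq -> V) : (forall b, b \in bits n k -> block_sorted (F b)) ->
  \sum_(b <- bits n k) word gp b (F b) = 0 -> forall b, b \in bits n k -> F b = 0.
Proof.
move=> hF S0; have [m mP] : exists m, forall b, b \in bits n k -> (inv b <= m)%N.
  by exists (\max_(b <- bits n k) inv b) => b bB; apply: (@leq_bigmax_seq _ _ _ inv).
have glin b : linop (word gp b : V -> V) by apply: word_lin => r; apply: gen_p_lin.
suff H N b : b \in bits n k -> (m - inv b < N)%N -> F b = 0.
  by move=> b /H; apply; apply: ltnSn.
elim: N b => // N IH b bB hN.
have bP b' : b' \in bits n k -> size b' = n /\ count id b' = k.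
  by rewrite mem_bits => /andP[/eqP ? /eqP ?].
have [sb cb] := bP b bB.
apply: (word_inj sb cb erefl (hF b bB)) => s hs es.
have : (\sum_(b <- bits n k) word gp b (F b)) s = 0 by rewrite S0.
rewrite fct_sumE (bigD1_seq b) ?bits_uniq //= big1_seq ?addr0 // => b' /andP[nb b'B].
have [sb' cb'] := bP b' b'B; have [lt|le] := ltnP (inv b) (inv b').
  rewrite (IH b') ?(linop0 (glin b')) //.
  by have := mP b' b'B; lia.
apply/eqP; apply: contraT => /(word_support sb' cb' erefl (hF b' b'B))[_ []]; rewrite es.
  by move=> e; rewrite e eqxx in nb.
by rewrite ltnNge le.
Qed.
Lemma block_sorted_sub : subsp block_sorted.
Proof.
split=> [s|c f g hf hg s]; first by rewrite eqxx.
have [f0|/hf//] := eqVneq (f s) 0; have [g0|/hg//] := eqVneq (g s) 0.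
by rewrite -[(c *: f + g) s]/(phi c * (f s : L) + (g s : L)) f0 g0 mulr0 addr0 eqxx.
Qed.

Lemma block_sorted_stable (D : pred nat) :
  stable n [pred r | D r & r.+1 != k] (@gen_x K L phi X) gp (fun (_ : seq I) f => block_sorted f).
Proof.
split=> [_|r _ f _ rn hf s|r _ f _ rn /= /andP[_ rk] hf s]; first exact: block_sorted_sub.
  by rewrite /gen_x => h; apply: hf; apply: contraNneq h => ->; rewrite mulr0.
case/gen_p_neq0 => /hf //; rewrite arrangement_swp block_type_swp => -[hs e].
split=> //; rewrite -(swpK r (block_type s)) e.
by apply: (@swp_id _ false); rewrite ?size_bits0 // !nth_bits0; lia.
Qed.

Lemma block_type_iota : block_type (iota 0 n) = bits0 n k.
Proof.
apply: (@eq_from_nth _ false); rewrite size_map size_iota ?size_bits0 // => r rn.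
by rewrite (nth_map 0%N) ?size_iota // nth_iota // nth_bits0.
Qed.
End Words.

(** * Generated submodules and products *)

Section Closure.
Variables (K : fieldType) (I : choiceType) (V : lmodType K) (n : nat) (D : pred nat).
Variables (x p : nat -> V -> V) (B : seq I -> V -> Prop).

Inductive closure : seq I -> V -> Prop :=
| cl_base mu v : B mu v -> closure mu v
| cl_0 mu : closure mu 0
| cl_lin mu c u v : closure mu u -> closure mu v -> closure mu (c *: u + v)
| cl_x r mu v : size mu = n -> (r < n)%N -> closure mu v -> closure mu (x r v)
| cl_p r mu v : size mu = n -> (r.+1 < n)%N -> D r -> closure mu v ->
    closure (swp r mu) (p r v).

Lemma closure_stable : stable n D x p closure.
Proof.
split=> [mu|r mu v|r mu v]; [|exact: cl_x|exact: cl_p].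
by split=> [|c u v]; [apply: cl_0|apply: cl_lin].
Qed.

Lemma closure_min S : stable n D x p S -> (forall mu v, B mu v -> S mu v) ->
  forall mu v, closure mu v -> S mu v.
Proof.
move=> HS BS mu v; elim=> {mu v} [mu v|mu|mu c u v _ hu _ hv|r mu v sm rn _|r mu v sm rn Dr _].
- exact: BS.
- by case: (st_sub HS mu).
- exact: (st_sub HS mu).2.
- exact: (st_x HS).
exact: (st_p HS).
Qed.
Lemma closure_size mu v : (forall mu v, B mu v -> size mu = n) ->
  closure mu v -> size mu != n -> v = 0.
Proof.
move=> BS; elim=> {mu v} [mu v /BS ->|//|mu c u v _ hu _ hv nm|r mu v -> _ _ _|r mu v sm _ _ _ _].
- by rewrite eqxx.
- by rewrite hu // hv // scaler0 addr0.
- by rewrite eqxx.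
by rewrite size_swp sm eqxx.
Qed.
End Closure.

Section Product.
Variables (K : fieldType) (I : choiceType) (Q : I -> I -> {poly {poly K}}) (i0 : I).
Variables (V W : lmodType K).

(** The product of two modules; submodules of it are used as graphs. *)
Definition prodop (f : V -> V) (g : W -> W) (u : V * W) : V * W := (f u.1, g u.2).

Lemma iter_prodop f g m u : iter m (prodop f g) u = (iter m f u.1, iter m g u.2).
Proof. by elim: m => [|m IH] /=; [case: u|rewrite IH]. Qed.

Lemma prodop_lin f g : linop f -> linop g -> linop (prodop f g).
Proof. by move=> hf hg c u v; rewrite /prodop /= hf hg. Qed.

Lemma snd_lin c (u v : V * W) : (c *: u + v).2 = c *: u.2 + v.2.
Proof. by []. Qed.

Lemma fst_sum (J : Type) (s : seq J) (P : pred J) (F : J -> V * W) :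
  (\sum_(j <- s | P j) F j).1 = \sum_(j <- s | P j) (F j).1.
Proof. by apply: (big_morph fst). Qed.
Lemma snd_sum (J : Type) (s : seq J) (P : pred J) (F : J -> V * W) :
  (\sum_(j <- s | P j) F j).2 = \sum_(j <- s | P j) (F j).2.
Proof. by apply: (big_morph snd). Qed.

Lemma prod_eval2 q f g f' g' u :
  op_eval2 q (prodop f g) (prodop f' g') u = (op_eval2 q f f' u.1, op_eval2 q g g' u.2).
Proof.
rewrite [LHS]surjective_pairing /op_eval2 fst_sum snd_sum.
by congr pair; apply: eq_bigr => k _; rewrite ?fst_sum ?snd_sum; apply: eq_bigr => m _;
  rewrite !iter_prodop.
Qed.

Lemma prod_ddiff q f g f' g' f'' g'' u :
  op_ddiff q (prodop f g) (prodop f' g') (prodop f'' g'') u =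
  (op_ddiff q f f' f'' u.1, op_ddiff q g g' g'' u.2).
Proof.
rewrite [LHS]surjective_pairing /op_ddiff fst_sum snd_sum.
congr pair; apply: eq_bigr => k _; rewrite ?fst_sum ?snd_sum; apply: eq_bigr => m _.
  rewrite -[LHS]/(_ *: (\sum_(b < k) _).1) fst_sum; congr (_ *: _).
  by apply: eq_bigr => b _; rewrite !iter_prodop.
rewrite -[LHS]/(_ *: (\sum_(b < k) _).2) snd_sum; congr (_ *: _).
by apply: eq_bigr => b _; rewrite !iter_prodop.
Qed.

Lemma pair_addMn (a c : V) (b d : W) k : (a + c *+ k, b + d *+ k) = (a, b) + (c, d) *+ k.
Proof.
rewrite [RHS]surjective_pairing; congr pair.
  by rewrite -[RHS]/(a + ((c, d) *+ k).1) (raddfMn fst).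
by rewrite -[RHS]/(b + ((c, d) *+ k).2) (raddfMn snd).
Qed.

Variables (n : nat) (D : pred nat).
Variables (x p : nat -> V -> V) (M : seq I -> V -> Prop) (y q : nat -> W -> W) (N : seq I -> W -> Prop).
Hypotheses (MP : qhmod Q i0 n D x p M) (NP : qhmod Q i0 n D y q N).

Definition prodfam mu (u : V * W) := M mu u.1 /\ N mu u.2.

Lemma prod_qhmod : qhmod Q i0 n D (fun r => prodop (x r) (y r)) (fun r => prodop (p r) (q r)) prodfam.
Proof.
split.
- split=> [mu|r mu u sm rn [h1 h2]|r mu u sm rn Dr [h1 h2]].
  + split=> [|c u v [h1 h2] [h3 h4]].
      by split; [case: (st_sub (qh_st MP) mu)|case: (st_sub (qh_st NP) mu)].
    by split; [apply: (st_sub (qh_st MP) mu).2|apply: (st_sub (qh_st NP) mu).2].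
  + by split; [apply: (st_x (qh_st MP))|apply: (st_x (qh_st NP))].
  by split; [apply: (st_p (qh_st MP))|apply: (st_p (qh_st NP))].
- by move=> r; apply: prodop_lin; [apply: (qh_xlin MP)|apply: (qh_xlin NP)].
- by move=> r; apply: prodop_lin; [apply: (qh_plin MP)|apply: (qh_plin NP)].
- move=> r s mu u sm rn sn [h1 h2]; rewrite /prodop /=.
  by rewrite (qh_xxC MP sm rn sn h1) (qh_xxC NP sm rn sn h2).
- move=> r mu u sm rn Dr [h1 h2]; rewrite /prodop /=.
  by rewrite (qh_px MP sm rn Dr h1) (qh_px NP sm rn Dr h2) pair_addMn -surjective_pairing.
- move=> r mu u sm rn Dr [h1 h2]; rewrite /prodop /=.
  by rewrite (qh_xp MP sm rn Dr h1) (qh_xp NP sm rn Dr h2) pair_addMn -surjective_pairing.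
- move=> r s mu u sm rn Dr sn n1 n2 [h1 h2]; rewrite /prodop /=.
  by rewrite (qh_px_far MP sm rn Dr sn n1 n2 h1) (qh_px_far NP sm rn Dr sn n1 n2 h2).
- move=> r s mu u sm rs sn Dr Ds [h1 h2]; rewrite /prodop /=.
  by rewrite (qh_pp_far MP sm rs sn Dr Ds h1) (qh_pp_far NP sm rs sn Dr Ds h2).
- move=> r mu u sm rn Dr [h1 h2]; rewrite prod_eval2 /prodop /=.
  by rewrite (qh_pp MP sm rn Dr h1) (qh_pp NP sm rn Dr h2).
move=> r mu u sm rn Dr Dr1 [h1 h2]; rewrite prod_ddiff /prodop /=.
have /= := pair_addMn 0 (op_ddiff (Q (nth i0 mu r) (nth i0 mu r.+1)) (x r) (x r.+1) (x r.+2) u.1)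
  0 (op_ddiff (Q (nth i0 mu r) (nth i0 mu r.+1)) (y r) (y r.+1) (y r.+2) u.2)
  (nth i0 mu r == nth i0 mu r.+2).
by rewrite !add0r => <-; rewrite -(qh_ppp MP sm rn Dr Dr1 h1) -(qh_ppp NP sm rn Dr Dr1 h2).
Qed.

Lemma word_rec_prod m b u :
  word_rec (fun r => prodop (p r) (q r)) m b u = (word_rec p m b u.1, word_rec q m b u.2).
Proof. by elim: m b => [|m IH] b /=; [case: u|rewrite IH]. Qed.
End Product.

(** * Faithfulness of the generic representation *)

Section AddStrand.
Variables (K : fieldType) (I : choiceType) (Q : I -> I -> {poly {poly K}}) (i0 : I).
Variables (L : fieldType) (phi : {rmorphism K -> L}) (X : nat -> L) (n : nat).
Variables (io io' : nat -> I).
Hypothesis ioE : forall c, (c < n)%N -> io' c = io c.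

(** The dot of a new strand acts by a new indeterminate, so the scalars are
    enlarged to rational functions. *)
Definition Lnext : fieldType := {fraction {poly L}}.
Definition cnext (a : L) : Lnext := tofrac a%:P.
Lemma cnext_additive : zmod_morphism cnext.
Proof. by move=> a b; rewrite /cnext !raddfB. Qed.
Lemma cnext_multiplicative : monoid_morphism cnext.
Proof. by split=> [|a b]; rewrite /cnext ?rmorph1 ?rmorphM. Qed.
HB.instance Definition _ := GRing.isZmodMorphism.Build _ _ cnext cnext_additive.
HB.instance Definition _ := GRing.isMonoidMorphism.Build _ _ cnext cnext_multiplicative.
Definition phinext (a : K) : Lnext := cnext (phi a).
Lemma phinext_additive : zmod_morphism phinext.
Proof. by move=> a b; rewrite /phinext !raddfB. Qed.
Lemma phinext_multiplicative : monoid_morphism phinext.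
Proof. by split=> [|a b]; rewrite /phinext ?rmorph1 ?rmorphM. Qed.
HB.instance Definition _ := GRing.isZmodMorphism.Build _ _ phinext phinext_additive.
HB.instance Definition _ := GRing.isMonoidMorphism.Build _ _ phinext phinext_multiplicative.
Definition Xnext (c : nat) : Lnext := if (c < n)%N then cnext (X c) else tofrac 'X.

Lemma cnext_eq0 a : (cnext a == 0) = (a == 0).
Proof. by rewrite /cnext tofrac_eq0 polyC_eq0. Qed.

Lemma Xnext_inj : (forall c c', (c < n)%N -> (c' < n)%N -> X c = X c' -> c = c') ->
  forall c c', (c < n.+1)%N -> (c' < n.+1)%N -> Xnext c = Xnext c' -> c = c'.
Proof.
have XC (a : L) : tofrac a%:P <> tofrac 'X :> Lnext.
  move/eqP; rewrite tofrac_eq => /eqP/(congr1 (fun q : {poly L} => size q)).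
  by rewrite size_polyX size_polyC; case: (a != 0).
move=> H c c'; rewrite !ltnS /Xnext => cn c'n.
case: (ltnP c n) => hc; case: (ltnP c' n) => hc'.
- by move/fmorph_inj; apply: H.
- by move/XC.
- by move/esym/XC.
by move=> _; lia.
Qed.

Local Notation W := (seq nat -> ext_space phi).
Local Notation W' := (seq nat -> ext_space phinext).

(** The new strand is put at the right end of every arrangement. *)
Definition add_strand (f : W) : W' :=
  fun s => if drop n s == [:: n] then cnext (f (take n s)) else 0.

Lemma add_strand_lin c f g : add_strand (c *: f + g) = c *: add_strand f + add_strand g.
Proof.
apply/funext => s; rewrite /add_strand.
rewrite -[RHS]/(phinext c * (if drop n s == [:: n] then cnext (f (take n s)) else 0)
  + (if drop n s == [:: n] then cnext (g (take n s)) else 0)).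
case: ifP => _; last by rewrite mulr0 addr0.
rewrite -[(c *: f + g) _]/(phi c * (f (take n s) : L) + (g (take n s) : L)).
by rewrite rmorphD rmorphM.
Qed.

Lemma ev2_next q u v : ev2 phinext q (cnext u) (cnext v) = cnext (ev2 phi q u v).
Proof.
rewrite /ev2 raddf_sum; apply: eq_bigr => k _; rewrite raddf_sum; apply: eq_bigr => m _.
by rewrite /= !rmorphM !rmorphXn.
Qed.

Lemma swp_coef_next c c' : (c < n)%N -> (c' < n)%N ->
  swp_coef Q phinext Xnext io' c c' = cnext (swp_coef Q phi X io c c').
Proof.
move=> hc hc'; rewrite /swp_coef !ioE // /Xnext hc hc'.
case: ifP => _; first by rewrite fmorphV rmorphB.
by case: ifP => _; [rewrite rmorph1|rewrite ev2_next].
Qed.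

Lemma stay_coef_next c c' : (c < n)%N -> (c' < n)%N ->
  stay_coef Xnext io' c c' = cnext (stay_coef X io c c').
Proof.
move=> hc hc'; rewrite /stay_coef !ioE // /Xnext hc hc'.
case: ifP => _; first by rewrite rmorphN fmorphV rmorphB.
by rewrite rmorph0.
Qed.

Lemma size_drop1 (s : seq nat) : drop n s = [:: n] -> size s = n.+1.
Proof. by move/(congr1 size); rewrite size_drop /=; lia. Qed.

Lemma add_strand_x r mu (f : W) : gen_space n io mu f -> (r < n)%N ->
  gen_x Xnext r (add_strand f) = add_strand (gen_x X r f).
Proof.
move=> hf rn; apply/funext => s; rewrite /gen_x /add_strand.
case: ifP => [/eqP hs|_]; last by rewrite mulr0.
rewrite rmorphM nth_take //; have [->|/hf[ha _]] := eqVneq (f (take n s)) 0.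
  by rewrite rmorph0 !mulr0.
by have := arr_lt ha rn; rewrite nth_take // => hc; rewrite /Xnext hc.
Qed.

Lemma add_strand_p r mu (f : W) : gen_space n io mu f -> (r.+1 < n)%N ->
  gen_p Q Xnext io' r (add_strand f) = add_strand (gen_p Q X io r f).
Proof.
move=> hf rn; apply/funext => s; rewrite /gen_p /add_strand drop_swp //.
case: ifP => [/eqP hs|_]; last by rewrite !mulr0 addr0.
rewrite take_swp_in // rmorphD !rmorphM !nth_take ?(ltnW rn) //.
have [ha|na] := boolP (arrangement n (take n s)).
  have := arr_lt ha rn; have := arr_lt ha (ltnW rn).
  rewrite !nth_take ?(ltnW rn) // => h1 h2.
  by rewrite swp_coef_next // stay_coef_next.
rewrite (off_arr hf na) (off_arr hf (s := swp r (take n s))) ?arrangement_swp //.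
by rewrite rmorph0 !mulr0.
Qed.

Lemma add_strand_space mu (f : W) : gen_space n io mu f ->
  gen_space n.+1 io' (mu ++ [:: io' n]) (add_strand f).
Proof.
move=> hf s; rewrite /add_strand; case: ifP => [/eqP hs|_]; last by rewrite eqxx.
rewrite cnext_eq0 => /hf[ha <-].
have es : s = take n s ++ [:: n] by rewrite -hs cat_take_drop.
split; first by rewrite es /arrangement -addn1 iotaD perm_cat2r.
rewrite {1}es map_cat /=; congr cat; apply/eq_in_map => c.
by rewrite (perm_mem ha) mem_iota => /andP[_ /ioE].
Qed.

(** The new strand sits at the last position in the image of [add_strand], and
    its dot is multiplication by a transcendental scalar. *)
Lemma add_strand_free A (h : nat -> W) : (forall a, exists mu, gen_space n io mu (h a)) ->
  \sum_(a < A) iter a (gen_x Xnext n) (add_strand (h a)) = 0 ->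
  forall a, (a < A)%N -> h a = 0.
Proof.
move=> hh S0 a aA; apply/funext => s; apply/eqP; apply: contraT => hs.
have [mu /(_ s hs)[ha _]] := hh a; have ss := arr_size ha.
have : (\sum_(a < A) iter a (gen_x Xnext n) (add_strand (h a))) (s ++ [:: n]) = 0 by rewrite S0.
rewrite fct_sumE (eq_bigr (fun a : 'I_A => tofrac ((h a s)%:P * 'X^a) : Lnext)); last first.
  move=> b _; rewrite iter_gen_x nth_cat ss ltnn subnn /= /Xnext ltnn.
  rewrite /add_strand drop_cat take_cat ss ltnn subnn /= cats0 eqxx.
  by rewrite rmorphM rmorphXn mulrC.
rewrite -raddf_sum => /eqP; rewrite tofrac_eq0 => /eqP/(congr1 (fun q : {poly L} => q`_a)).
rewrite coef0 coef_sum (bigD1 (Ordinal aA)) //= big1 ?addr0 => [|b nb].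
  by rewrite coefCM coefXn eqxx mulr1 => e; rewrite e eqxx in hs.
rewrite coefCM coefXn; case: eqP => [e|_]; last by rewrite mulr0.
by rewrite -val_eqE /= e eqxx in nb.
Qed.
End AddStrand.

Section Faithful.
Variables (K : fieldType) (I : choiceType) (Q : I -> I -> {poly {poly K}}) (i0 : I).
Hypothesis Qii : forall i, Q i i = 0.
Hypothesis Qsym : forall i j, Q i j = swapXY (Q j i).

Definition base_vector (L : fieldType) (phi : {rmorphism K -> L}) (n : nat) :
  seq nat -> ext_space phi := fun s => if s == iota 0 n then (1 : L) else 0.

Arguments base_vector {L} phi n _.

Definition single (V : Type) (mu0 : seq I) (v0 : V) (mu : seq I) (v : V) := mu = mu0 /\ v = v0.

(** The submodule generated by the pair of [w] and the base vector; it is the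
    graph of a map exactly when it contains no vector [(t, 0)] with [t] nonzero. *)
Definition graph (L : fieldType) (phi : {rmorphism K -> L}) (X : nat -> L) n D
    (V : lmodType K) (x p : nat -> V -> V) (nu : seq I) (w : V) :=
  closure n D (fun r => prodop (x r) (@gen_x K L phi X r))
    (fun r => prodop (p r) (@gen_p K I Q L phi X (nth i0 nu) r))
    (single nu (w, base_vector phi n)).

Arguments graph {L} phi X n D {V} x p nu w _ _.

(** Every relation satisfied by the base vector holds in all modules: the base
    vector can be sent to any other vector with the same labels. *)
Definition faithful (L : fieldType) (phi : {rmorphism K -> L}) (X : nat -> L) n :=
  forall D (V : lmodType K) (x p : nat -> V -> V) M nu w, size nu = n ->
  qhmod Q i0 n D x p M -> M nu w ->
  forall mu t, graph phi X n D x p nu w mu (t, 0) -> t = 0.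

Lemma base_vector_space (L : fieldType) (phi : {rmorphism K -> L}) n nu : size nu = n ->
  gen_space n (nth i0 nu) nu (base_vector phi n).
Proof.
move=> sn s; rewrite /base_vector; case: ifP => [/eqP -> _|_]; last by rewrite eqxx.
by split; [apply: perm_refl|rewrite -sn map_nth_iota0 ?take_size].
Qed.

Lemma graph_qhmod (L : fieldType) (phi : {rmorphism K -> L}) (X : nat -> L) n D
    (V : lmodType K) (x p : nat -> V -> V) M nu w :
  (forall c c', (c < n)%N -> (c' < n)%N -> X c = X c' -> c = c') ->
  size nu = n -> qhmod Q i0 n D x p M -> M nu w ->
  qhmod Q i0 n D (fun r => prodop (x r) (@gen_x K L phi X r))
    (fun r => prodop (p r) (@gen_p K I Q L phi X (nth i0 nu) r))
    (prodfam M (gen_space n (nth i0 nu))) /\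
  subfam n (graph phi X n D x p nu w) (prodfam M (gen_space n (nth i0 nu))).
Proof.
move=> Xinj sn MP Mw; have GP := gen_qhmod i0 Qii Qsym phi Xinj (nth i0 nu).
have GD := sub_qhmod GP (@stable_sub _ _ _ _ _ _ predT D _ (fun _ _ => isT) (qh_st GP)) (fun _ _ _ h => h) (fun _ _ _ => isT).
have PP := prod_qhmod MP GD; split=> // mu u _.
apply: (closure_min (qh_st PP)) => _ _ [-> ->]; split=> //.
exact: base_vector_space.
Qed.

Lemma base_vector_sorted (L : fieldType) (phi : {rmorphism K -> L}) n k :
  (k <= n)%N -> block_sorted n k (base_vector phi n).
Proof.
move=> kn s; rewrite /base_vector; case: ifP => [/eqP -> _|_]; last by rewrite eqxx.
by split; [apply: perm_refl|apply: block_type_iota].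
Qed.

(** Crossings that avoid [k] do not mix the colours below [k] with the others. *)
Lemma graph_sorted (L : fieldType) (phi : {rmorphism K -> L}) (X : nat -> L) n k (D : pred nat)
    (V : lmodType K) (x p : nat -> V -> V) nu w mu u : (k <= n)%N ->
  graph phi X n [pred r | D r & r.+1 != k] x p nu w mu u -> block_sorted n k u.2.
Proof.
move=> kn; apply: (closure_min (S := fun _ u => block_sorted n k u.2)); last first.
  by move=> _ _ [_ ->]; apply: base_vector_sorted.
have BS := block_sorted_stable Q phi X (nth i0 nu) kn D.
split=> [nu'|r nu' v sn' rn hv|r nu' v sn' rn Dr hv].
- have [z lin] := st_sub BS nu'; split=> [|c v v' hv hv']; first exact: z.
  by rewrite snd_lin; apply: lin.
- exact: (st_x BS sn' rn hv).
exact: (st_p BS sn' rn Dr hv).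
Qed.

Let id_K : {rmorphism K -> K} := idfun.

Lemma faithful0 : faithful id_K (fun=> 0) 0.
Proof.
move=> D V x p M nu w _ MP Mw mu t hg.
suff [c] : exists c : K, (t, 0 : seq nat -> ext_space id_K) = (c *: w, c *: base_vector _ 0).
  case=> -> /esym/(congr1 (fun f : seq nat -> ext_space id_K => f [::] : K)).
  by rewrite -[LHS]/(c * 1) mulr1 => ->; rewrite scale0r.
elim: hg => {mu t} [_ _ [_ ->]|_|_ a u v _ [c ->] _ [d ->]|r mu v _ //|r mu v _ //].
- by exists 1; rewrite !scale1r.
- by exists 0; rewrite !scale0r.
by exists (a * c + d); rewrite !scalerDl -!scalerA.
Qed.

Section Step.
Variables (L : fieldType) (phi : {rmorphism K -> L}) (X : nat -> L) (n : nat).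
Hypothesis Xinj : forall c c', (c < n)%N -> (c' < n)%N -> X c = X c' -> c = c'.
Hypothesis HF : faithful phi X n.
Variables (D : pred nat) (V : lmodType K) (x p : nat -> V -> V) (M : seq I -> V -> Prop).
Variables (nu : seq I) (i : I) (w : V).
Hypotheses (snu : size nu = n) (MP : qhmod Q i0 n.+1 D x p M) (Mw : M (rcons nu i) w).
Local Notation X' := (Xnext X n).
Local Notation phi' := (phinext phi).
Local Notation io := (nth i0 nu).
Local Notation io' := (nth i0 (rcons nu i)).
Local Notation W := (seq nat -> ext_space phi).
Local Notation W' := (seq nat -> ext_space phi').
Local Notation px := (fun r => prodop (x r) (@gen_x K (Lnext L) phi' X' r)).
Local Notation pp := (fun r => prodop (p r) (@gen_p K I Q (Lnext L) phi' X' io' r)).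
Local Notation D' := [pred r | D r & r.+1 != n].
Local Notation small := (graph phi X n D x p nu w).

Definition embed (u : V * W) : V * W' := (u.1, add_strand n u.2).

(** Polynomials in the dot of the last strand, with coefficients generated by
    the operators on the other strands. They exhaust what the generating pair
    produces without crossings of the last strand. *)
Definition last_polys (mu : seq I) (u : V * W') : Prop :=
  if drop n mu == [:: i] then
    exists A (h : nat -> V * W), (forall a, small (take n mu) (h a)) /\
      u = \sum_(a < A) iter a (px n) (embed (h a))
  else u = 0.

Lemma rcons_io c : (c < n)%N -> io' c = io c.
Proof. by move=> h; rewrite nth_rcons snu h. Qed.

Lemma Mw' : M (nu ++ [:: i]) w. Proof. by rewrite cats1. Qed.

Lemma small_module : qhmod Q i0 n D x p (fun mu => M (mu ++ [:: i])).
Proof. by apply: (restrict_left (leqnSn n) _ _ MP) => //=; rewrite subSnn. Qed.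

Lemma small_space mu u : size mu = n -> small mu u ->
  M (mu ++ [:: i]) u.1 /\ gen_space n io mu u.2.
Proof.
move=> sm hu; have [_ H] := graph_qhmod phi Xinj snu small_module Mw'.
exact: H.
Qed.

Lemma big_space : qhmod Q i0 n.+1 D px pp (prodfam M (gen_space n.+1 io')).
Proof.
have Xi := Xnext_inj Xinj; have sn : size (rcons nu i) = n.+1 by rewrite size_rcons snu.
by case: (graph_qhmod phi' Xi sn MP Mw).
Qed.

Lemma io'n : io' n = i. Proof. by rewrite nth_rcons snu ltnn eqxx. Qed.

Lemma embed_space mu u : size mu = n -> small mu u ->
  prodfam M (gen_space n.+1 io') (mu ++ [:: i]) (embed u).
Proof.
move=> sm /(small_space sm)[h1 h2]; split=> //.
by have := add_strand_space rcons_io h2; rewrite io'n.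
Qed.

Lemma embed_x r mu u : size mu = n -> (r < n)%N -> small mu u ->
  px r (embed u) = embed (prodop (x r) (gen_x X r) u).
Proof.
move=> sm rn /(small_space sm)[_ h2]; rewrite /prodop /embed /=.
by rewrite (add_strand_x X h2 rn).
Qed.

Lemma embed_p r mu u : size mu = n -> (r.+1 < n)%N -> small mu u ->
  pp r (embed u) = embed (prodop (p r) (gen_p Q X io r) u).
Proof.
move=> sm rn /(small_space sm)[_ h2]; rewrite /prodop /embed /=.
by rewrite (add_strand_p Q X rcons_io h2 rn).
Qed.

Lemma embed_lin c u v : embed (c *: u + v) = c *: embed u + embed v.
Proof. by rewrite /embed /= add_strand_lin. Qed.

Lemma last_polys_stable : stable n.+1 D' px pp last_polys.
Proof.
have BP := big_space; have embed0 : embed 0 = 0.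
  by have := embed_lin (-1) 0 0; rewrite !scaleN1r !addNr.
have SS : stable n D (fun r => prodop (x r) (gen_x X r)) (fun r => prodop (p r) (gen_p Q X io r)) small.
  exact: closure_stable.
have itl m : linop (iter m (px n)) by apply/linop_iter/(qh_xlin BP n).
have bigP mu h : size mu = n.+1 -> drop n mu = [:: i] -> small (take n mu) h ->
    prodfam M (gen_space n.+1 io') mu (embed h).
  move=> sm dm hs; rewrite -(cat_take_drop n mu) dm; apply: embed_space => //.
  by rewrite size_takel // sm.
split=> [mu|r mu u sm rn|r mu u sm rn /andP[/= Dr rk]]; rewrite /last_polys.
- case: (drop n mu == [:: i]); last by split=> // c u v -> ->; rewrite scaler0 addr0.
  split.
    exists 0%N, (fun=> 0); split; last by rewrite big_ord0.
    by move=> _; case: (st_sub SS (take n mu)).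
  move=> c u v [A [h [hs ->]]] [B [g [gs ->]]].
  pose cut C (h : nat -> V * W) a := if (a < C)%N then h a else 0.
  exists (A + B)%N, (fun a => c *: cut A h a + cut B g a); split=> [a|].
    apply: (st_sub SS _).2; rewrite /cut; case: ifP => _ //;
      by case: (st_sub SS (take n mu)).
  have ext C (f : nat -> V * W) N : (C <= N)%N ->
      \sum_(a < C) iter a (px n) (embed (f a)) = \sum_(a < N) iter a (px n) (embed (cut C f a)).
    move=> CN; rewrite (big_ord_widen N (fun a => iter a (px n) (embed (f a)))) // big_mkcond /=.
    apply: eq_bigr => a _; rewrite /cut; case: ifP => // _.
    by rewrite embed0 (linop0 (itl _)).
  rewrite (ext A h (A + B)%N) ?leq_addr // (ext B g (A + B)%N) ?leq_addl //.
  rewrite scaler_sumr -big_split; apply: eq_bigr => a _.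
  by rewrite embed_lin (itl a).
- case: eqP => [dm|_]; last by move=> ->; apply: (linop0 (qh_xlin BP r)).
  case=> A [h [hs ->]]; move: rn; rewrite ltnS leq_eqVlt => /orP[/eqP ->|rn].
    exists A.+1, (fun a => if a is a'.+1 then h a' else 0); split.
      by case=> [|a]; [case: (st_sub SS (take n mu))|].
    rewrite big_ord_recl /= embed0 add0r (linop_sum _ _ _ (qh_xlin BP n)).
    by apply: eq_bigr.
  have st : size (take n mu) = n by rewrite size_takel // sm.
  exists A, (fun a => prodop (x r) (gen_x X r) (h a)); split.
    by move=> a; apply: (st_x SS).
  rewrite (linop_sum _ _ _ (qh_xlin BP r)); apply: eq_bigr => a _.
  rewrite -(embed_x st rn (hs a)).
  apply: (@iter_comm _ _ (prodfam M (gen_space n.+1 io') mu)); last exact: bigP.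
    by move=> v; apply: (st_x (qh_st BP)).
  by move=> v hv; apply: (qh_xxC BP sm _ _ hv); rewrite ?ltnS // ltnW.
have rn' : (r.+1 < n)%N by rewrite ltn_neqAle rk.
rewrite drop_swp // take_swp_in //.
case: eqP => [dm|_]; last by move=> ->; apply: (linop0 (qh_plin BP r)).
case=> A [h [hs ->]]; have st : size (take n mu) = n by rewrite size_takel // sm.
exists A, (fun a => prodop (p r) (gen_p Q X io r) (h a)); split.
  by move=> a; apply: (st_p SS).
rewrite (linop_sum _ _ _ (qh_plin BP r)); apply: eq_bigr => a _.
rewrite -(embed_p st rn' (hs a)).
apply: (@iter_comm _ _ (prodfam M (gen_space n.+1 io') mu)); last exact: bigP.
  by move=> v; apply: (st_x (qh_st BP)).
by move=> v hv; apply: (qh_px_far BP sm _ _ _ _ _ hv) => //; lia.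
Qed.

Lemma add_base : add_strand n (base_vector phi n) = base_vector phi' n.+1.
Proof.
apply/funext => s; rewrite /add_strand /base_vector -addn1 iotaD add0n /=.
have [ss|ns] := eqVneq (size s) n.+1; last first.
  rewrite (introF eqP (fun e : drop n s = [:: n] => negP ns (introT eqP (size_drop1 e)))).
  by case: eqP => // e; move: ns; rewrite e size_cat size_iota addn1 eqxx.
rewrite -[s in RHS](cat_take_drop n s) eqseq_cat ?size_takel ?ss ?size_iota //.
by rewrite andbC; case: eqP => //= _; case: ifP => _; rewrite ?rmorph1 ?rmorph0.
Qed.

Lemma graph_last_polys mu u :
  graph phi' X' n.+1 D' x p (rcons nu i) w mu u -> last_polys mu u.
Proof.
apply: (closure_min last_polys_stable) => _ _ [-> ->]; rewrite /last_polys -cats1.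
rewrite drop_cat take_cat snu ltnn subnn /= cats0 eqxx.
exists 1%N, (fun=> (w, base_vector phi n)); split; first by move=> a; apply: cl_base.
by rewrite big_ord1 /embed /= add_base.
Qed.

(** The coefficients of a polynomial whose second component is zero have zero
    second component themselves, and the faithfulness for the first [n] strands
    applies to each of them. *)
Lemma last_polys_faithful mu t : size mu = n.+1 -> last_polys mu (t, 0) -> t = 0.
Proof.
move=> sm; rewrite /last_polys; case: ifP => [/eqP dm|_ [//]].
case=> A [h [hs e]]; have st : size (take n mu) = n by rewrite size_takel // sm.
have e2 : \sum_(a < A) iter a (gen_x X' n) (add_strand n (h a).2) = 0.
  have := congr1 snd e; rewrite snd_sum => e'; apply: etrans (esym e').
  by apply: eq_bigr => a _; rewrite iter_prodop.
have hh a : exists mu, gen_space n io mu (h a).2.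
  by exists (take n mu); case: (small_space st (hs a)).
have h0 := add_strand_free (h := fun a => (h a).2) hh e2.
have := congr1 fst e; rewrite fst_sum => e'; rewrite [LHS]e'; apply: big1 => a _.
rewrite iter_prodop /=.
have [t0 ht] : exists t0, h a = (t0, 0).
  by exists (h a).1; rewrite -(h0 a) //; case: (h a).
rewrite ht /= (HF snu small_module Mw' (mu := take n mu) (t := t0)); last by rewrite -ht.
exact: (linop0 (linop_iter _ (qh_xlin MP n))).
Qed.

(** The full graph is induced from the part without crossings of the last
    strand; the coset words are independent in the generic representation, so
    that a vanishing second component vanishes word by word. *)
Lemma faithful_step mu t :
  graph phi' X' n.+1 D x p (rcons nu i) w mu (t, 0) -> t = 0.
Proof.
have Xi := Xnext_inj Xinj; have sn : size (rcons nu i) = n.+1 by rewrite size_rcons snu.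
have BP := big_space; pose G' := graph phi' X' n.+1 D' x p (rcons nu i) w.
have MP' : qhmod Q i0 n.+1 D' x p M.
  apply: (sub_qhmod MP (stable_sub (D' := D') _ (qh_st MP))) => //.
    by move=> r /andP[].
  by move=> r _ /andP[].
have [_ G'sub] := graph_qhmod phi' Xi sn MP' Mw.
have G'st : stable n.+1 D' px pp G' by apply: closure_stable.
have Ind := induced_stable BP (leqnSn n) G'sub G'st.
move=> hg; have : induced n.+1 D pp n G' mu (t, 0).
  apply: (closure_min Ind _ hg) => _ _ [-> ->]; apply: induced_base; first exact: sn.
  exact: cl_base.
case/(induced_sum BP (leqnSn n) G'sub G'st) => F hF e.
have [smu|nmu] := eqVneq (size mu) n.+1; last first.
  have B0 nu' (v : V * W') : single (rcons nu i) (w, base_vector phi' n.+1) nu' v -> size nu' = n.+1.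
    by case=> ->.
  by have := closure_size B0 hg nmu => -[].
have F2 b : b \in bits n.+1 n -> (F b).2 = 0.
  have e2 : \sum_(b <- bits n.+1 n) word (gen_p Q X' io') b (F b).2 = 0.
    have := congr1 snd e; rewrite snd_sum => e'; apply: etrans (esym e').
    by apply: eq_bigr => b1 _; rewrite /word word_rec_prod.
  by apply: (word_free Xi (leqnSn n) _ e2) => b' /hF; apply: graph_sorted.
have := congr1 fst e; rewrite fst_sum => e'; rewrite [LHS]e' big1_seq // => b /= bB.
rewrite /word word_rec_prod /=.
have -> : (F b).1 = 0.
  have := hF b bB; rewrite (surjective_pairing (F b)) F2 //.
  move/graph_last_polys; apply: last_polys_faithful.
  move: bB; rewrite mem_bits => /andP[/eqP sb _].
  by rewrite size_cat !size_mask ?size_map ?sb ?smu // count_map (count_predC id) sb.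
exact: (linop0 (word_rec_lin _ _ (qh_plin MP))).
Qed.
End Step.

Lemma faithfulP n : exists (L : fieldType) (phi : {rmorphism K -> L}) (X : nat -> L),
  (forall c c', (c < n)%N -> (c' < n)%N -> X c = X c' -> c = c') /\ faithful phi X n.
Proof.
elim: n => [|n [L [phi [X [Xinj HF]]]]].
  by exists K, id_K, (fun=> 0); split=> //; apply: faithful0.
exists (Lnext L), (phinext phi), (Xnext X n); split; first exact: Xnext_inj.
move=> D V x p M nu; case/lastP: nu => [|nu i] w //; rewrite size_rcons => -[snu] MP Mw mu t.
exact: (faithful_step Xinj HF snu MP Mw).
Qed.
End Faithful.

(** * The cyclotomic relation on induced modules *)

Section Mackey.
Variables (K : fieldType) (I : choiceType) (Q : I -> I -> {poly {poly K}}) (i0 : I).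
Variables (V : lmodType K) (n : nat) (x p : nat -> V -> V) (G : seq I -> V -> Prop).
Hypothesis GP : qhmod Q i0 n predT x p G.
Variables (k : nat) (kn : (k <= n)%N) (E N : seq I -> V -> Prop).
Local Notation D := [pred r | predT r & r.+1 != k].
Hypotheses (EG : subfam n E G) (NE : subfam n N E).
Hypotheses (EP : stable n D x p E) (NP : stable n D x p N).
Variables (a w : I -> nat).
Local Notation lab mu r := (nth i0 mu r).
Hypothesis cyc1 : forall mu v, (0 < k)%N -> size mu = n -> E mu v ->
  N mu (iter (a (lab mu 0)) (x 0%N) v).
Hypothesis cyc2 : forall mu v, (k < n)%N -> size mu = n -> E mu v ->
  N mu (iter (w (lab mu k)) (x k) v).

Local Notation IN := (induced n predT p k N).
Local Notation IE := (induced n predT p k E).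

Let NG : subfam n N G.
Proof. by move=> mu v sm /(NE sm) /(EG sm). Qed.

Lemma IN_stable : stable n predT x p IN.
Proof. exact: (induced_stable GP kn NG NP). Qed.

Definition from j := closure n [pred r | (j <= r)%N] x p E.

Lemma from_stable j : stable n [pred r | (j <= r)%N] x p (from j).
Proof. exact: closure_stable. Qed.

Lemma from_G j : subfam n (from j) G.
Proof.
move=> mu v + hv; apply: (closure_min (S := fun mu v => size mu = n -> G mu v) _ _ hv).
  split=> [nu|r nu u sn rn hu|r nu u sn rn _ hu].
  - split=> [|c u1 u2 h1 h2] sn; first by case: (st_sub (qh_st GP) nu).
    by apply: (st_sub (qh_st GP) nu).2; [apply: h1|apply: h2].
  - by move=> _; apply: (st_x (qh_st GP) sn rn); apply: hu.
  by move=> _; apply: (st_p (qh_st GP) sn rn isT); apply: hu.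
by move=> nu u Eu sn; apply: EG.
Qed.

Lemma first_dots_p r m mu v : size mu = n -> (0 < r)%N -> (r.+1 < n)%N -> G mu v ->
  iter m (x 0%N) (p r v) = p r (iter m (x 0%N) v).
Proof.
move=> sm r0 rn Gv; rewrite (@iter_comm _ _ (G mu)) // => u Gu.
  by apply: (st_x (qh_st GP)) => //; lia.
by apply: (qh_px_far GP sm _ _ _ _ _ Gu) => //; lia.
Qed.

Lemma lab0_swp r mu : size mu = n -> (0 < r)%N -> (r.+1 < n)%N ->
  lab (swp r mu) 0 = lab mu 0.
Proof. by move=> sm r0 rn; rewrite nth_swp_far ?sm //; lia. Qed.

(** The vectors of [from 1] do not involve crossings of the first strand, which
    therefore still is the first strand of the first block. *)
Lemma from_first mu v : (0 < k)%N -> size mu = n -> from 1 mu v ->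
  IN mu (iter (a (lab mu 0)) (x 0%N) v).
Proof.
move=> k0 + hv; have n0 : (0 < n)%N by lia.
have xl m : linop (iter m (x 0%N)) by apply/linop_iter/(qh_xlin GP).
suff H : size mu = n -> G mu v /\ IN mu (iter (a (lab mu 0)) (x 0%N) v).
  by move=> sm; case: (H sm).
apply: (closure_min (S := fun mu v => size mu = n ->
  G mu v /\ IN mu (iter (a (lab mu 0)) (x 0%N) v)) _ _ hv) => [|nu u Eu sn]; last first.
  split; first exact: EG.
  by apply: induced_base => //; apply: cyc1.
have IS := IN_stable; have GS := qh_st GP.
split=> [nu|r nu u sn rn hu|r nu u sn rn /= r0 hu].
- split=> [|c u1 u2 h1 h2] sn.
    by rewrite (linop0 (xl _)); split; [case: (st_sub GS nu)|case: (st_sub IS nu)].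
  have [g1 i1] := h1 sn; have [g2 i2] := h2 sn; rewrite xl.
  by split; [apply: (st_sub GS nu).2|apply: (st_sub IS nu).2].
- move=> _; have [gu iu] := hu sn; split; first exact: (st_x GS).
  by rewrite -(x_iter GP _ sn) //; apply: (st_x IS).
move=> _; have [gu iu] := hu sn; split; first exact: (st_p GS).
by rewrite (first_dots_p _ sn) // lab0_swp //; apply: (st_p IS).
Qed.

Lemma from_le i j : (i <= j)%N -> forall mu v, from j mu v -> from i mu v.
Proof.
move=> ij; apply: closure_min => [|mu v Ev]; last exact: cl_base.
have FS := from_stable i.
split=> [mu|r mu v|r mu v sm rn /= jr]; first exact: (st_sub FS mu).
  exact: (st_x FS).
by apply: (st_p FS) => //=; apply: leq_trans jr.
Qed.

(** The crossing [p j] maps [E] to itself and commutes with the crossings from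
    [j.+2] on; its commutators with dots give vectors already present. *)
Lemma from_p j mu v : (j.+1 < k)%N -> size mu = n -> from j.+2 mu v ->
  from j.+2 (swp j mu) (p j v).
Proof.
move=> jk + hv; have FS := from_stable j.+2; have jn : (j.+1 < n)%N by lia.
have GS := qh_st GP.
suff H : size mu = n -> [/\ G mu v, from j.+2 mu v & from j.+2 (swp j mu) (p j v)].
  by move=> sm; case: (H sm).
apply: (closure_min (S := fun mu v => size mu = n ->
  [/\ G mu v, from j.+2 mu v & from j.+2 (swp j mu) (p j v)]) _ _ hv) => [|nu u Eu sn]; last first.
  split; [exact: EG|exact: cl_base|].
  by apply: cl_base; apply: (st_p EP) => //=; lia.
have pl := qh_plin GP j.
split=> [nu|r nu u sn rn hu|r nu u sn rn /= jr hu].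
- split=> [|c u1 u2 h1 h2] sn.
    by rewrite (linop0 pl); split; [case: (st_sub GS nu)|apply: cl_0|apply: cl_0].
  have [g1 f1 i1] := h1 sn; have [g2 f2 i2] := h2 sn; rewrite pl.
  by split; [apply: (st_sub GS nu).2|apply: cl_lin|apply: cl_lin].
- move=> _; have [gu fu iu] := hu sn.
  split; [exact: (st_x GS)|exact: (st_x FS)|].
  have sub : subsp (from j.+2 (swp j nu)) by apply: (st_sub FS).
  have sw : size (swp j nu) = n by rewrite size_swp.
  have d : from j.+2 (swp j nu) (u *+ (lab nu j == lab nu j.+1)).
    case e: (_ == _); last by rewrite mulr0n; case: sub.
    by rewrite mulr1n (swp_lab (esym e)).
  case: (eqVneq r j.+1) => [->|n1].
    by rewrite (qh_px GP sn _ _ gu) //; apply: subspD => //; apply: (st_x FS) => //; lia.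
  case: (eqVneq r j) => [->|n2].
    have -> : p j (x j u) = x j.+1 (p j u) - u *+ (lab nu j == lab nu j.+1).
      by rewrite (qh_xp GP sn _ _ gu) // addrK.
    by apply: subspB => //; apply: (st_x FS).
  by rewrite (qh_px_far GP sn _ _ _ _ _ gu) //; apply: (st_x FS).
move=> _; have [gu fu iu] := hu sn.
split; [exact: (st_p GS)|exact: (st_p FS)|].
rewrite (qh_pp_far GP sn _ _ _ _ gu) // swp_far //.
by apply: (st_p FS) => //; rewrite size_swp.
Qed.

(** The vectors obtained from [E] by the chain of crossings [p j] after
    [p j.+1] and so on down to [p k.-1], which brings the first strand of the
    second block to position [j]. *)
Inductive lead : nat -> seq I -> V -> Prop :=
| lead0 mu v : size mu = n -> E mu v -> lead k mu v
| leadS j mu v : (j < k)%N -> (j.+1 < n)%N -> lead j.+1 mu v -> lead j (swp j mu) (p j v).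

Lemma lead_size j mu v : lead j mu v -> size mu = n.
Proof. by elim=> // *; rewrite size_swp. Qed.

Lemma lead_from j i mu v : lead j mu v -> (i <= j)%N -> from i mu v.
Proof.
elim=> {j mu v} [mu v _ Ev _|j mu v jk jn hl IH ij]; first exact: cl_base.
by apply: cl_p => //; [apply: (lead_size hl)|apply: IH; lia].
Qed.

Lemma lead_le j mu v : lead j mu v -> (j <= k)%N.
Proof. by elim=> // *; apply: ltnW. Qed.

(** A dot at [j] becomes a dot at [j.+1] when it passes the crossing, up to
    terms where this crossing is missing. *)
Lemma iter_xp j m mu u : size mu = n -> (j.+1 < n)%N -> from j.+1 mu u ->
  from j.+1 (swp j mu) (iter m (x j) (p j u) - p j (iter m (x j.+1) u)).
Proof.
move=> sm jn fu; have FS := from_stable j.+1.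
have sub : subsp (from j.+1 (swp j mu)) by apply: (st_sub FS).
have fi i : from j.+1 mu (iter i (x j.+1) u).
  by apply: iter_in => // w0; apply: (st_x FS).
have [xl pl] := (qh_xlin GP j, qh_plin GP j).
elim: m => [|m IH]; first by rewrite /= subrr; case: sub.
rewrite !iterS; set u' := iter m _ u; have gu' : G mu u' := from_G sm (fi m).
rewrite (qh_px GP sm jn _ gu') // opprD addrA -(linopB _ _ xl); apply: subspB => //.
  by apply: (st_x FS); rewrite ?size_swp //; lia.
case e: (_ == _); last by rewrite mulr0n; case: sub.
by rewrite mulr1n (swp_lab (esym e)) //; apply: fi.
Qed.

(** At [j = k] no crossing has been made and there is no error term; this case
    has to be distinguished because [from k.+1] is not zero. *)
Definition rest j mu v := if (j < k)%N then from j.+1 mu v else v = 0.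

(** The [w] dots on the first strand of the second block travel back along its
    chain of crossings to position [k], where they give a vector of [N]. The
    error terms lack a crossing of the chain, so that position [j] still carries
    a strand of the first block. *)
Lemma lead_cyc j mu v : (k < n)%N -> lead j mu v ->
  exists2 v', IN mu v' & rest j mu (iter (w (lab mu j)) (x j) v - v').
Proof.
move=> ltkn; have IS := IN_stable.
elim=> {j mu v} [mu v sm Ev|j mu v jk jn hl [v' Iv' hr]].
  exists (iter (w (lab mu k)) (x k) v).
    by apply: induced_base => //; apply: cyc2.
  by rewrite /rest ltnn subrr.
have sm := lead_size hl; have fv := lead_from hl (leqnn _).
have FS := from_stable j.+1.
exists (p j v'); first exact: (st_p IS).
rewrite /rest jk nth_swp_l ?sm //; set m := w _.
rewrite -(subrK (p j (iter m (x j.+1) v)) (iter m (x j) (p j v))) -addrA.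
have pl := qh_plin GP j.
apply: subspD; [exact: (st_sub FS)|exact: iter_xp|].
rewrite -(linopB _ _ pl); move: hr; rewrite /rest -/m; case: ifP => [jk1 hr|_ ->].
  by apply: (@from_le _ j.+2); first exact: leqnSn; apply: from_p.
by rewrite (linop0 pl); apply: cl_0.
Qed.

(** The remaining crossings take place to the right of position [j], so that the
    strand brought there by [lead] stays. *)
Inductive tail (j : nat) : seq I -> V -> Prop :=
| tail0 mu v : lead j mu v -> tail j mu v
| tailS r mu v : (j < r)%N -> (r.+1 < n)%N -> tail j mu v -> tail j (swp r mu) (p r v).

Lemma tail_size j mu v : tail j mu v -> size mu = n.
Proof. by elim=> [? ? /lead_size|*]; rewrite ?size_swp. Qed.

Lemma tail_from j mu v : tail j mu v -> from j mu v.
Proof.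
elim=> {mu v} [mu v /lead_from h|r mu v jr rn ht IH]; first exact: h.
by apply: cl_p => //; [apply: tail_size ht|apply: ltnW].
Qed.

Lemma tail_p j mu v : tail j.+1 mu v -> (j < k)%N -> (j.+1 < n)%N ->
  tail j (swp j mu) (p j v).
Proof.
move=> ht jk jn; elim: ht => {mu v} [mu v hl|r mu v jr rn ht IH].
  by apply: tail0; apply: leadS.
rewrite (qh_pp_far GP (tail_size ht) _ _ _ _ (from_G (tail_size ht) (tail_from ht))) //.
by rewrite swp_far //; apply: tailS => //; lia.
Qed.

(** Modulo commutation, a path first brings the first strand of the second
    block to its final position [j], the first unmarked position of [b], and the
    other crossings take place to the right of it. *)
Lemma path_tail q b mu v : path n predT p k E q b mu v ->
  exists j, [/\ forall i, (i < j)%N -> nth false b i, ~~ nth false b j & tail j mu v].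
Proof.
elim=> {q b mu v} [mu v sm Ev|q b mu v r P [j [h1 h2 ht]] _ rn br br1].
  exists k; split; last by apply/tail0/lead0.
    by move=> i ik; rewrite nth_bits0.
  by rewrite nth_bits0 ltnn.
have sb := path_size kn P.
case: (ltngtP j r) => jr.
- exists j; split; last exact: tailS.
    by move=> i ij; rewrite nth_swp_far ?sb ?h1 //; lia.
  by rewrite nth_swp_far ?sb //; lia.
- have e : j = r.+1.
    apply/eqP; rewrite eqn_leq jr andbT leqNgt; apply: contra br1; exact: h1.
  subst j; exists r; split.
  + by move=> i ij; rewrite nth_swp_far ?sb ?h1 //; lia.
  + by rewrite nth_swp_l ?sb.
  apply: tail_p => //.
  suff: (r.+1 <= k)%N by [].
  by elim: ht => [? ? /lead_le|].
by rewrite jr br in h2.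
Qed.

Lemma tail_cyc mu v : (k < n)%N -> tail 0 mu v ->
  exists2 v', IN mu v' & rest 0 mu (iter (w (lab mu 0)) (x 0%N) v - v').
Proof.
move=> ltkn; have IS := IN_stable.
elim=> {mu v} [mu v|r mu v r0 rn ht [v' Iv' hr]]; first exact: lead_cyc.
have sm := tail_size ht; exists (p r v'); first exact: (st_p IS).
have pl := qh_plin GP r.
have gv := from_G sm (tail_from ht).
rewrite lab0_swp // (first_dots_p _ sm) // -(linopB _ _ pl).
move: hr; rewrite /rest; case: ifP => [_|_ ->]; last exact: linop0.
exact: cl_p.
Qed.

(** If position 0 is reached by the second block, the [w] dots produce vectors
    of [IN] and error terms that start with the first block; the latter are
    caught by the [a] dots. Otherwise the [a] dots suffice. *)
Lemma path_cyc q b mu v : (0 < n)%N -> path n predT p k E q b mu v ->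
  IN mu (iter (a (lab mu 0) + w (lab mu 0)) (x 0%N) v).
Proof.
move=> n0 P; have [j [h1 h2 ht]] := path_tail P.
have IS := IN_stable; have sm := tail_size ht.
have IxN m u : IN mu u -> IN mu (iter m (x 0%N) u).
  by apply: iter_in => w0; apply: (st_x IS).
have xl m : linop (iter m (x 0%N)) by apply/linop_iter/(qh_xlin GP).
case: j h1 h2 ht => [|j] h1 h2 ht; last first.
  rewrite addnC iterD; apply: (IxN); apply: from_first => //.
    suff: (j.+1 <= k)%N by lia.
    by elim: ht => [? ? /lead_le|].
  by apply: from_le (tail_from ht).
have [ltkn|] := ltnP k n; last first.
  move=> nk; have := path_count P; have /eqP := path_size kn P.
  have -> : k = n by lia.
  move=> /eqP sb cb; have : all id b by rewrite all_count cb sb.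
  by move/(all_nthP false)/(_ 0%N); rewrite sb (negPf h2) => /(_ n0).
have [v' Iv' hr] := tail_cyc ltkn ht.
rewrite iterD -(subrK v' (iter (w _) _ v)) linopD //.
apply: subspD; [exact: (st_sub IS)| |exact: IxN].
move: hr; rewrite /rest; case: ifP => [k0|_ ->]; first exact: from_first.
by rewrite linop0 //; case: (st_sub IS mu).
Qed.

Lemma induced_cyc mu v : (0 < n)%N -> IE mu v ->
  IN mu (iter (a (lab mu 0) + w (lab mu 0)) (x 0%N) v).
Proof.
move=> n0 [q S]; have IS := IN_stable.
have xl m : linop (iter m (x 0%N)) by apply/linop_iter/(qh_xlin GP).
elim: S => [q1 q2 b nu u _|q1 nu|q1 nu c u1 u2 _ h1 _ h2]; first exact: path_cyc.
  by rewrite linop0 //; case: (st_sub IS nu).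
by rewrite xl; apply: (st_sub IS nu).2.
Qed.
End Mackey.

(** * Nonvanishing from modules over the parabolic subalgebra *)

Local Notation unshuffle b mu := (mask b mu ++ mask (map negb b) mu).

(** Undone from its last crossing on, the word of [b] removes one inversion at
    each step. *)
Lemma word_path (K : fieldType) (I : choiceType) (V : lmodType K) n k
    (p : nat -> V -> V) (N : seq I -> V -> Prop) b s v :
  size b = n -> count id b = k -> size s = n -> N (unshuffle b s) v ->
  path n predT p k N (inv b) b s (word p b v).
Proof.
rewrite /word; move Eq: (inv b) => q; elim: q b s Eq => [|q IH] b s Eq sb cb ss Nv.
  rewrite [b](inv_eq0 Eq) sb cb /=; apply: path0 => //.
  move: Nv; rewrite [b](inv_eq0 Eq) sb cb mask_bits0 ?mask_negb_bits0 ?cat_take_drop //;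
    by rewrite -cb -sb count_size.
have [r0 [/descentP h /h [b0 b1]]] : exists r, ~~ nth false b r /\ nth false b r.+1.
  by apply: inv_descent; rewrite Eq.
rewrite /=; move: (descent b) b0 b1 => r b0 b1.
have rs : (r.+1 < size b)%N by case: ltnP b1 => // h'; rewrite nth_default.
have sb' : size (swp r b) = n by rewrite size_swp.
have P := IH (swp r b) (swp r s) _ sb' _ _ _.
rewrite -{1}(swpK r b) -(swpK r s); apply: pathS; last 2 first.
- by rewrite nth_swp_l.
- by rewrite nth_swp_r.
- apply: P; rewrite ?size_swp ?count_swp //.
    by apply: succn_inj; rewrite -Eq inv_swp_descent.
  by rewrite (unshuffle_swp (leqnn n)) ?sb ?ss -?sb // (negPf b0) b1.
- by [].
by rewrite -sb.
Qed.

Section Backward.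
Variables (K : fieldType) (I : choiceType) (Q : I -> I -> {poly {poly K}}) (i0 : I).
Hypothesis Qii : forall i, Q i i = 0.
Hypothesis Qsym : forall i j, Q i j = swapXY (Q j i).
Variables (n k : nat) (kn : (k <= n)%N) (V : lmodType K) (x p : nat -> V -> V).
Local Notation D := [pred r | predT r & r.+1 != k].
Variables (M : seq I -> V -> Prop) (MP : qhmod Q i0 n D x p M).
Variables (nu : seq I) (snu : size nu = n) (t0 : V) (Mt : M nu t0) (t0N0 : t0 != 0).
Variables (a w : I -> nat).
Hypothesis cyc1 : forall mu v, (0 < k)%N -> size mu = n -> M mu v ->
  iter (a (nth i0 mu 0)) (x 0%N) v = 0.
Hypothesis cyc2 : forall mu v, (k < n)%N -> size mu = n -> M mu v ->
  iter (w (nth i0 mu k)) (x k) v = 0.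

(** The family [M] stands for a module of the parabolic subalgebra; [Gr] relates
    it to the generic representation, in which [E] and [N] are the vectors that
    correspond to some vector of [M] and to zero. The quotient of the submodules
    generated by [E] and [N] is the induced module, and the word of [b] applied
    to the base vector is a nonzero vector of it with the labels [s]. *)
Theorem shuffle_not_vanishing s b : size s = n -> b \in bits n k ->
  unshuffle b s = nu -> ~ vanishing Q i0 (fun i => a i + w i)%N s.
Proof.
move=> ss; rewrite mem_bits => /andP[/eqP sb /eqP cb] us van.
have [L [phi [X [Xinj HF]]]] := faithfulP i0 Qii Qsym n.
have GP := gen_qhmod i0 Qii Qsym phi Xinj (nth i0 nu).
have [BP Gsub] := graph_qhmod Qii Qsym phi Xinj snu MP Mt.
set Gr := graph Q i0 X n D x p nu t0 in Gsub.
have GrS : stable n D (fun r => prodop (x r) (@gen_x K L phi X r))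
    (fun r => prodop (p r) (@gen_p K I Q L phi X (nth i0 nu) r)) Gr.
  exact: closure_stable.
pose W := (seq nat -> ext_space phi).
pose E mu (f : W) := exists t, Gr mu (t, f); pose N mu (f : W) := Gr mu (0, f).
have ES : stable n D (@gen_x K L phi X) (@gen_p K I Q L phi X (nth i0 nu)) E.
  split=> [mu|r mu f sm rn [t h]|r mu f sm rn Dr [t h]].
  - have [z lin] := st_sub GrS mu; split; first by exists 0.
    by move=> c f g [t ht] [u hu]; exists (c *: t + u); apply: lin ht hu.
  - by exists (x r t); apply: (st_x GrS sm rn h).
  by exists (p r t); apply: (st_p GrS sm rn Dr h).
have NS : stable n D (@gen_x K L phi X) (@gen_p K I Q L phi X (nth i0 nu)) N.
  split=> [mu|r mu f sm rn h|r mu f sm rn Dr h].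
  - have [z lin] := st_sub GrS mu; split; first exact: z.
    move=> c f g hf hg; have := lin c _ _ hf hg.
    by rewrite [c *: (0, f) + (0, g)](_ : _ = (0, c *: f + g)) // /GRing.add /GRing.scale /= /add_pair /scale_pair /= scaler0 addr0.
  - by have := st_x GrS sm rn h; rewrite /prodop /= (linop0 (qh_xlin MP r)).
  by have := st_p GrS sm rn Dr h; rewrite /prodop /= (linop0 (qh_plin MP r)).
have NE : subfam n N E by move=> mu f _ h; exists 0.
have EG : subfam n E (gen_space n (nth i0 nu)).
  by move=> mu f sm [t /(Gsub _ _ sm)[]].
have NG : subfam n N (gen_space n (nth i0 nu)).
  by move=> mu f sm /(NE _ _ sm) /(EG _ _ sm).
have c1 mu f : (0 < k)%N -> size mu = n -> E mu f ->
    N mu (iter (a (nth i0 mu 0)) (gen_x X 0%N) f).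
  move=> k0 sm [t h]; have [Mu _] := Gsub _ _ sm h.
  have := @iter_in _ _ (Gr mu) _ (a (nth i0 mu 0)) _ _ h.
  move=> /(_ _ (fun u => st_x GrS sm (r := 0%N) (v := u) (leq_trans k0 kn))).
  by rewrite iter_prodop /= cyc1.
have c2 mu f : (k < n)%N -> size mu = n -> E mu f ->
    N mu (iter (w (nth i0 mu k)) (gen_x X k) f).
  move=> k0 sm [t h]; have [Mu _] := Gsub _ _ sm h.
  have := @iter_in _ _ (Gr mu) _ (w (nth i0 mu k)) _ _ h.
  move=> /(_ _ (fun u => st_x GrS sm (r := k) (v := u) k0)).
  by rewrite iter_prodop /= cyc2.
have IES := induced_stable GP kn EG ES; have INS := induced_stable GP kn NG NS.
have IEP : qhmod Q i0 n predT (@gen_x K L phi X) (@gen_p K I Q L phi X (nth i0 nu))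
    (induced n predT (@gen_p K I Q L phi X (nth i0 nu)) k E).
  by apply: (sub_qhmod GP IES (induced_M GP EG)).
pose f := word (@gen_p K I Q L phi X (nth i0 nu)) b (base_vector phi n).
have Ef : induced n predT (@gen_p K I Q L phi X (nth i0 nu)) k E s f.
  exists (inv b); apply: (span_path (leqnn _)); apply: word_path => //.
  by rewrite us; exists t0; apply: cl_base.
have := van n _ _ _ _ _ ss IEP INS _ f Ef; case=> [mu v n0 sm hv|q Sq].
  exact: (induced_cyc GP kn EG NE ES NS c1 c2 n0 hv).
have [F hF e] := induced_sum GP kn NG NS (ex_intro _ q Sq).
have bB : b \in bits n k by rewrite mem_bits sb cb !eqxx.
have gl b' : linop (word (@gen_p K I Q L phi X (nth i0 nu)) b').
  by apply: word_lin => r; apply: (qh_plin GP).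
have NB mu g : N mu g -> block_sorted n k g.
  exact: (graph_sorted (D := predT) kn).
pose G b' : seq nat -> ext_space phi := F b' - (if b' == b then base_vector phi n else 0).
have GB b' : b' \in bits n k -> block_sorted n k (G b').
  move=> /hF/NB hb'; rewrite /G; apply: (@subspB _ _ (block_sorted n k)) => //; first exact: block_sorted_sub.
  by case: eqP => _; [apply: base_vector_sorted|case: (block_sorted_sub phi n k)].
have G0 : \sum_(b' <- bits n k) word (@gen_p K I Q L phi X (nth i0 nu)) b' (G b') = 0.
  rewrite (eq_bigr _ (fun b' _ => linopB _ _ (gl b'))) big_split /= -e.
  rewrite (bigD1_seq b) ?bits_uniq //= eqxx big1 => [|b' /negPf ->].
    by rewrite addr0 subrr.
  by rewrite (linop0 (gl b')) oppr0.
have := word_free Xinj kn GB G0 bB; rewrite /G eqxx => /eqP; rewrite subr_eq0 => /eqP eF.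
have : Gr nu (t0 - 0, base_vector phi n - base_vector phi n).
  apply: (@subspB _ _ (Gr nu) (t0, base_vector phi n) (0, base_vector phi n)).
  - exact: (st_sub GrS nu).
  - exact: cl_base.
  by have := hF b bB; rewrite us eF.
rewrite subr0 subrr => /(HF _ _ _ _ _ _ _ snu MP Mt) t00.
by move: t0N0; rewrite t00 eqxx.
Qed.
End Backward.

(** * Tensor products *)

(** A maximal subspace avoiding [e] is a hyperplane. *)
Lemma functional_at (K : fieldType) (V : lmodType K) (e : V) : e != 0 ->
  exists2 lam : V -> K, forall c u v, lam (c *: u + v) = c * lam u + lam v & lam e = 1.
Proof.
move=> e0; pose avoids (A : set V) :=
  (forall c u v, A u -> A v -> A (c *: u + v)) /\ ~ A e.
have [F FP Ftot|A [[Alin Ae] Amax]] := @Zorn_bigcup V avoids.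
  split=> [c u v [S FS Su] [T FT Tv]|[S /FP[_ nS] /nS//]].
  have [ST|TS] := Ftot _ _ FS FT.
    by exists T => //; apply: (FP _ FT).1 => //; apply: ST.
  by exists S => //; apply: (FP _ FS).1 => //; apply: TS.
have A0 : A 0.
  have [//|nA0] := pselect (A 0); exfalso.
  have nA u : ~ A u by move=> Au; apply: nA0; rewrite -(addNr u) -scaleN1r; apply: Alin.
  apply: (Amax [set 0]%classic); first by split=> [u /nA//|/(_ 0 erefl)/nA].
  split=> [c u v -> ->|/= ee]; first by rewrite scaler0 addr0.
  by rewrite ee eqxx in e0.
have AZ c u : A u -> A (c *: u) by move=> Au; rewrite -[c *: u]addr0; apply: Alin.
have AD u v : A u -> A v -> A (u + v) by move=> Au Av; rewrite -[u]scale1r; apply: Alin.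
have ex v : exists c, A (v - c *: e).
  have [Av|nAv] := pselect (A v); first by exists 0; rewrite scale0r subr0.
  pose B : set V := fun z => exists c u, A u /\ z = c *: v + u.
  have [[d [u [Au ee]]]|nBe] := pselect (B e).
    have d0 : d != 0.
      by apply/eqP => d0; apply: Ae; rewrite ee d0 scale0r add0r.
    exists d^-1; rewrite ee scalerDr scalerA mulVf // scale1r opprD addrA subrr sub0r.
    by rewrite -scalerN -scaleN1r; apply/AZ/AZ.
  exfalso; apply: (Amax B).
    split=> [u Au|/(_ v)]; first by exists 0, u; rewrite scale0r add0r.
    by move=> H; apply: nAv; apply: H; exists 1, 0; rewrite scale1r addr0.
  split=> // c _ _ [c1 [u1 [A1 ->]]] [c2 [u2 [A2 ->]]].
  exists (c * c1 + c2), (c *: u1 + u2); split; first exact: Alin.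
  by rewrite scalerDr scalerA scalerDl addrACA.
have uniq c d v : A (v - c *: e) -> A (v - d *: e) -> c = d.
  move=> h1 h2; apply/eqP; rewrite -subr_eq0; apply/negPn/negP => n0; apply: Ae.
  have -> : e = (c - d)^-1 *: ((v - d *: e) + (-1) *: (v - c *: e)).
    rewrite scaleN1r opprB [X in _ *: X]addrC addrA subrK -scalerBl.
    by rewrite scalerA mulVf // scale1r.
  by apply/AZ/AD => //; apply: AZ.
have [lam lamP] := choice ex; exists lam => [c u v|]; last first.
  by apply: (uniq _ _ e (lamP e)); rewrite scale1r subrr.
apply: (uniq _ _ _ (lamP _)).
have -> : c *: u + v - (c * lam u + lam v) *: e = c *: (u - lam u *: e) + (v - lam v *: e).
  by rewrite scalerDl scalerBr scalerA opprD addrACA.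
exact: Alin (lamP u) (lamP v).
Qed.

Section Action.
Variables (K : fieldType) (I : choiceType) (Q : I -> I -> {poly {poly K}}) (i0 : I).
Variables (n : nat) (A : pzAlgType K) (X Ps : nat -> A) (E : seq I -> A).
Hypothesis AP : qhring Q i0 n X Ps E.
Variables (V : lmodType K) (act : A -> V -> V) (S : V -> Prop).

(** The action is only required to be additive in the scalar on the subspace
    [S], so that functions that are not linear can be admitted in [V]. *)
Record action : Prop := Action {
  actn_lin a : linop (act a);
  actn_M a b v : act (a * b) v = act a (act b v);
  actn_in a v : S v -> S (act a v);
  actn_S : subsp S;
  actn_D a b v : S v -> act (a + b) v = act a v + act b v;
  actn_Z c a v : S v -> act (pz_scalar c * a) v = c *: act a v;
  actn_1 v : S v -> act 1 v = v }.

Hypothesis VP : action.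

Let act0 v : S v -> act 0 v = 0.
Proof. by move=> Sv; apply: (addrI (act 0 v)); rewrite -(actn_D VP) // !addr0. Qed.

Let actN a v : S v -> act (- a) v = - act a v.
Proof. by move=> Sv; apply/eqP; rewrite -subr_eq0 opprK -(actn_D VP) // addNr act0. Qed.

Let act_sum (J : Type) (r : seq J) (F : J -> A) v : S v ->
  act (\sum_(j <- r) F j) v = \sum_(j <- r) act (F j) v.
Proof.
move=> Sv; apply: (big_morph (fun a => act a v)) => [a b|]; last exact: act0.
exact: (actn_D VP).
Qed.

Let act_nat (k : bool) a v : S v -> act (k%:R * a) v = act a v *+ k.
Proof. by move=> Sv; case: k; rewrite ?mul1r ?mul0r ?mulr1n ?mulr0n ?act0. Qed.

Let iter_act a k v : S v -> iter k (act a) v = act (a ^+ k) v.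
Proof.
move=> Sv; elim: k => [|k IH] /=; first by rewrite expr0 (actn_1 VP).
by rewrite IH exprS (actn_M VP).
Qed.

Let act_eval2 q a b v : S v -> op_eval2 q (act a) (act b) v = act (alg_eval2 q a b) v.
Proof.
move=> Sv; rewrite /alg_eval2 act_sum //; apply: eq_bigr => k _.
rewrite act_sum //; apply: eq_bigr => m _; rewrite (actn_Z VP) // (actn_M VP).
by rewrite (iter_act b m Sv); congr (_ *: _); apply: iter_act; apply: (actn_in VP).
Qed.

Let act_ddiff q a b c v : S v ->
  op_ddiff q (act a) (act b) (act c) v = act (alg_ddiff q a b c) v.
Proof.
move=> Sv; rewrite /alg_ddiff act_sum //; apply: eq_bigr => k _.
rewrite act_sum //; apply: eq_bigr => m _; rewrite (actn_Z VP) // (actn_M VP).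
rewrite act_sum; last exact: (actn_in VP).
congr (_ *: _); apply: eq_bigr => j _; rewrite (actn_M VP) (iter_act b m Sv).
have Sw := actn_in VP (b ^+ m) Sv; rewrite (iter_act c j Sw).
exact: iter_act (actn_in VP _ Sw).
Qed.

Definition act_fam mu v := S v /\ act (E mu) v = v.

Lemma act_fam_sub mu : subsp (act_fam mu).
Proof.
split=> [|c u v [Su hu] [Sv hv]].
  by split; [case: (actn_S VP)|apply: (linop0 (actn_lin VP _))].
by split; [apply: (actn_S VP).2|rewrite (actn_lin VP) hu hv].
Qed.

Lemma action_qhmod : qhmod Q i0 n predT (fun r => act (X r)) (fun r => act (Ps r)) act_fam.
Proof.
have aM := actn_M VP.
split.
- split=> [mu|r mu v _ _ [Sv hv]|r mu v _ rn _ [Sv hv]]; first exact: act_fam_sub.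
    by split; [apply: (actn_in VP)|rewrite -aM -(qr_xe AP) aM hv].
  by split; [apply: (actn_in VP)|rewrite -aM -(qr_pe AP) // aM hv].
- by move=> r; apply: (actn_lin VP).
- by move=> r; apply: (actn_lin VP).
- by move=> r s mu v _ _ _ _; rewrite -!aM (qr_xx AP).
- move=> r mu v _ rn _ [Sv hv]; rewrite -{1}hv -!aM (qr_px AP) // mulrDl.
  by rewrite (actn_D VP) // act_nat // !aM hv.
- move=> r mu v _ rn _ [Sv hv]; rewrite -{1}hv -!aM (qr_xp AP) // mulrDl.
  by rewrite (actn_D VP) // act_nat // !aM hv.
- by move=> r s mu v _ rn _ sn n1 n2 _; rewrite -!aM (qr_px_far AP).
- by move=> r s mu v _ rs sn _ _ _; rewrite -!aM (qr_pp_far AP).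
- move=> r mu v _ rn _ [Sv hv]; rewrite act_eval2 // -{1}hv -!aM (qr_pp AP) //.
  by rewrite aM hv.
move=> r mu v _ rn _ _ [Sv hv]; rewrite act_ddiff // -act_nat // -[in RHS]hv.
by rewrite -[RHS]aM -(qr_ppp AP) // aM hv (actn_D VP) // actN // !aM.
Qed.
End Action.

Lemma lmulop_action (K : fieldType) (A : pzAlgType K) :
  action (@lmulop K A) (fun=> True).
Proof.
split=> //.
- exact: lmulop_lin.
- by move=> a b v; rewrite /lmulop mulrA.
- by move=> a b v _; rewrite /lmulop mulrDl.
- by move=> c a v _; rewrite /lmulop -mulrA.
by move=> v _; rewrite /lmulop mul1r.
Qed.

(** Two commuting actions on the same space, of the algebras on [k] and on [m]
    strands, form an action of the parabolic subalgebra on [k + m] strands. *)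
Section Outer.
Variables (K : fieldType) (I : choiceType) (Q : I -> I -> {poly {poly K}}) (i0 : I).
Variables (V : lmodType K) (k m : nat).
Variables (x1 p1 x2 p2 : nat -> V -> V) (M1 M2 : seq I -> V -> Prop).
Hypotheses (MP1 : qhmod Q i0 k predT x1 p1 M1) (MP2 : qhmod Q i0 m predT x2 p2 M2).
Hypothesis Cxx : forall r s v, x1 r (x2 s v) = x2 s (x1 r v).
Hypothesis Cxp : forall r s v, x1 r (p2 s v) = p2 s (x1 r v).
Hypothesis Cpx : forall r s v, p1 r (x2 s v) = x2 s (p1 r v).
Hypothesis Cpp : forall r s v, p1 r (p2 s v) = p2 s (p1 r v).
Hypothesis M1x : forall r mu v, M1 mu v -> M1 mu (x2 r v).
Hypothesis M1p : forall r mu v, M1 mu v -> M1 mu (p2 r v).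
Hypothesis M2x : forall r mu v, M2 mu v -> M2 mu (x1 r v).
Hypothesis M2p : forall r mu v, M2 mu v -> M2 mu (p1 r v).

Definition outer (f g : nat -> V -> V) r := if (r < k)%N then f r else g (r - k)%N.
Definition outer_fam mu v := M1 (take k mu) v /\ M2 (drop k mu) v.

Lemma outer_l f g r : (r < k)%N -> outer f g r = f r.
Proof. by rewrite /outer => ->. Qed.
Lemma outer_r f g r : outer f g (k + r) = g r.
Proof. by rewrite /outer ltnNge leq_addr addKn. Qed.

Lemma split_index r : (r < k + m)%N ->
  (r < k)%N \/ exists2 r', r = (k + r')%N & (r' < m)%N.
Proof.
case: (ltnP r k) => h rn; [by left|right].
by exists (r - k)%N; lia.
Qed.

Lemma split_crossing r : (r.+1 < k + m)%N -> r.+1 != k ->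
  (r.+1 < k)%N \/ exists2 r', r = (k + r')%N & (r'.+1 < m)%N.
Proof.
move=> rn rk; case: (ltnP r.+1 k) => h; [by left|right].
by exists (r - k)%N; lia.
Qed.

Lemma outer_qhmod :
  qhmod Q i0 (k + m) [pred r | predT r & r.+1 != k] (outer x1 x2) (outer p1 p2) outer_fam.
Proof.
have st (mu : seq I) : size mu = (k + m)%N -> size (take k mu) = k.
  by move=> sm; rewrite size_takel // sm leq_addr.
have sd (mu : seq I) : size mu = (k + m)%N -> size (drop k mu) = m.
  by move=> sm; rewrite size_drop sm addKn.
have ol := outer_l; have or := outer_r.
have [S1 S2] := (qh_st MP1, qh_st MP2).
have nl (mu : seq I) r : (r < k)%N -> nth i0 mu r = nth i0 (take k mu) r by move=> h; rewrite nth_take.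
have nr (mu : seq I) r : nth i0 mu (k + r) = nth i0 (drop k mu) r by rewrite nth_drop.
split.
- split=> [mu|r mu v sm /split_index hr [h1 h2]|r mu v sm rn /= rk [h1 h2]].
  + split; first by split; [case: (st_sub S1 (take k mu))|case: (st_sub S2 (drop k mu))].
    move=> c u v [u1 u2] [v1 v2].
    by split; [apply: (st_sub S1 _).2|apply: (st_sub S2 _).2].
  + case: hr => [h|[r' -> h]]; rewrite ?or ?ol //.
      by split; [apply: (st_x S1 (st _ sm))|apply: M2x].
    by split; [apply: M1x|apply: (st_x S2 (sd _ sm))].
  case: (split_crossing rn rk) => [h|[r' -> h]]; rewrite /outer_fam.
    rewrite ol ?(ltnW h) // take_swp_in // drop_swp //.
    by split; [apply: (st_p S1 (st _ sm))|apply: M2p].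
  rewrite or take_swp ?leq_addr // drop_swp_in.
  by split; [apply: M1p|apply: (st_p S2 (sd _ sm))].
- by move=> r; rewrite /outer; case: ifP => _; [apply: (qh_xlin MP1)|apply: (qh_xlin MP2)].
- by move=> r; rewrite /outer; case: ifP => _; [apply: (qh_plin MP1)|apply: (qh_plin MP2)].
- move=> r s mu v sm /split_index hr /split_index hs [h1 h2].
  case: hr => [hr|[r' -> hr]]; case: hs => [hs|[s' -> hs]]; rewrite ?or ?ol //.
    exact: (qh_xxC MP1 (st _ sm) _ _ h1).
  exact: (qh_xxC MP2 (sd _ sm) _ _ h2).
- move=> r mu v sm rn /= rk [h1 h2]; case: (split_crossing rn rk) => [h|[r' -> h]].
    have h' := ltnW h; rewrite !ol // (nl mu r h') (nl mu r.+1 h).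
    exact: (qh_px MP1 (st _ sm) _ _ h1).
  by rewrite -addnS !or !nr; apply: (qh_px MP2 (sd _ sm) _ _ h2).
- move=> r mu v sm rn /= rk [h1 h2]; case: (split_crossing rn rk) => [h|[r' -> h]].
    have h' := ltnW h; rewrite !ol // (nl mu r h') (nl mu r.+1 h).
    exact: (qh_xp MP1 (st _ sm) _ _ h1).
  by rewrite -addnS !or !nr; apply: (qh_xp MP2 (sd _ sm) _ _ h2).
- move=> r s mu v sm rn /= rk /split_index hs + + [h1 h2].
  case: (split_crossing rn rk) => [hr|[r' -> hr]]; case: hs => [hs|[s' -> hs]] n1 n2;
    rewrite ?or ?ol ?(ltnW hr) //.
    exact: (qh_px_far MP1 (st _ sm) _ _ _ _ _ h1).
  by apply: (qh_px_far MP2 (sd _ sm) _ _ _ _ _ h2) => //; lia.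
- move=> r s mu v sm rs sn /= rk sk [h1 h2].
  have rn : (r.+1 < k + m)%N by lia.
  case: (split_crossing rn rk) => [hr|[r' er hr]]; case: (split_crossing sn sk) => [hs|[s' es hs]].
  + rewrite !ol ?(ltnW hr) ?(ltnW hs) //; exact: (qh_pp_far MP1 (st _ sm) _ _ _ _ h1).
  + by rewrite es !or !ol ?(ltnW hr).
  + by lia.
  rewrite er es !or; apply: (qh_pp_far MP2 (sd _ sm) _ _ _ _ h2) => //; lia.
- move=> r mu v sm rn /= rk [h1 h2]; case: (split_crossing rn rk) => [h|[r' -> h]].
    have h' := ltnW h; rewrite !ol // (nl mu r h') (nl mu r.+1 h).
    exact: (qh_pp MP1 (st _ sm) _ _ h1).
  by rewrite -addnS !or !nr; apply: (qh_pp MP2 (sd _ sm) _ _ h2).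
move=> r mu v sm rn /= rk rk1 [h1 h2]; case: (split_crossing rn rk1) => [h|[r1 e1 h]].
  have h' := ltnW h; rewrite !ol ?(ltnW h') // (nl mu r (ltnW h')) (nl mu r.+1 h') (nl mu r.+2 h).
  exact: (qh_ppp MP1 (st _ sm) _ _ _ h1).
have [r' e h3] : exists2 r', r = (k + r')%N & (r'.+2 < m)%N.
  by exists (r - k)%N; move: rk rk1 rn; lia.
rewrite e -!addnS !or !nr; exact: (qh_ppp MP2 (sd _ sm) _ _ _ h2).
Qed.
End Outer.

Section Tensor.
Variables (K : fieldType) (I : choiceType) (Q : I -> I -> {poly {poly K}}) (i0 : I).
Variables (k m : nat) (A1 A2 : pzAlgType K).
Variables (X1 P1 : nat -> A1) (E1 : seq I -> A1) (X2 P2 : nat -> A2) (E2 : seq I -> A2).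
Hypotheses (AP1 : qhring Q i0 k X1 P1 E1) (AP2 : qhring Q i0 m X2 P2 E2).

Local Notation V := (A1 -> alg_space A2).

(** Linear maps from [A1] to [A2] replace the tensor product: they carry
    commuting left actions of both algebras, and a vector that is nonzero at a
    given pair of idempotents only needs a linear functional. *)
Definition linear_map (f : V) := forall c u v,
  f (pz_scalar c * u + v) = c *: f u + f v.
Definition act_l (a : A1) (f : V) : V := fun z => f (z * a).
Definition act_r (b : A2) (f : V) : V := fun z => lmulop b (f z).

Lemma linear_map_sub : subsp linear_map.
Proof.
split=> [c u v|c f g hf hg d u v]; first by rewrite -[RHS]/(c *: 0 + 0) scaler0 addr0.
rewrite -[LHS]/(c *: f _ + g _) hf hg -[RHS]/(d *: (c *: f u + g u) + (c *: f v + g v)).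
by rewrite !scalerDr !scalerA [d * c]mulrC addrACA.
Qed.

Lemma act_l_action : action act_l linear_map.
Proof.
split.
- by [].
- by move=> a b f; apply/funext => z; rewrite /act_l mulrA.
- by move=> a f hf c u v; rewrite /act_l mulrDl -mulrA hf.
- exact: linear_map_sub.
- move=> a b f hf; apply/funext => z; rewrite /act_l mulrDr.
  by have := hf 1 (z * a) (z * b); rewrite rmorph1 mul1r scale1r.
- move=> c a f hf; apply/funext => z; rewrite /act_l mulrA -pz_scalarC -mulrA.
  rewrite -[pz_scalar c * _]addr0 hf -[RHS]addr0; congr (_ + _).
  by have := hf (-1) 0 0; rewrite mulr0 addr0 scaleN1r addNr.
by move=> f _; apply/funext => z; rewrite /act_l mulr1.
Qed.

Lemma act_r_action : action act_r linear_map.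
Proof.
have L := lmulop_action A2; split.
- by move=> b c f g; apply/funext => z; rewrite /act_r lmulop_lin.
- by move=> a b f; apply/funext => z; rewrite /act_r (actn_M L).
- by move=> b f hf c u v; rewrite /act_r hf lmulop_lin.
- exact: linear_map_sub.
- by move=> a b f _; apply/funext => z; rewrite /act_r (actn_D L).
- by move=> c a f _; apply/funext => z; rewrite /act_r (actn_Z L).
by move=> f _; apply/funext => z; rewrite /act_r (actn_1 L).
Qed.

Let M1 := act_fam E1 act_l linear_map.
Let M2 := act_fam E2 act_r linear_map.

Definition tensor_x := outer k (fun r => act_l (X1 r)) (fun r => act_r (X2 r)).
Definition tensor_p := outer k (fun r => act_l (P1 r)) (fun r => act_r (P2 r)).
Definition tensor_fam := outer_fam k M1 M2.

Lemma tensor_qhmod :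
  qhmod Q i0 (k + m) [pred r | predT r & r.+1 != k] tensor_x tensor_p tensor_fam.
Proof.
have [L R] := (act_l_action, act_r_action).
have rM b mu f : M1 mu f -> M1 mu (act_r b f).
  move=> [hf e]; split; first exact: (actn_in R).
  by rewrite -[RHS](congr1 (act_r b) e).
have lM a mu f : M2 mu f -> M2 mu (act_l a f).
  move=> [hf e]; split; first exact: (actn_in L).
  by rewrite -[RHS](congr1 (act_l a) e).
apply: outer_qhmod => //; [exact: (action_qhmod AP1 L)|exact: (action_qhmod AP2 R)|..].
all: by move=> r mu f; (apply: rM || apply: lM).
Qed.

Lemma tensor_cyc_l c mu f : (0 < k)%N -> X1 0%N ^+ c * E1 (take k mu) = 0 ->
  tensor_fam mu f -> iter c (tensor_x 0%N) f = 0.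
Proof.
move=> k0 e [[hf ef] _]; rewrite /tensor_x outer_l //.
have -> : iter c (act_l (X1 0%N)) f = act_l (X1 0%N ^+ c) f.
  by elim: c {e} => [|c IH]; apply/funext => z; rewrite ?IH /act_l ?mulr1 //= IH /act_l exprS mulrA.
rewrite -ef -(actn_M act_l_action) e; apply/funext => z; rewrite /act_l mulr0.
by have := hf (-1) 0 0; rewrite mulr0 addr0 scaleN1r addNr.
Qed.

Lemma tensor_cyc_r c mu f : X2 0%N ^+ c * E2 (drop k mu) = 0 ->
  tensor_fam mu f -> iter c (tensor_x k) f = 0.
Proof.
move=> e [_ [hf ef]]; rewrite /tensor_x -[k in outer _ _ _ k]addn0 outer_r.
have -> : iter c (act_r (X2 0%N)) f = act_r (X2 0%N ^+ c) f.
  by elim: c {e} => [|c IH]; apply/funext => z; rewrite ?IH /act_r /lmulop ?mul1r //= IH /act_r /lmulop exprS mulrA.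
by rewrite -ef -(actn_M act_r_action) e; apply/funext => z; rewrite /act_r /lmulop mul0r.
Qed.

Lemma tensor_neq0 mu : E1 (take k mu) != 0 -> E2 (drop k mu) != 0 ->
  exists2 f : V, tensor_fam mu f & f != 0.
Proof.
move=> e1 e2; have [lam lamL lam1] := @functional_at K (alg_space A1) (E1 (take k mu)) e1.
exists (fun z => lam (z * E1 (take k mu)) *: (E2 (drop k mu) : alg_space A2)).
  have lin : linear_map (fun z => lam (z * E1 (take k mu)) *: (E2 (drop k mu) : alg_space A2)).
    move=> c u v; rewrite mulrDl -mulrA.
    rewrite -[pz_scalar c * _ + _]/(c *: (u * _ : alg_space A1) + (v * _ : alg_space A1)).
    by rewrite lamL scalerDl scalerA.
  split; split=> //; apply/funext => z.
    by rewrite /act_l -mulrA (qr_ee AP1).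
  rewrite /act_r (linopZ _ _ (@lmulop_lin K A2 (E2 (drop k mu)))).
  by rewrite /lmulop (qr_ee AP2).
apply/eqP => /(congr1 (fun f : V => f 1)).
rewrite mul1r lam1 scale1r => e; by rewrite -[E2 _]/((E2 (drop k mu) : alg_space A2)) e eqxx in e2.
Qed.
End Tensor.

(** * Sums of two weights *)
Section AbstractAlgebras.
Variables (K : fieldType) (I : choiceType) (Q : I -> I -> {poly {poly K}}) (i0 : I).
Variables (a w : I -> nat).

(** The element [E s] is a vector labelled [s] of the regular representation. *)
Lemma algebra_split n (A : pzAlgType K) X Ps E s : @qhring K I Q i0 n A X Ps E ->
  (forall mu, (0 < n)%N -> X 0%N ^+ (a (nth i0 mu 0) + w (nth i0 mu 0)) * E mu = 0) ->
  size s = n -> E s != 0 -> exists b,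
  [/\ size b = n, ~ vanishing Q i0 a (mask b s) & ~ vanishing Q i0 w (mask (map negb b) s)].
Proof.
move=> AP cyc ss es; have RP := action_qhmod AP (lmulop_action A).
apply: contrapT => nex; move/eqP: es; apply.
apply: (forward_aux (a := a) (w := w) RP _ ss) => [mu v n0 sm [_ <-]|b sb|].
- rewrite iter_lmulop /lmulop mulrA cyc //; exact: mul0r.
- have [h1|h1] := pselect (vanishing Q i0 a (mask b s)); first by left.
  have [h2|h2] := pselect (vanishing Q i0 w (mask (map negb b) s)); first by right.
  by case: nex; exists b.
by split=> //; apply: (qr_ee AP).
Qed.

Hypothesis Qii : forall i, Q i i = 0.
Hypothesis Qsym : forall i j, Q i j = swapXY (Q j i).

Lemma algebra_shuffle k m (A1 A2 : pzAlgType K) X1 P1 E1 X2 P2 E2 s b :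
  @qhring K I Q i0 k A1 X1 P1 E1 -> @qhring K I Q i0 m A2 X2 P2 E2 ->
  (forall mu, (0 < k)%N -> X1 0%N ^+ a (nth i0 mu 0) * E1 mu = 0) ->
  (forall mu, (0 < m)%N -> X2 0%N ^+ w (nth i0 mu 0) * E2 mu = 0) ->
  size b = size s -> size (mask b s) = k -> size (mask (map negb b) s) = m ->
  E1 (mask b s) != 0 -> E2 (mask (map negb b) s) != 0 ->
  ~ vanishing Q i0 (fun i => a i + w i)%N s.
Proof.
move=> AP1 AP2 cyc1 cyc2 sb sk sm e1 e2.
have cb : count id b = k by rewrite -sk size_mask.
have ss : size s = (k + m)%N.
  rewrite -sk -sm !size_mask ?size_map // -sb -(count_predC id b); congr addn.
  by rewrite count_map.
pose nu := mask b s ++ mask (map negb b) s.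
have tn : take k nu = mask b s by rewrite take_size_cat.
have dn : drop k nu = mask (map negb b) s by rewrite drop_size_cat.
have [t0 Mt t0N0] : exists2 t, tensor_fam k E1 E2 nu t & t != 0.
  by apply: (tensor_neq0 AP1 AP2); rewrite ?tn ?dn.
have TP := tensor_qhmod AP1 AP2.
apply: (shuffle_not_vanishing Qii Qsym (leq_addr m k) TP _ Mt t0N0 (a := a) (w := w)
  _ _ ss _ erefl).
- by rewrite size_cat sk sm.
- move=> mu v k0 smu; apply: tensor_cyc_l => //.
  have -> : nth i0 mu 0 = nth i0 (take k mu) 0 by rewrite nth_take.
  exact: cyc1.
- move=> mu v km smu; apply: tensor_cyc_r.
  have -> : nth i0 mu k = nth i0 (drop k mu) 0 by rewrite nth_drop addn0.
  by apply: cyc2; lia.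
by rewrite mem_bits sb ss cb !eqxx.
Qed.
End AbstractAlgebras.

Section Alive.
Variables (K : fieldType) (I : choiceType) (Q : I -> I -> {poly {poly K}}).
Hypothesis Qii : forall i, Q i i = 0.
Hypothesis Qsym : forall i j, Q i j = swapXY (Q j i).
Variables (P : zmodType) (alpha : I -> P) (h : I -> {additive P -> int}).

Definition alive (Lam : P) (s : seq I) : Prop := cyc_e Q h Lam (seq_Ibeta alpha s) != 0.

(** Without strands the algebra acts on the ground field; this also covers an
    empty set of labels. *)
Lemma cyc_e_nil beta (Lam : P) (nu : Ibeta alpha 0 beta) : cyc_e Q h Lam nu != 0.
Proof.
apply/negP => /to_quot_eq0 hI.
pose g (_ : qh_index alpha 0 beta) (v : K^o) := v.
have glin b : linop (g b) by [].
pose U (_ : K^o) := True; pose U' (v : K^o) := v = 0.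
have Us : subsp U by [].
have Us' : subsp U' by split=> // c u v -> ->; rewrite scaler0 addr0.
have Ug b u : U u -> U (g b u) by [].
have U'g b u : U' u -> U' (g b u) by [].
have one (nu1 nu2 : Ibeta alpha 0 beta) : nu1 = nu2.
  by apply: val_inj; apply: val_inj => /=; rewrite (tuple0 (val nu1)) (tuple0 (val nu2)).
have abs_ee (A : pzRingType) (ac : A -> K^o -> K^o) (e : A) :
    (forall z1 z2 v, ac (z1 * z2) v = ac z1 (ac z2 v)) -> (forall v, ac 1 v = v) ->
    (forall v, ac e v = v) -> forall v, ac (e * e) v = ac (true%:R * e) v.
  by move=> aM a1 ae v; rewrite !aM !ae -[true%:R]/1 a1.
have relU z1 z2 u : qh_rel Q z1 z2 -> U u -> act g z1 u = act g z2 u.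
  have aM := actM glin; have a1 := @act1 K _ _ g.
  have no T (r : 'I_0) : T by case: r.
  case=> [nu1 nu2|s us hs|r ?|r ?|r ?|r ?|r ?|r ? ? ?|r ? ?|r ?|r ? ? ?] _.
  3-11: exact: (no _ r).
    by rewrite (one nu2 nu1) eqxx; exact (abs_ee _ _ _ aM a1 (fun v => act_gen g (e_index nu1) v) u).
  have es : s = [:: nu].
    by case: s us hs => [_ /(_ nu)//|nu1 [|nu2 s]]; rewrite (one nu1 nu) // (one nu2 nu) /= inE eqxx.
  by rewrite es big_seq1; exact (etrans (act_gen g (e_index nu) u) (esym (a1 u))).
have hS (w : quiver_hecke Q alpha 0 beta) : cyc_gen h Lam w ->
    exists y, to_quot _ y = w /\ forall u, U u -> U' (act g y u).
  by case=> -[].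
have := act_quot_ideal glin Us Ug Us' U'g relU hS hI
  (erefl _ : to_quot _ (free_gen K (e_index nu)) = _) (u := 1) Logic.I.
by rewrite act_gen => /eqP; rewrite oner_eq0.
Qed.

Lemma alive_nil Lam : alive Lam [::].
Proof. exact: cyc_e_nil. Qed.

Lemma alive_vanishing i0 Lam s : ~ alive Lam s ->
  vanishing Q i0 (fun i => `|h i Lam|%N) s.
Proof.
move=> /negP/negPn/eqP e0 n V x p M M' ss MP M'P cyc v.
subst n; exact: (cyc_vanish MP M'P cyc e0).
Qed.

Lemma alive0 s : alive 0 s <-> s = [::].
Proof.
split=> [|->]; last exact: alive_nil.
case: s => // i s; rewrite /alive -(cyc_en_val Q h 0) => /eqP[].
have := @cyc_pow K I Q i P alpha h (size (i :: s)) (seq_wt alpha (i :: s)) 0 (i :: s) isT.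
by rewrite raddf0 expr0 mul1r.
Qed.

Section TwoFactors.
Variables (L1 L2 : P).
Hypothesis habs : forall i, `|h i (L1 + L2)%R|%N = (`|h i L1|%N + `|h i L2|%N)%N.

(** The cyclotomic quotients are modules for their own weights, so that both
    directions can be tested on modules. *)
Lemma alive_split s : alive (L1 + L2) s <-> exists b,
  [/\ size b = size s, alive L1 (mask b s) & alive L2 (mask (map negb b) s)].
Proof.
case Es: s => [|i0 s'].
  split=> _; last exact: alive_nil.
  by exists [::]; split=> //; apply: alive_nil.
rewrite -Es; have nv L u : ~ vanishing Q i0 (fun i => `|h i L|%N) u -> alive L u.
  by move=> H; apply: contrapT => na; apply: H; exact: alive_vanishing.
split=> [|[b [sb]]].
  rewrite /alive -(cyc_en_val Q h (L1 + L2)) => es.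
  have AP := cyc_qhring Q i0 alpha h (size s) (seq_wt alpha s) (L1 + L2).
  have [mu n0|b [sb h1 h2]] := algebra_split (a := fun i => `|h i L1|%N)
    (w := fun i => `|h i L2|%N) AP _ erefl es; first by rewrite -habs; apply: cyc_pow.
  by exists b; split=> //; apply: nv.
rewrite /alive -(cyc_en_val Q h L1) -(cyc_en_val Q h L2) => e1 e2.
apply: nv; rewrite (_ : (fun i => _) = (fun i => `|h i L1| + `|h i L2|)%N); last first.
  by apply/funext => i; apply: habs.
have AP u L := cyc_qhring Q i0 alpha h (size u) (seq_wt alpha u) L.
apply: (algebra_shuffle Qii Qsym (AP (mask b s) L1) (AP (mask (map negb b) s) L2)
  _ _ sb erefl erefl e1 e2) => mu n0; exact: cyc_pow.
Qed.
End TwoFactors.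
End Alive.

(** * Shuffles of several sequences *)

Section Colours.
Variable T : Type.
Implicit Types (c : seq nat) (s : seq T) (b : bitseq).

(** A shuffle is encoded by the colouring of the positions that assigns to
    every entry the number of the sequence from which it comes. *)
Definition part k c s : seq T := mask [seq j == k | j <- c] s.

Lemma part_below l k c s : (k < l)%N -> size c = size s ->
  part k c s = part k (mask [seq (j < l)%N | j <- c] c) (mask [seq (j < l)%N | j <- c] s).
Proof.
rewrite /part => kl; elim: c s => [|j c IH] [|u s] //= [sc].
case: (ltnP j l) => jl /=; first by rewrite -IH.
by rewrite -IH //; case: eqP => // e; lia.
Qed.

Lemma part_last l c s : all (fun j => j < l.+1)%N c -> size c = size s ->
  part l c s = mask (map negb [seq (j < l)%N | j <- c]) s.
Proof.
rewrite /part; elim: c s => [|j c IH] [|u s] //= /andP[jl cl] [sc].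
by rewrite -IH //; congr (if _ then _ else _); lia.
Qed.

(** Reassembles a colouring from the positions [b] of the colours below [l] and
    the colouring [c] of these positions, inverting [part_below]. *)
Fixpoint paint l b c : seq nat :=
  match b with
  | [::] => [::]
  | true :: b' => head 0%N c :: paint l b' (behead c)
  | false :: b' => l :: paint l b' c
  end.

Lemma paintP l b c : size c = count id b -> all (fun j => j < l)%N c ->
  [/\ size (paint l b c) = size b, [seq (j < l)%N | j <- paint l b c] = b &
    mask b (paint l b c) = c].
Proof.
elim: b c => [|[] b IH] [|j c] //= sc.
- by move=> /andP[jl cl]; have [] := IH c _ cl; [by case: sc|move=> -> -> ->; rewrite jl].
- by move=> cl; have [] := IH [::] _ cl; [|move=> -> -> ->; rewrite ltnn].
by move=> cl; have [] := IH (j :: c) _ cl; [|move=> -> -> ->; rewrite ltnn].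
Qed.
Lemma paint_all l b c : all (fun j => j < l)%N c -> all (fun j => j < l.+1)%N (paint l b c).
Proof.
elim: b c => [|[] b IH] [|j c] //=.
- by move=> _; rewrite IH.
- by move=> /andP[jl /IH ->]; rewrite ltnS ltnW.
- by move=> _; rewrite ltnS leqnn IH.
by move=> h; rewrite ltnS leqnn IH.
Qed.
End Colours.

Lemma is_shuffle_colouring (T : Type) n l (nu : n.-tuple T) (nus : 'I_l -> seq T) :
  is_shuffle nu nus <-> exists c : seq nat,
    [/\ size c = n, all (fun j => j < l)%N c & forall k : 'I_l, part k c nu = nus k].
Proof.
have sub (B : {set 'I_n}) (b : pred nat) (c : seq nat) : size c = n ->
    (forall p : 'I_n, (p \in B) = b (nth 0%N c p)) ->
    [seq tnth nu p | p <- enum B] = mask (map b c) nu.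
  move=> sc hB; have -> : enum B = [seq p <- enum 'I_n | p \in B] by rewrite enumT.
  rewrite -[in RHS](map_tnth_enum nu) -map_mask filter_mask; congr (map _ (mask _ _)).
  have sE : size [seq p \in B | p <- enum 'I_n] = n by rewrite size_map size_enum_ord.
  apply: (@eq_from_nth _ false); rewrite sE; first by rewrite size_map sc.
  move=> i ltin.
  have x0 : 'I_n := Ordinal ltin.
  rewrite (nth_map x0) ?size_enum_ord // (nth_map 0%N) ?sc // hB nth_enum_ord //.
split=> [[B [dB cB eB]]|[c [sc cl ec]]].
  have ex (p : 'I_n) : exists k : 'I_l, p \in B k.
    by have := finset.in_setT p; rewrite -cB => /finset.bigcupP[k _ h]; exists k.
  have [f fP] := choice ex.
  have nf (p : 'I_n) : nth 0%N [seq (f p : nat) | p <- enum 'I_n] p = f p.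
    by rewrite (nth_map p) ?size_enum_ord // nth_ord_enum.
  exists [seq (f p : nat) | p <- enum 'I_n]; split.
  - by rewrite size_map size_enum_ord.
  - by apply/allP => _ /mapP[p _ ->]; apply: ltn_ord.
  move=> k; rewrite -eB; symmetry; apply: sub; first by rewrite size_map size_enum_ord.
  move=> p; rewrite nf; apply/idP/eqP => [hp|/val_inj <- //].
  apply/eqP; apply: contraT => nk.
  have /dB : f p != k by rewrite -val_eqE.
  by move/disjointFr => /(_ p (fP p)); rewrite hp.
have cl' (p : 'I_n) : (nth 0%N c p < l)%N by apply: (all_nthP 0%N cl); rewrite sc.
exists (fun k : 'I_l => [set p : 'I_n | nth 0%N c p == k]); split.
- move=> k k' nk; rewrite disjoint_subset; apply/fintype.subsetP => p; rewrite !inE => /eqP ->.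
  by rewrite val_eqE.
- apply/finset.setP => p; rewrite finset.in_setT; apply/finset.bigcupP.
  by exists (Ordinal (cl' p)) => //; rewrite inE.
move=> k; rewrite -ec; apply: sub => // p; by rewrite inE.
Qed.

Lemma seq_wt_shuffle (I : choiceType) (P : zmodType) (alpha : I -> P) n l
    (nu : n.-tuple I) (nus : 'I_l -> seq I) : is_shuffle nu nus ->
  seq_wt alpha nu = \sum_(k < l) seq_wt alpha (nus k).
Proof.
case=> B [dB cB eB]; rewrite /seq_wt big_tuple.
rewrite (eq_bigr (fun k => \sum_(p in B k) alpha (tnth nu p))); last first.
  by move=> k _; rewrite -eB big_map big_enum.
rewrite -(partition_disjoint_bigcup _ (fun p => alpha (tnth nu p)) dB) cB.
by apply: eq_bigl => p; rewrite finset.in_setT.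
Qed.

Section Colourings.
Variables (K : fieldType) (I : choiceType) (Q : I -> I -> {poly {poly K}}).
Hypothesis Qii : forall i, Q i i = 0.
Hypothesis Qsym : forall i j, Q i j = swapXY (Q j i).
Variables (P : zmodType) (alpha : I -> P) (h : I -> {additive P -> int}).
Local Notation alive := (alive Q alpha h).

(** The first [l] colours are split off from the last one by [alive_split]. *)
Lemma alive_colouring (w : nat -> P) l s :
  (forall k, (k < l)%N -> dominant h (w k)) ->
  alive (\sum_(k < l) w k) s <-> exists c : seq nat,
    [/\ size c = size s, all (fun j => j < l)%N c &
      forall k, (k < l)%N -> alive (w k) (part k c s)].
Proof.
elim: l s => [|l IH] s hw.
  rewrite big_ord0; split=> [/(alive0 Q alpha h s) ->|[c [sc cl _]]]; first by exists [::].
  have -> : s = [::] by case: c sc cl => [|j c] // /esym/size0nil.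
  exact: alive_nil.
have hw' k : (k < l)%N -> dominant h (w k) by move=> kl; apply: hw; apply: ltnW.
have habs i : `|h i (\sum_(k < l) w k + w l)%R|%N =
    (`|h i (\sum_(k < l) w k)%R|%N + `|h i (w l)|%N)%N.
  have d1 : 0 <= h i (\sum_(k < l) w k).
    by rewrite raddf_sum; apply: sumr_ge0 => k _; apply: hw'.
  have d2 : 0 <= h i (w l) by apply: hw.
  by rewrite raddfD; lia.
rewrite big_ord_recr; split=> [|[c [sc cl hc]]].
  move/(alive_split Qii Qsym alpha habs s) => [b [sb /(IH _ hw')[c [sc cl hc]] h2]].
  have cb : size c = count id b by rewrite sc size_mask.
  have [e1 e2 e3] := paintP cb cl.
  have al := paint_all b cl.
  exists (paint l b c); split=> [|//|k]; first by rewrite e1.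
  rewrite ltnS leq_eqVlt => /orP[/eqP ->|kl].
    by rewrite part_last ?e2 ?e1.
  by rewrite (part_below kl) ?e1 // e2 e3; apply: hc.
apply/(alive_split Qii Qsym alpha habs s); exists [seq (j < l)%N | j <- c].
split; first by rewrite size_map.
  apply/(IH _ hw'); exists (mask [seq (j < l)%N | j <- c] c); split.
  - by rewrite !size_mask ?size_map ?sc.
  - by rewrite -filter_mask filter_all.
  by move=> k kl; rewrite -part_below //; apply: hc; apply: ltnW.
by rewrite -part_last //; apply: hc.
Qed.
End Colourings.

Theorem corollary4p12 (K : fieldType) (I : choiceType)
    (a : I -> I -> int) (d : I -> nat)
    (P : zmodType) (alpha : I -> P) (h : I -> {additive P -> int})
    (form : P -> P -> rat) (Q : I -> I -> {poly {poly K}}) (fund : I -> P)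
    (a_gcm : gen_cartan_matrix a) (d_sym : symmetrizer a d)
    (a_real : realization a alpha h) (form_spec : weight_pairing a d alpha h form)
    (Q_spec : klr_polys a alpha form Q) (fund_spec : fundamental_weights h fund)
    (n : nat) (beta : P) (beta_Qn : in_Qplus alpha n beta)
    (nu : Ibeta alpha n beta)
    (l : nat) (t : 'I_l -> I) (Lam : P)
    (Lam_sum : Lam = \sum_(k < l) fund (t k)) :
  cyc_e Q h Lam nu != 0 <->
  exists nus : 'I_l -> seq I,
    [/\ is_shuffle (val nu) nus,
        beta = \sum_(k < l) seq_wt alpha (nus k)
      & forall k, cyc_e Q h (fund (t k)) (seq_Ibeta alpha (nus k)) != 0].
Proof.
have [Qii _ _ Qsym] := Q_spec.
case: nu => -[s ss] wt; have eb := eqP wt; have en := eqP ss; simpl in eb.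
subst n beta; have -> : exist _ (Tuple ss) wt = seq_Ibeta alpha s.
  by apply: val_inj; apply: val_inj.
pose w k := if insub k is Some k' then fund (t k') else 0.
have wE (k : 'I_l) : w k = fund (t k) by rewrite /w valK.
have wdom k : (k < l)%N -> dominant h (w k).
  by move=> kl; rewrite (wE (Ordinal kl)); case: (fund_spec (t (Ordinal kl))).
have -> : Lam = \sum_(k < l) w k by rewrite Lam_sum; apply: eq_bigr => k _; rewrite wE.
rewrite -/(alive Q alpha h (\sum_(k < l) w k) s).
split.
  move/(alive_colouring Qii Qsym alpha s wdom) => [c [sc cl hc]].
  have sh : is_shuffle (in_tuple s) (fun k : 'I_l => part k c s).
    by apply/is_shuffle_colouring; exists c.
  exists (fun k : 'I_l => part k c s); split=> //; first exact: seq_wt_shuffle sh.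
  by move=> k; rewrite -wE; apply: hc.
case=> nus [/is_shuffle_colouring[c [sc cl ec]] _ hn].
apply/(alive_colouring Qii Qsym alpha s wdom); exists c; split=> // k kl.
by rewrite -[k]/(nat_of_ord (Ordinal kl)) wE ec; apply: hn.
Qed.
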